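(* Let $n=3$, $k=2$, $\ell\ge0$. There is a constant $C_{\mathrm{conf}}^{2,\ell}$, which may depend on $\Omega$, $\ell$ and the mesh-regularity parameters but not on the mesh size, such that $$\inf_{\boldsymbol z\in\boldsymbol{\mathcal Z}_{\mathrm c,\operatorname{div}}(\Omega)}\|\boldsymbol v_h-\boldsymbol z\|_{L^2(\Omega)}\le C_{\mathrm{conf}}^{2,\ell}|\underline{\boldsymbol v}_h|_{\operatorname{div},h}$$ for every hybrid unknown $\underline{\boldsymbol v}_h$, where $\boldsymbol{\mathcal Z}_{\mathrm c,\operatorname{div}}(\Omega)=\boldsymbol H(\operatorname{div};\Omega)\cap\operatorname{Ker}(\operatorname{div})$, and, with this same constant, the following holds: if a hybrid unknown $\underline{\boldsymbol v}_h$ satisfies $$(\boldsymbol v_h,\boldsymbol z)_\Omega=0\qquad\forall\boldsymbol z\in\boldsymbol{\mathcal Z}_{\mathrm c,\operatorname{div}}(\Omega),$$ then $$\|\boldsymbol v_h\|_{L^2(\Omega)}\le C_{\mathrm{conf}}^{2,\ell}\,|\underline{\boldsymbol v}_h|_{\operatorname{div},h}.$$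
   Context: **Mesh.** $\Omega\subset\mathbb R^3$ is a bounded Lipschitz polyhedral domain, of arbitrary topology. A $d$-cell is a closed polytopal subset of a $d$-dimensional affine subspace of $\mathbb R^3$, homeomorphic to a closed $d$-ball. A mesh $\mathcal M_h$ of $\Omega$ is a finite collection of cells of dimensions $0,\dots,3$ such that the union of the $3$-cells is $\overline\Omega$, the boundary of every $d$-cell is a union of $(d-1)$-cells, two distinct cells of the same dimension intersect in the empty set or in a union of lower-dimensional cells, and distinct cells $e,f$ with $\dim e\le\dim f$ and $e\cap f\neq\emptyset$ satisfy $e\cap f\subset\partial f$; the cells form a finite regular cellular decomposition of $\overline\Omega$. $\mathcal T_h$, $\mathcal F_h$ are the sets of $3$-cells and $2$-cells (faces), $\mathcal F_T$ the set of faces contained in $\partial T$, $h_T,h_F$ diameters. Every face $F$ is oriented, with unit normal $\boldsymbol n_F$. The mesh admits a conforming simplicial submesh $\mathcal S_h$ (each $d$-cell is a union of $d$-simplices of it), and the mesh family is regular: there is $\varrho\in(0,1)$ independent of $h$ such that every tetrahedron of $\mathcal S_h$ has inradius at least $\varrho$ times its diameter and every tetrahedron contained in $T\in\mathcal T_h$ has diameter at least $\varrho h_T$. Consequently the induced submeshes of cells are uniformly shape-regular with uniformly bounded cardinality and simplex diameters comparable with the cell diameter, and incident cells have comparable sizes and bounded number. **Hybrid unknowns.** $\mathcal P^r(X)$ is the space of polynomials of total degree $\le r$ on $X$. A hybrid unknown is $\underline{\boldsymbol v}_h=((\boldsymbol v_T)_{T\in\mathcal T_h},(v_{F,n})_{F\in\mathcal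 F_h})$ with $\boldsymbol v_T\in\mathcal P^\ell(T)^3$ and $v_{F,n}\in\mathcal P^\ell(F)$ (for two-forms the admissible face space is necessarily the full space $\mathcal P^\ell(F)$); $\boldsymbol v_h$ is the broken polynomial field with $(\boldsymbol v_h)_{|T}=\boldsymbol v_T$, and $$|\underline{\boldsymbol v}_h|_{\operatorname{div},h}^2=\sum_{T\in\mathcal T_h}\Bigl(\|\operatorname{div}\boldsymbol v_T\|_{L^2(T)}^2+\sum_{F\in\mathcal F_T}h_F^{-1}\|\boldsymbol v_{T|F}\cdot\boldsymbol n_F-v_{F,n}\|_{L^2(F)}^2\Bigr).$$ $(\cdot,\cdot)_\Omega$ is the $L^2(\Omega)$ inner product. *)

(* Defs.v *)
From HB Require Import structures.
From mathcomp Require Import all_boot all_order all_algebra.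
From mathcomp Require Import all_classical all_reals all_analysis.
(* The notations of mpoly clash with those of the analysis library. *)
From mathcomp Require Import -(notations) mpoly.

Set Implicit Arguments.
Unset Strict Implicit.
Unset Printing Implicit Defensive.

Import Order.TTheory GRing.Theory Num.Theory.
Import numFieldNormedType.Exports.

Local Open Scope classical_set_scope.
Local Open Scope ring_scope.

(* The library norm of 'rV[R]_3 is the sup norm: it has the right topology, but
   lengths, diameters, radii and L2 norms need the Euclidean one. *)
Section Euclidean.
Variable R : realType.
Local Notation P := 'rV[R]_3.

Definition dotp (u v : P) : R := \sum_i u 0 i * v 0 i.
Definition enorm (u : P) : R := Num.sqrt (dotp u u).

Definition diam (A : set P) : R :=
  sup [set r | exists x y, [/\ A x, A y & r = enorm (x - y)]].

Definition inradius (A : set P) : R :=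
  sup [set r | 0 <= r /\ exists x, forall y, enorm (y - x) <= r -> A y].

Definition orthogonal_mx (Q : 'M[R]_3) : Prop := Q *m Q^T = 1%:M.

End Euclidean.

Section Polytopes.
Variable R : realType.
Local Notation P := 'rV[R]_3.

Definition conv_hull (I : finType) (x : I -> P) (s : {set I}) : set P :=
  [set y | exists a : I -> R, [/\ forall i, i \in s -> 0 <= a i,
     \sum_(i in s) a i = 1 & y = \sum_(i in s) a i *: x i]].

Definition affine_indep (I : finType) (x : I -> P) (s : {set I}) : Prop :=
  forall a : I -> R, \sum_(i in s) a i = 0 -> \sum_(i in s) a i *: x i = 0 ->
    forall i, i \in s -> a i = 0.

Definition polytopal (d : nat) (A : set P) : Prop :=
  exists (m : nat) (x : 'I_m -> 'I_d.+1 -> P),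
    (forall j, affine_indep (x j) [set: 'I_d.+1]%SET) /\
    A = \bigcup_(j in [set: 'I_m]) conv_hull (x j) [set: 'I_d.+1]%SET.

Definition affine_hull (A : set P) : set P :=
  [set y | exists (m : nat) (x : 'I_m -> P) (a : 'I_m -> R),
     [/\ forall i, A (x i), \sum_i a i = 1 & y = \sum_i a i *: x i]].

(* Interior and boundary relative to the affine hull. A point is its own
   relative interior, so 0-cells have empty boundary. *)
Definition rel_interior (A : set P) : set P :=
  [set x | A x /\ \forall y \near x, affine_hull A y -> A y].
Definition rel_boundary (A : set P) : set P := A `\` rel_interior A.

Definition affine_subspace (d : nat) (E : set P) : Prop :=
  exists (o : P) (B : 'M[R]_(d, 3)),
    row_free B /\ E = [set x | exists u : 'rV[R]_d, x = o + u *m B].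

Definition closed_ball3 (d : nat) : set P :=
  [set x | enorm x <= 1 /\ forall i : 'I_3, (d <= i)%N -> x 0 i = 0].

Definition homeomorphic (A B : set P) : Prop :=
  exists f g : P -> P,
    [/\ {within A, continuous f}, {within B, continuous g},
        forall x, A x -> B (f x) /\ g (f x) = x &
        forall y, B y -> A (g y) /\ f (g y) = y].

Definition is_cell (d : nat) (A : set P) : Prop :=
  [/\ closed A, polytopal d A,
      exists2 E, affine_subspace d E & A `<=` E &
      homeomorphic A (closed_ball3 d)].

End Polytopes.

Section Domain.
Variable R : realType.
Local Notation P := 'rV[R]_3.

(* Around each boundary point, in suitable orthonormal coordinates w centred
   there, Omega is the strict subgraph of a Lipschitz function. *)
Definition lipschitz_boundary (Omega : set P) : Prop :=
  forall x, (closure Omega `\` Omega) x ->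
  exists (Q : 'M[R]_3) (r L : R) (gam : R * R -> R),
    [/\ orthogonal_mx Q, 0 < r,
        forall s t : R * R, `|gam s - gam t| <= L * `|s - t| &
        forall y : P, enorm (y - x) < r ->
          let w := (y - x) *m Q^T in
          Omega y <-> w 0 ord_max < gam (w 0 0, w 0 1)].

Definition lipschitz_polyhedral_domain (Omega : set P) : Prop :=
  [/\ open Omega /\ connected Omega, Omega !=set0, bounded_set Omega,
      polytopal 3 (closure Omega) & lipschitz_boundary Omega].

End Domain.

Section Fields.
Variable R : realType.
Local Notation P := 'rV[R]_3.

(* Row vectors carry no measurable structure in the library: sets and functions
   are pulled back to R * R * R with its product Lebesgue measure. Integrands
   are Borel, so every L2 class has a representative here. The real-valued
   integral is used only on integrable functions. *)
Definition vec3 (p : R * R * R) : P := \row_i [:: p.1.1; p.1.2; p.2]`_i.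

Definition lebesgue2 :=
  ((@lebesgue_measure R) \x (@lebesgue_measure R))%E.
Definition lebesgue3 :=
  (((@lebesgue_measure R) \x (@lebesgue_measure R)) \x (@lebesgue_measure R))%E.

Definition vint (D : set P) (f : P -> R) : R :=
  \int[lebesgue3]_(p in vec3 @^-1` D) f (vec3 p).

Definition L2fun (D : set P) (f : P -> R) : Prop :=
  measurable_fun (vec3 @^-1` D) (fun p => f (vec3 p)) /\
  (\int[lebesgue3]_(p in vec3 @^-1` D) (f (vec3 p) ^+ 2)%:E < +oo)%E.

Definition L2field (D : set P) (z : P -> P) : Prop :=
  forall i, L2fun D (fun x => z x 0 i).

Definition L2inner (D : set P) (u v : P -> P) : R :=
  vint D (fun x => dotp (u x) (v x)).

Definition L2norm (D : set P) (u : P -> P) : R := Num.sqrt (L2inner D u u).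

Definition partial (i : 'I_3) (f : P -> R) : P -> R :=
  fun x => 'D_(delta_mx 0 i) f x.

Definition smooth (f : P -> R) : Prop :=
  forall (s : seq 'I_3) (x : P), differentiable (foldr partial f s) x.

Definition test_function (Omega : set P) (phi : P -> R) : Prop :=
  smooth phi /\ exists K : set P,
    [/\ compact K, K `<=` Omega & forall x, ~ K x -> phi x = 0].

Definition grad (f : P -> R) (x : P) : P := \row_i partial i f x.

Definition weak_div (Omega : set P) (z : P -> P) (g : P -> R) : Prop :=
  forall phi, test_function Omega phi ->
    vint Omega (fun x => dotp (z x) (grad phi x)) =
    - vint Omega (fun x => g x * phi x).

Definition Hdiv (Omega : set P) (z : P -> P) : Prop :=
  L2field Omega z /\ exists2 g, L2fun Omega g & weak_div Omega z g.

(* The weak divergence is unique almost everywhere, so the second clause says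
   that the divergence provided by Hdiv vanishes. *)
Definition Zdiv (Omega : set P) : set (P -> P) :=
  [set z | Hdiv Omega z /\ weak_div Omega z (fun=> 0)].

End Fields.

Section Mesh.
Variable R : realType.
Local Notation P := 'rV[R]_3.

(* A face F carries an origin and an orthogonal matrix whose first two rows
   span its plane and whose last row is the unit normal n_F. The tangent rows
   serve only to define surface integrals, which do not depend on them. *)
Record mesh := Mesh {
  cell : finType;
  cdim : cell -> nat;
  carrier : cell -> set P;
  forigin : cell -> P;
  fframe : cell -> 'M[R]_3 }.

Definition normal (M : mesh) (F : cell M) : P := row ord_max (fframe F).

Definition fchart (M : mesh) (F : cell M) (s : R * R) : P :=
  forigin F + s.1 *: row 0 (fframe F) + s.2 *: row 1 (fframe F).

Definition union_of_cells (M : mesh) (D : pred nat) (A : set P) : Prop :=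
  exists S : set (cell M), (forall e, S e -> D (cdim e)) /\
    A = \bigcup_(e in S) carrier e.

Definition is_mesh (Omega : set P) (M : mesh) : Prop :=
  [/\ injective (@carrier M),
      forall c : cell M, (cdim c <= 3)%N /\ is_cell (cdim c) (carrier c),
      [/\ \bigcup_(T in [set T : cell M | cdim T = 3%N]) carrier T
            = closure Omega,
          forall c : cell M,
            union_of_cells M (fun d => d.+1 == cdim c)
              (rel_boundary (carrier c)),
          forall c c' : cell M, c <> c' -> cdim c = cdim c' ->
            union_of_cells M (fun d => d < cdim c)%N
              (carrier c `&` carrier c') &
          forall e f : cell M, e <> f -> (cdim e <= cdim f)%N ->
            carrier e `&` carrier f !=set0 ->
            carrier e `&` carrier f `<=` rel_boundary (carrier f)],
      (* regular cellular decomposition: the open cells partition the closure,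
         which also excludes cells outside it *)
      trivIset [set: cell M] (fun c => rel_interior (carrier c)) /\
      \bigcup_(c in [set: cell M]) rel_interior (carrier c) = closure Omega &
      forall F : cell M, cdim F = 2%N -> orthogonal_mx (fframe F) /\
        forall x, carrier F x -> dotp (x - forigin F) (normal F) = 0].

(* Conformity: two simplices meet in the hull of their common vertices. *)
Record complex := Complex {
  vertex : finType;
  position : vertex -> P;
  simplices : {set {set vertex} } }.
Arguments simplices : clear implicits.

Definition hull (S : complex) (s : {set vertex S}) : set P :=
  conv_hull (@position S) s.

Definition is_complex (S : complex) : Prop :=
  [/\ forall s : {set vertex S}, s \in simplices S -> s != finset.set0,
      forall s t : {set vertex S}, s \in simplices S -> t \subset s ->
        t != finset.set0 -> t \in simplices S,
      forall s : {set vertex S}, s \in simplices S ->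
        affine_indep (@position S) s &
      forall s t : {set vertex S}, s \in simplices S -> t \in simplices S ->
        hull s `&` hull t = hull (s :&: t)%SET].

Definition simplicial_submesh (Omega : set P) (M : mesh) (S : complex) : Prop :=
  [/\ is_complex S,
      \bigcup_(s in [set s | s \in simplices S]) hull s = closure Omega &
      forall c : cell M, exists A : set {set vertex S},
        (forall s, A s -> s \in simplices S /\ #|s| = (cdim c).+1) /\
        carrier c = \bigcup_(s in A) hull s].

Definition regular_mesh (rho : R) (M : mesh) (S : complex) : Prop :=
  forall s : {set vertex S}, s \in simplices S -> #|s| = 4%N ->
    rho * diam (hull s) <= inradius (hull s) /\
    forall T : cell M, cdim T = 3%N -> hull s `<=` carrier T ->
      rho * diam (carrier T) <= diam (hull s).

End Mesh.

Section Hybrid.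
Variable R : realType.
Local Notation P := 'rV[R]_3.
Local Notation poly3 := (mpoly 3 R).

Definition peval (p : poly3) (x : P) : R := meval (fun i => x 0 i) p.

(* msize is 1 + the total degree. *)
Definition poly_deg_le (l : nat) (p : poly3) : Prop :=
  (msize p <= l.+1)%N.

(* P^l(T) is identified with the polynomials in three variables, and P^l(F) is
   the space of restrictions to F of such polynomials; hface F is only ever
   evaluated on F. Components at cells of other dimensions are ignored. *)
Record hybrid (M : mesh R) := Hybrid {
  hcell : cell M -> 'I_3 -> poly3;
  hface : cell M -> poly3 }.

Definition hybrid_deg (l : nat) (M : mesh R) (v : hybrid M) : Prop :=
  (forall T : cell M, cdim T = 3%N -> forall i, poly_deg_le l (hcell v T i)) /\
  (forall F : cell M, cdim F = 2%N -> poly_deg_le l (hface v F)).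

Definition cell_field (M : mesh R) (v : hybrid M) (T : cell M) (x : P) : P :=
  \row_i peval (hcell v T i) x.

Definition cell_div (M : mesh R) (v : hybrid M) (T : cell M) (x : P) : R :=
  peval (\sum_i mderiv i (hcell v T i)) x.

(* v_h, set to 0 on the (null) skeleton. *)
Definition broken (M : mesh R) (v : hybrid M) (x : P) : P :=
  \sum_(T : cell M | cdim T == 3%N)
     (\1_(interior (carrier T)) x : R) *: cell_field v T x.

Definition fint (M : mesh R) (F : cell M) (g : P -> R) : R :=
  \int[@lebesgue2 R]_(s in fchart F @^-1` carrier F) g (fchart F s).

Definition face_of (M : mesh R) (F T : cell M) : bool :=
  (cdim F == 2%N) && `[< carrier F `<=` rel_boundary (carrier T) >].

Definition div_seminorm (M : mesh R) (v : hybrid M) : R :=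
  Num.sqrt (\sum_(T : cell M | cdim T == 3%N)
    (vint (carrier T) (fun x => cell_div v T x ^+ 2) +
     \sum_(F : cell M | face_of F T) (diam (carrier F))^-1 *
       fint F (fun x =>
         (dotp (cell_field v T x) (normal F) - peval (hface v F) x) ^+ 2))).

End Hybrid.

(* Main.v *)
(* Let V be the space of gradients of test functions: its L2-orthogonal
   complement consists of divergence-free fields, and the distance from v_h to
   it is the norm of the projection of v_h on the closure of V. So it suffices
   to bound (v_h, grad phi) by C |v_h|_div ||grad phi||. Integrating by parts on
   each tetrahedron of the submesh leaves - int phi div v_T and the fluxes of
   phi v_T. The two fluxes through a triangle interior to a mesh cell cancel; on
   a triangle of a mesh face F one may replace v_T by v_T - v_F n_F, because the
   fluxes of phi v_F n_F cancel as well. It remains to control ||phi|| and the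
   norms of phi on the faces, weighted by h_F ^ (1/2): this is done by a
   Friedrichs and a trace inequality, both obtained from the divergence theorem
   for the field phi ^ 2 (y - p). *)
Require Import Defs.
From HB Require Import structures.
From mathcomp Require Import all_boot all_order all_algebra perm.
From mathcomp Require Import all_classical all_reals all_analysis.
From mathcomp Require Import -(notations) mpoly.
From mathcomp Require Import measurable_realfun ring lra.

Set Implicit Arguments.
Unset Strict Implicit.
Unset Printing Implicit Defensive.

Import Order.TTheory GRing.Theory Num.Theory.
Import numFieldNormedType.Exports.
Local Open Scope classical_set_scope.
Local Open Scope ring_scope.

(** * Integration over R^3 and affine changes of variables *)

(** The cancellation of fluxes rests on a fact absent from the definition of a complex: a triangle
    meeting Omega lies in exactly two tetrahedra, on opposite sides of its plane. It is derived from
    conformity and from the covering of the closure of Omega. A triangle that misses Omega requires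
    no such count, because phi vanishes on it.

    Bounds are first proved in the form 2 |X| <= lam a + lam^-1 b for every lam > 0. In this form
    they add up over tetrahedra and triangles without any Cauchy-Schwarz inequality for sums, and
    [young_optimal] turns the total into X^2 <= a b once, at the end.

    The squared constant is (24 rho^-2 + 1) D2, where D2 bounds |y|^2 on the closure of Omega. One
    factor rho^-1 compares a mesh cell with a tetrahedron inside it, the other the diameter of this
    tetrahedron with its inradius. Each of its 4 faces costs 4 ||phi||^2 + 4 D2 ||grad phi||^2, and
    2 ||phi||^2 <= D2 ||grad phi||^2, so that 24 = 4 (2 + 4). *)

Section Tonelli.
Variable R : realType.
Local Notation mu := (@lebesgue_measure R).

(* The library's canonical sigma-finite structure on products only fires for
   subprobabilities, hence this explicit one. *)
Definition leb2 : set (measurableTypeR R * measurableTypeR R) -> \bar R := (mu \x mu)%E.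

HB.instance Definition _ := measure_function.Measure.copy leb2 (mu \x mu)%E.

Let leb2_sigma_finite : sigma_finite setT leb2.
Proof.
have /sigma_finiteP[F [TF ndF Foo]] := sigma_finiteT mu.
exists (fun n => F n `*` F n).
  rewrite -setXTT TF predeqE => -[x y]; split.
    move=> [/= [n _ Fnx] [k _ Gky]]; exists (maxn n k) => //; split.
    - by move: x Fnx; exact/subsetPset/ndF/leq_maxl.
    - by move: y Gky; exact/subsetPset/ndF/leq_maxr.
  by move=> [n _ []/= ? ?]; split; exists n.
move=> k; have [? ?] := Foo k.
split; first exact: measurableX.
by rewrite /leb2 product_measure1E// lte_mul_pinfty// ge0_fin_numE.
Qed.

HB.instance Definition _ := Measure_isSigmaFinite.Build _ _ _ leb2 leb2_sigma_finite.

Definition leb3 : set (measurableTypeR R * measurableTypeR R * measurableTypeR R) -> \bar R :=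
  (leb2 \x mu)%E.

HB.instance Definition _ := measure_function.Measure.copy leb3 (leb2 \x mu)%E.

Lemma tonelli2 (f : R * R -> \bar R) : measurable_fun setT f -> (forall x, (0 <= f x)%E) ->
  (\int[leb2]_p f p = \int[mu]_x \int[mu]_y f (x, y))%E.
Proof.
by move=> mf f0; rewrite (@fubini_tonelli1 _ _ _ _ _ mu mu f mf f0).
Qed.

Lemma tonelli2_swap (f : R * R -> \bar R) : measurable_fun setT f -> (forall x, (0 <= f x)%E) ->
  (\int[mu]_x \int[mu]_y f (x, y) = \int[mu]_y \int[mu]_x f (x, y))%E.
Proof. by move=> mf f0; exact: (@fubini_tonelli _ _ _ _ _ mu mu f mf f0). Qed.

Lemma tonelli21 (f : R * R * R -> \bar R) : measurable_fun setT f -> (forall x, (0 <= f x)%E) ->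
  (\int[leb3]_p f p = \int[leb2]_p \int[mu]_z f (p.1, p.2, z))%E.
Proof.
move=> mf f0; rewrite (@fubini_tonelli1 _ _ _ _ _ leb2 mu f mf f0) //.
by apply: eq_integral => -[x y] _.
Qed.

Lemma measurable_inner (f : R * R * R -> \bar R) : measurable_fun setT f -> (forall x, (0 <= f x)%E) ->
  measurable_fun setT (fun p : R * R => \int[mu]_z f (p.1, p.2, z))%E.
Proof.
move=> mf f0; under eq_fun do rewrite -surjective_pairing.
exact: (@measurable_fun_fubini_tonelli_F _ _ _ _ _ mu f mf f0).
Qed.

Lemma tonelli3 (f : R * R * R -> \bar R) : measurable_fun setT f -> (forall x, (0 <= f x)%E) ->
  (\int[leb3]_p f p = \int[mu]_x \int[mu]_y \int[mu]_z f (x, y, z))%E.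
Proof.
move=> mf f0; rewrite tonelli21 // tonelli2 //; first exact: measurable_inner.
by move=> x; apply: integral_ge0.
Qed.
End Tonelli.

(** * Borel sets of row vectors, through coordinates *)

Section BorelVec3.
Variable R : realType.
Local Notation P := 'rV[R]_3.

Lemma ord3P (T : 'I_3 -> Prop) : T 0 -> T 1 -> T (lift ord0 (lift ord0 ord0)) -> forall i, T i.
Proof.
move=> T0 T1 T2 [[|[|[|//]]] Hi].
- by have -> : Ordinal Hi = 0 by exact: val_inj.
- by have -> : Ordinal Hi = 1 by exact: val_inj.
- by have -> : Ordinal Hi = lift ord0 (lift ord0 ord0) by exact: val_inj.
Qed.

Lemma vec3E (p : R * R * R) : (vec3 p 0 0 = p.1.1) * (vec3 p 0 1 = p.1.2)
  * (vec3 p 0 (lift ord0 (lift ord0 ord0)) = p.2) * (vec3 p 0 ord_max = p.2).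
Proof. by rewrite !mxE. Qed.

Definition unvec3 (x : P) : R * R * R := (x 0 0, x 0 1, x 0 ord_max).

Lemma ord_max3 : ord_max = lift ord0 (lift ord0 ord0) :> 'I_3.
Proof. exact: val_inj. Qed.

Lemma unvec3K : cancel unvec3 (@vec3 R).
Proof.
move=> x; apply/rowP; apply: ord3P; rewrite vec3E //=.
by rewrite -ord_max3.
Qed.

Lemma vec3K : cancel (@vec3 R) unvec3.
Proof. by move=> [[x y] z]; rewrite /unvec3 !vec3E. Qed.

Lemma ball_rV3 (x y : P) e : 0 < e -> (forall i, `|x 0 i - y 0 i| < e) -> ball x e y.
Proof. by move=> e0 H; split=> // i j; rewrite ord1; exact: H. Qed.

Lemma ball_rV3P (x y : P) e : ball x e y -> forall i, `|x 0 i - y 0 i| < e.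
Proof. by move=> [_ H] i; exact: H. Qed.

Lemma rat_approx (x e : R) : 0 < e -> exists q : rat, `|x - ratr q| < e.
Proof.
move=> e0; have [|q] := @rat_in_itvoo _ (x - e) (x + e); first lra.
by rewrite in_itv /= => /andP[q1 q2]; exists q; rewrite ltr_norml; lra.
Qed.

(** An open set is the countable union of the sup-norm balls with rational centre and radius 1 / (n
    + 1) that it contains, and such a ball is a product of three intervals. *)
Lemma open_measurable_vec3 (U : set P) : open U -> measurable (@vec3 R @^-1` U).
Proof.
move=> oU.
pose c (q : rat * rat * rat) : P := vec3 (ratr q.1.1, ratr q.1.2, ratr q.2).
pose B (i : (rat * rat * rat) * nat) : set (R * R * R) :=
  if `[< ball (c i.1) i.2.+1%:R^-1 `<=` U >] then
    [set p | forall j, `|c i.1 0 j - vec3 p 0 j| < i.2.+1%:R^-1] else set0.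
have -> : @vec3 R @^-1` U = \bigcup_i B i.
  apply/seteqP; split => [p /= Up|p [i _]]; last first.
    rewrite /B; case: asboolP => [sub /= H|//]; apply: sub.
    by apply: ball_rV3 => //; rewrite invr_gt0.
  have /nbhs_ballP[e /= e0 sub] := open_nbhs_nbhs (conj oU Up).
  have [n nP] : exists n, n.+1%:R^-1 < e / 2 :> R.
    have e2 : 0 < e / 2 by lra.
    have [N _ HN] := near_infty_natSinv_lt (PosNum e2).
    by exists N; exact: (HN N (leqnn N)).
  have n0 : 0 < n.+1%:R^-1 :> R by rewrite invr_gt0.
  have [q1 Hq1] := @rat_approx p.1.1 n.+1%:R^-1 n0.
  have [q2 Hq2] := @rat_approx p.1.2 n.+1%:R^-1 n0.
  have [q3 Hq3] := @rat_approx p.2 n.+1%:R^-1 n0.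
  have H j : `|c (q1, q2, q3) 0 j - vec3 p 0 j| < n.+1%:R^-1.
    by move: j; apply: ord3P; rewrite !vec3E //= distrC.
  exists ((q1, q2, q3), n) => //; rewrite /B asboolT //= => y /ball_rV3P yb.
  apply: sub; apply: ball_rV3 => // j.
  apply: le_lt_trans (ler_distD (c (q1, q2, q3) 0 j) _ _) _.
  by rewrite (distrC (vec3 p 0 j)); rewrite [e]splitr; exact: (ltrD (lt_trans (H j) nP) (lt_trans (yb j) nP)).
apply: countable_bigcupT_measurable; first exact: countableP.
move=> i; rewrite /B; case: ifP => // _.
have -> : [set p | forall j, `|c i.1 0 j - vec3 p 0 j| < i.2.+1%:R^-1] =
  [set p : R * R * R | `|c i.1 0 0 - p.1.1| < i.2.+1%:R^-1] `&`
  ([set p : R * R * R | `|c i.1 0 1 - p.1.2| < i.2.+1%:R^-1] `&`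
  [set p : R * R * R | `|c i.1 0 (lift ord0 (lift ord0 ord0)) - p.2| < i.2.+1%:R^-1]).
  apply/seteqP; split => [p /= H|p /= [H1 [H2 H3]]].
    by do !split; [move: (H 0)|move: (H 1)|move: (H (lift ord0 (lift ord0 ord0)))]; rewrite vec3E.
  by apply: ord3P; rewrite vec3E.
have M (g : R * R * R -> R) (a b : R) : measurable_fun setT g ->
    measurable [set p | `|a - g p| < b].
  move=> mg; have := mg measurableT _ (measurable_itv `](a - b), (a + b)[).
  rewrite setTI; congr measurable; apply/seteqP; split => p /=;
    rewrite in_itv /= ltr_norml => /andP[? ?]; apply/andP; split; lra.
apply: measurableI; [|apply: measurableI]; apply: M => //; exact: measurableT_comp.
Qed.

Lemma closed_measurable_vec3 (U : set P) : closed U -> measurable (@vec3 R @^-1` U).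
Proof.
move=> cU; rewrite -[U]setCK preimage_setC; apply: measurableC.
exact: (open_measurable_vec3 (closed_openC cU)).
Qed.

Lemma continuous_measurable_vec3 (f : P -> R) : continuous f ->
  measurable_fun setT (f \o @vec3 R).
Proof.
move=> cf; apply: (measurability _ (RGenOInfty.measurableE R)) => //.
move=> /= _ [_ [a ->]] <-; rewrite setTI.
rewrite comp_preimage; apply: open_measurable_vec3.
by move/continuousP: cf; apply; exact: interval_open.
Qed.

End BorelVec3.

(** * Change of variables: one coordinate, triangular maps, invertible matrices *)

Section AffineSubstitution.
Variable R : realType.
Local Notation mu := (@lebesgue_measure R).

(** The right-hand side is a measure in [A] with the value y - x on every half-open interval, and
    Lebesgue measure is characterised by these values. For a < 0 the preimage is half-open on the
    other side, with the same length. *)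
Lemma lebesgue_measure_affine (a b : R) (A : set (measurableTypeR R)) : a != 0 -> measurable A ->
  mu A = (`|a|%:E * mu ((fun t => a * t + b)%R @^-1` A))%E.
Proof.
move=> a0 mA.
have mT : measurable_fun setT ((fun t => a * t + b) : measurableTypeR R -> measurableTypeR R).
  by apply: measurable_funD => //; exact: mulrl_measurable.
pose nu : {measure set _ -> \bar R} :=
  mscale (NngNum (normr_ge0 a)) (measure_function_pushforward__canonical__measure_function_Measure mu mT).
rewrite -[RHS]/(nu A).
apply: lebesgue_measure_unique => //= _ [[x y]] _ <-.
rewrite /nu /mscale /= /pushforward.
have [a_gt0|a_lt0|] := ltrgt0P a; last by move=> /eqP; rewrite (negbTE a0).
  rewrite [X in (_ * lebesgue_measure X)%E](_ : _ = `](x - b) / a, (y - b) / a]%classic); last first.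
    apply/seteqP; split => t /=; rewrite !in_itv /= ltr_pdivrMr // ler_pdivlMr // (mulrC t) => /andP[? ?]; apply/andP; split; lra.
  rewrite !lebesgue_measure_itv /= !lte_fin ltr_pM2r ?invr_gt0 // ltrD2r.
  case: ifP => _; last by rewrite mule0.
  by rewrite -EFinM; congr EFin; field; rewrite gt_eqF.
rewrite [X in (_ * lebesgue_measure X)%E](_ : _ = `[(y - b) / a, (x - b) / a[%classic); last first.
  apply/seteqP; split => t /=; rewrite !in_itv /= ltr_ndivlMr // ler_ndivrMr // (mulrC t) => /andP[? ?]; apply/andP; split; lra.
rewrite !lebesgue_measure_itv /= !lte_fin ltr_nM2r ?invr_lt0 // ltrD2r.
case: ifP => _; last by rewrite mule0.
by rewrite -EFinM; congr EFin; field; rewrite lt_eqF.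
Qed.

Lemma integral_affine (a b : R) (f : R -> \bar R) : a != 0 ->
  measurable_fun setT f -> (forall x, 0 <= f x)%E ->
  (`|a|%:E * \int[mu]_t f (a * t + b)%R = \int[mu]_t f t)%E.
Proof.
move=> a0 mf f0.
have mT : measurable_fun setT ((fun t => a * t + b) : measurableTypeR R -> measurableTypeR R).
  by apply: measurable_funD => //; exact: mulrl_measurable.
pose nu : {measure set _ -> \bar R} :=
  mscale (NngNum (normr_ge0 a)) (measure_function_pushforward__canonical__measure_function_Measure mu mT).
rewrite [RHS](@eq_measure_integral _ _ _ _ nu) /=; last first.
  by move=> A mA _; rewrite (lebesgue_measure_affine b a0 mA).
by rewrite ge0_integral_mscale //= ge0_integral_pushforward //= preimage_setT.
Qed.

End AffineSubstitution.

Section Substitution3.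
Variable R : realType.
Local Notation mu := (@lebesgue_measure R).
Local Notation R3 := (R * R * R)%type.

(** The number [c] stands for the absolute Jacobian of [T]. Only nonnegative integrands are tested,
    so that Tonelli applies freely; signed ones are recovered by [integral_subst_signed]. *)
Definition subst3 (T : R3 -> R3) (c : R) : Prop :=
  [/\ measurable_fun setT T, 0 <= c & forall f : R3 -> \bar R, measurable_fun setT f ->
    (forall x, 0 <= f x)%E -> (\int[@leb3 R]_u f u = \int[@leb3 R]_u (c%:E * f (T u)))%E].

Lemma subst3_comp T c T' c' : subst3 T c -> subst3 T' c' -> subst3 (T \o T') (c * c').
Proof.
move=> [mT c0 H] [mT' c0' H']; split; [exact: measurableT_comp|exact: mulr_ge0|].
move=> f mf f0; rewrite H // H'; last 2 first.
- by apply: emeasurable_funM => //; exact: measurableT_comp.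
- by move=> x; rewrite mule_ge0 // lee_fin.
by apply: eq_integral => u _; rewrite muleA -EFinM mulrC.
Qed.

Lemma measurable_triangular (a b1 d e b2 g h k b3 : R) : measurable_fun setT
  (fun u : R3 => (a * u.1.1 + b1, d * u.1.2 + (e * u.1.1 + b2),
            g * u.2 + (h * u.1.1 + k * u.1.2 + b3))).
Proof.
have m11 : measurable_fun setT (fun u : R3 => u.1.1) by exact: measurableT_comp.
have m12 : measurable_fun setT (fun u : R3 => u.1.2) by exact: measurableT_comp.
have m2 : measurable_fun setT (fun u : R3 => u.2) by exact: measurable_snd.
have mc (c : R) (f : R3 -> R) : measurable_fun setT f -> measurable_fun setT (fun u => c * f u).
  by move=> mf; apply: measurable_funM.
apply: measurable_fun_pair; first apply: measurable_fun_pair.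
- by apply: measurable_funD => //; exact: mc.
- by apply: measurable_funD; [exact: mc|apply: measurable_funD => //; exact: mc].
- by apply: measurable_funD; [exact: mc|apply: measurable_funD => //;
    apply: measurable_funD; exact: mc].
Qed.

(** For fixed first coordinates, the innermost integral undergoes a one-dimensional affine change of
    variable. Tonelli then allows the same for the second coordinate, and last for the first. *)
Lemma subst3_triangular (a b1 d e b2 g h k b3 : R) : a != 0 -> d != 0 -> g != 0 ->
  subst3 (fun u => (a * u.1.1 + b1, d * u.1.2 + (e * u.1.1 + b2),
            g * u.2 + (h * u.1.1 + k * u.1.2 + b3))) (`|a| * `|d| * `|g|).
Proof.
move=> a0 d0 g0; split; [exact: measurable_triangular|by rewrite !mulr_ge0|].
move=> f mf f0.
have mfT := measurableT_comp mf (measurable_triangular a b1 d e b2 g h k b3).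
rewrite [RHS]ge0_integralZl; [|by []|exact: mfT|by []|by rewrite lee_fin !mulr_ge0].
rewrite [in RHS](tonelli3 mfT) /=; last by move=> x; exact: f0.
pose G1 (p : R * R) := (\int[mu]_z f (p.1, p.2, z))%E.
have G10 p : (0 <= G1 p)%E by exact: integral_ge0.
have mG1 : measurable_fun setT G1 by exact: measurable_inner.
pose G2 (x : R) := (\int[mu]_y G1 (x, y))%E.
have G20 p : (0 <= G2 p)%E by exact: integral_ge0.
have mG2 : measurable_fun setT G2.
  exact: (@measurable_fun_fubini_tonelli_F _ _ _ _ _ mu G1 mG1 G10).
have Ez (x y : R) : (`|g|%:E * \int[mu]_z f (a * x + b1, d * y + (e * x + b2), g * z + (h * x + k * y + b3))%R = G1 (a * x + b1, d * y + (e * x + b2))%R)%E.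
  rewrite (@integral_affine _ g (h * x + k * y + b3) (fun z => f (_, _, z))) //.
  exact: (measurableT_comp mf).
have Ey (x : R) : (`|d|%:E * \int[mu]_y G1 (a * x + b1, d * y + (e * x + b2))%R = G2 (a * x + b1)%R)%E.
  rewrite (@integral_affine _ d (e * x + b2) (fun y => G1 (_, y))) //.
  exact: (measurableT_comp mG1).
rewrite (tonelli3 mf f0) -[LHS]/(\int[mu]_x G2 x)%E -(integral_affine b1 a0 mG2 G20).
have mH : measurable_fun setT (fun t : measurableTypeR R => G2 (a * t + b1)).
  by apply: (measurableT_comp mG2); apply: measurable_funD => //; exact: mulrl_measurable.
rewrite -mulrA EFinM -muleA; congr (_ * _)%E.
rewrite -[RHS]ge0_integralZl; [|by []| | |by rewrite lee_fin mulr_ge0]; last 2 first.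
- have m1 := measurableT_comp mf (measurable_triangular a b1 d e b2 g h k b3).
  have m2 := @measurable_fun_fubini_tonelli_F _ _ _ _ _ mu _ m1 (fun _ => f0 _).
  exact: (@measurable_fun_fubini_tonelli_F _ _ _ _ _ mu _ m2 (fun _ => integral_ge0 mu (fun _ _ => f0 _))).
- by move=> x _; apply: integral_ge0 => y _; apply: integral_ge0.
apply: eq_integral => x _; rewrite -Ey EFinM -muleA; congr (_ * _)%E.
rewrite -[RHS]ge0_integralZl; [|by []| | |by rewrite lee_fin]; last 2 first.
- have mp : measurable_fun setT (fun p : R * R => (x, p.1, p.2)).
    apply: measurable_fun_pair => //; exact: measurable_fun_pair.
  have m1 := measurableT_comp (measurableT_comp mf (measurable_triangular a b1 d e b2 g h k b3)) mp.
  exact: (@measurable_fun_fubini_tonelli_F _ _ _ _ _ mu _ m1 (fun _ => f0 _)).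
- by move=> y _; apply: integral_ge0.
by apply: eq_integral => y _; rewrite Ez.
Qed.

Lemma subst3_swap12 : subst3 (fun u => (u.1.2, u.1.1, u.2)) 1.
Proof.
have mT : measurable_fun setT (fun u : R3 => (u.1.2, u.1.1, u.2)).
  apply: measurable_fun_pair => //; apply: measurable_fun_pair; exact: measurableT_comp.
split=> // f mf f0; under [RHS]eq_integral do rewrite mul1e.
rewrite (tonelli3 mf f0) (tonelli3 (measurableT_comp mf mT)) /=; last by move=> x; exact: f0.
pose G1 (p : R * R) := (\int[mu]_z f (p.1, p.2, z))%E.
have G10 p : (0 <= G1 p)%E by exact: integral_ge0.
have mG1 : measurable_fun setT G1 by exact: measurable_inner.
exact: (tonelli2_swap mG1 G10).
Qed.

Lemma subst3_swap23 : subst3 (fun u => (u.1.1, u.2, u.1.2)) 1.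
Proof.
have mT : measurable_fun setT (fun u : R3 => (u.1.1, u.2, u.1.2)).
  apply: measurable_fun_pair => //; [apply: measurable_fun_pair => //|]; exact: measurableT_comp.
split=> // f mf f0; under [RHS]eq_integral do rewrite mul1e.
rewrite (tonelli3 mf f0) (tonelli3 (measurableT_comp mf mT)) /=; last by move=> x; exact: f0.
apply: eq_integral => x _; apply: (@tonelli2_swap _ (fun p => f (x, p.1, p.2))) => //.
apply: (measurableT_comp mf).
apply: measurable_fun_pair => //; exact: measurable_fun_pair.
Qed.

End Substitution3.

Section SubstitutionMatrix.
Variable R : realType.
Local Notation P := 'rV[R]_3.
Local Notation R3 := (R * R * R)%type.

Lemma sum3 (V : nmodType) (F : 'I_3 -> V) : \sum_i F i = F 0 + F 1 + F ord_max.
Proof.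
rewrite !big_ord_recl big_ord0 addr0 addrA ord_max3.
by congr (_ + F _ + _); exact: val_inj.
Qed.

Lemma prod3 (V : comNzRingType) (F : 'I_3 -> V) : \prod_i F i = F 0 * F 1 * F ord_max.
Proof.
rewrite !big_ord_recl big_ord0 mulr1 mulrA ord_max3.
by congr (_ * F _ * _); exact: val_inj.
Qed.

Lemma forall3 (T : 'I_3 -> Prop) : T 0 -> T 1 -> T ord_max -> forall i, T i.
Proof. by rewrite ord_max3; exact: ord3P. Qed.

Definition subst_mx (B : 'M[R]_3) : Prop :=
  subst3 (fun u => unvec3 (vec3 u *m B)) `|\det B|.

Lemma subst_mxM A B : subst_mx A -> subst_mx B -> subst_mx (A *m B).
Proof.
move=> hA hB; have := subst3_comp hB hA; rewrite /subst_mx det_mulmx normrM mulrC.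
by congr subst3; apply/funext => u /=; rewrite unvec3K mulmxA.
Qed.

Lemma unvec3_mul (u : R3) (B : 'M[R]_3) : unvec3 (vec3 u *m B) =
  (u.1.1 * B 0 0 + u.1.2 * B 1 0 + u.2 * B ord_max 0,
   u.1.1 * B 0 1 + u.1.2 * B 1 1 + u.2 * B ord_max 1,
   u.1.1 * B 0 ord_max + u.1.2 * B 1 ord_max + u.2 * B ord_max ord_max).
Proof. by rewrite /unvec3 !mxE !sum3 !vec3E. Qed.

Lemma subst_mx_upper (B : 'M[R]_3) : (forall i j : 'I_3, (j < i)%N -> B i j = 0) ->
  (forall i, B i i != 0) -> subst_mx B.
Proof.
move=> B0 Bd; rewrite /subst_mx.
have -> : \det B = B 0 0 * B 1 1 * B ord_max ord_max.
  rewrite -det_tr det_trig.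
    by rewrite prod3 !mxE.
  by apply/is_trig_mxP => i j ij; rewrite mxE B0.
have := @subst3_triangular R (B 0 0) 0 (B 1 1) (B 0 1) 0 (B ord_max ord_max) (B 0 ord_max) (B 1 ord_max) 0 (Bd _) (Bd _) (Bd _).
rewrite !normrM; congr subst3; apply/funext => u; rewrite unvec3_mul.
rewrite (B0 1 0) // (B0 ord_max 0) // (B0 ord_max 1) //.
by congr (_, _, _); ring.
Qed.

Lemma subst3_swap13 : subst3 (fun u : R3 => (u.2, u.1.2, u.1.1)) 1.
Proof.
have := subst3_comp (subst3_swap12 R) (subst3_comp (subst3_swap23 R) (subst3_swap12 R)).
by rewrite !mulr1; congr subst3.
Qed.

(** Conjugation by the exchange of the first and last coordinates gives an upper triangular
    matrix. *)
Lemma subst_mx_lower (B : 'M[R]_3) : (forall i j : 'I_3, (i < j)%N -> B i j = 0) ->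
  (forall i, B i i != 0) -> subst_mx B.
Proof.
move=> B0 Bd; rewrite /subst_mx.
have -> : \det B = B ord_max ord_max * B 1 1 * B 0 0.
  rewrite det_trig; last by apply/is_trig_mxP.
  by rewrite prod3; ring.
have := @subst3_triangular R (B ord_max ord_max) 0 (B 1 1) (B ord_max 1) 0 (B 0 0) (B ord_max 0) (B 1 0) 0 (Bd _) (Bd _) (Bd _).
move=> /(subst3_comp subst3_swap13) /subst3_comp /(_ subst3_swap13).
rewrite !normrM mul1r mulr1; congr subst3; apply/funext => u /=; rewrite unvec3_mul.
rewrite (B0 0 1) // (B0 0 ord_max) // (B0 1 ord_max) //.
by congr (_, _, _); ring.
Qed.

Lemma subst_mx_tperm (i j : 'I_3) : subst_mx (tperm_mx i j).
Proof.
have E (f g : R3 -> R3) : f =1 g -> subst3 f 1 -> subst3 g 1 by move=> /funext ->.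
have [->|ij] := eqVneq i j.
  rewrite /tperm_mx tperm1 perm_mx1; apply: subst_mx_upper => [k l kl|k]; rewrite mxE.
    by rewrite -val_eqE gtn_eqF.
  by rewrite eqxx oner_eq0.
rewrite /subst_mx det_perm odd_tperm ij normrX normrN normr1 expr1.
have tE u (k l : 'I_3) : unvec3 (vec3 u *m tperm_mx k l) =
   (vec3 u 0 (tperm k l 0), vec3 u 0 (tperm k l 1), vec3 u 0 (tperm k l ord_max)) :> R3.
  by rewrite -xcolE /unvec3 !mxE.
wlog : i j ij / (i < j)%N.
  move=> W; have [||/val_inj eij] := ltngtP i j.
  - exact: W.
  - by move=> ji; rewrite /tperm_mx tpermC; apply: W => //; rewrite eq_sym.
  - by rewrite eij eqxx in ij.
move: i j {ij}; apply: forall3; apply: forall3 => //= _.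
- apply: E (subst3_swap12 R) => u; rewrite tE tpermL tpermR tpermD //.
  by rewrite !vec3E.
- apply: E subst3_swap13 => u; rewrite tE tpermL tpermR tpermD //.
  by rewrite !vec3E.
- apply: E (subst3_swap23 R) => u; rewrite tE tpermL tpermR tpermD //.
  by rewrite !vec3E.
Qed.

Lemma subst_mx_perm (s : 'S_3) : subst_mx (perm_mx s).
Proof.
have [ts -> _] := prod_tpermP s; elim: ts => [|t ts IH].
  by have := subst_mx_tperm 0 0; rewrite /tperm_mx tperm1 big_nil.
by rewrite big_cons perm_mxM; apply: subst_mxM => //; exact: subst_mx_tperm.
Qed.

Lemma lup_decomposition (F : fieldType) n (A : 'M[F]_n.+1) :
  exists (s : 'S_n.+1) (L U : 'M[F]_n.+1), [/\ perm_mx s *m A = L *m U, \det L = 1,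
    forall i j : 'I_n.+1, (i <= j)%N -> L i j = (i == j)%:R &
    forall i j : 'I_n.+1, (j < i)%N -> U i j = 0].
Proof.
have := cormen_lup_correct A; have := cormen_lup_perm A.
have := cormen_lup_lower A; have := cormen_lup_detL A; have := cormen_lup_upper A.
case: (cormen_lup A) => [[Pm L] U] /= hU dL hL /is_perm_mxP[s ->] E.
by exists s, L, U; split.
Qed.

(** By the LUP decomposition [B] is a permutation times a lower times an upper triangular matrix;
    the change of variables is known for each factor, and such changes compose. *)
Lemma subst_mx_unit (B : 'M[R]_3) : \det B != 0 -> subst_mx B.
Proof.
move=> B0; have [s [L [U [E dL hL hU]]]] := lup_decomposition B.
have -> : B = perm_mx s^-1 *m (L *m U).
  by rewrite -E mulmxA -perm_mxM mulVg perm_mx1 mul1mx.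
apply: subst_mxM; first exact: subst_mx_perm.
have dU : \det U != 0.
  have : \det (perm_mx s *m B) != 0.
    by rewrite det_mulmx det_perm mulf_neq0 // signr_eq0.
  by rewrite E det_mulmx dL mul1r.
apply: subst_mxM.
  apply: subst_mx_lower => [i j ij|i]; rewrite hL ?leqnn ?eqxx ?oner_eq0 //; last exact: ltnW.
  by rewrite -val_eqE /= ltn_eqF.
apply: subst_mx_upper => [i j|i]; first exact: hU.
move: dU; rewrite -det_tr det_trig; last first.
  by apply/is_trig_mxP => k l kl; rewrite mxE hU.
by move=> /prodf_neq0 /(_ i isT); rewrite mxE.
Qed.

Lemma subst3_affine (x0 : P) (B : 'M[R]_3) : \det B != 0 ->
  subst3 (fun u => unvec3 (x0 + vec3 u *m B)) `|\det B|.
Proof.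
move=> B0.
have := @subst3_triangular R 1 (x0 0 0) 1 0 (x0 0 1) 1 0 0 (x0 0 ord_max) (oner_neq0 _) (oner_neq0 _) (oner_neq0 _).
move=> /subst3_comp /(_ (subst_mx_unit B0)); rewrite !normr1 !mul1r.
congr subst3; apply/funext => u /=; rewrite /unvec3 /= !mxE.
by congr (_, _, _); ring.
Qed.

End SubstitutionMatrix.

Ltac vec_ring := by apply/rowP => ?; rewrite !mxE; ring.
Ltac vec_ring3 := by apply/rowP; apply: forall3; rewrite !mxE /= ?mxE; ring.

Section CrossProduct.
Variable R : realType.
Local Notation P := 'rV[R]_3.

Definition crossp (u v : P) : P :=
  vec3 (u 0 1 * v 0 ord_max - u 0 ord_max * v 0 1,
        u 0 ord_max * v 0 0 - u 0 0 * v 0 ord_max,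
        u 0 0 * v 0 1 - u 0 1 * v 0 0).

Definition rows3 (u v w : P) : 'M[R]_3 :=
  \matrix_(i, j) (if i == 0 then u 0 j else if i == 1 then v 0 j else w 0 j).

Lemma dotpE (u v : P) : dotp u v = u 0 0 * v 0 0 + u 0 1 * v 0 1 + u 0 ord_max * v 0 ord_max.
Proof. by rewrite /dotp sum3. Qed.

Lemma det3E (A : 'M[R]_3) : \det A =
  A 0 0 * (A 1 1 * A ord_max ord_max - A 1 ord_max * A ord_max 1)
  + A 0 1 * (A 1 ord_max * A ord_max 0 - A 1 0 * A ord_max ord_max)
  + A 0 ord_max * (A 1 0 * A ord_max 1 - A 1 1 * A ord_max 0).
Proof.
have l00 : lift 0 0 = 1 :> 'I_3 by exact: val_inj.
have l01 : lift 0 1 = ord_max :> 'I_3 by exact: val_inj.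
have l10 : lift 1 0 = 0 :> 'I_3 by exact: val_inj.
have l11 : lift 1 1 = ord_max :> 'I_3 by exact: val_inj.
have l20 : lift ord_max 0 = 0 :> 'I_3 by exact: val_inj.
have l21 : lift ord_max 1 = 1 :> 'I_3 by exact: val_inj.
have k0 : lift 0 0 = 1 :> 'I_2 by exact: val_inj.
have k1 : lift 1 0 = 0 :> 'I_2 by exact: val_inj.
have d2 (B : 'M[R]_2) : \det B = B 0 0 * B 1 1 - B 0 1 * B 1 0.
  rewrite (expand_det_row _ 0) !big_ord_recl big_ord0 addr0 k0 /cofactor !det_mx11 !mxE.
  by rewrite k0 k1 /= expr0 expr1 mul1r mulN1r mulrN.
rewrite (expand_det_row _ 0) sum3 /cofactor !d2 !mxE.
rewrite l00 l01 l10 l11 l20 l21 /=.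
by rewrite !expr0 /=; ring.
Qed.

Lemma det_rows3 (u v w : P) : \det (rows3 u v w) = dotp w (crossp u v).
Proof. by rewrite det3E dotpE !mxE /=; ring. Qed.

Lemma mul_rows3 (p : R * R * R) (u v w : P) :
  vec3 p *m rows3 u v w = p.1.1 *: u + p.1.2 *: v + p.2 *: w.
Proof. by apply/rowP => j; rewrite !mxE sum3 !mxE. Qed.

End CrossProduct.

(** * Integrability of continuous functions on bounded sets *)

Section ContinuousIntegrals.
Variable R : realType.
Local Notation mu := (@lebesgue_measure R).
Local Notation P := 'rV[R]_3.
Implicit Types (f g : P -> R) (D : set P).

Definition bounded3 (K : R) D := forall x, D x -> forall i, `|x 0 i| <= K.

Lemma continuous_bounded3 f K : continuous f ->
  exists M, forall x : P, (forall i, `|x 0 i| <= K) -> `|f x| <= M.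
Proof.
move=> cf; pose B : set P := [set x | forall i, (`[-K, K]%classic : set R) (x 0 i)].
have cB : compact B by apply: (@rV_compact _ _ (fun=> `[-K, K]%classic)) => _; exact: segment_compact.
have /compact_bounded[M [_ HM]] : compact (f @` B).
  by apply: continuous_compact => //; exact: continuous_subspaceT.
exists (M + 1) => x xK; apply: (HM (M + 1)); first by rewrite ltrDl.
by exists x => // i /=; rewrite in_itv /= -ler_norml; exact: xK.
Qed.

Lemma measure_box_lty (K : R) :
  (@leb3 R (`[- K, K]%classic `*` `[- K, K]%classic `*` `[- K, K]%classic)%R < +oo)%E.
Proof.
rewrite /leb3 product_measure1E //; last exact: measurableX.
rewrite /leb2 [X in (X * _)%E]product_measure1E //.
have E : (mu `[(- K)%R, K]%classic < +oo)%E.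
  by rewrite lebesgue_measure_itv /=; case: ifP => _; rewrite -?EFinB ltry.
have F : mu `[(- K)%R, K]%classic \is a fin_num by rewrite ge0_fin_numE.
apply: lte_mul_pinfty; [exact: mule_ge0|exact: fin_numM|exact: E].
Qed.

Lemma measure_bounded3_lty K D : measurable (@vec3 R @^-1` D) -> bounded3 K D ->
  (@leb3 R (@vec3 R @^-1` D) < +oo)%E.
Proof.
move=> mD bD; apply: le_lt_trans (measure_box_lty K); apply: le_measure.
- by rewrite inE.
- by rewrite inE; apply: measurableX => //; exact: measurableX.
- move=> p /= /bD b; split; first split; rewrite /= in_itv /= -ler_norml.
  + by have := b 0; rewrite vec3E.
  + by have := b 1; rewrite vec3E.
  + by have := b ord_max; rewrite vec3E.
Qed.

Lemma bounded_integrable3 K D (f : P -> R) : measurable (@vec3 R @^-1` D) -> bounded3 K D ->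
  measurable_fun (@vec3 R @^-1` D) (f \o @vec3 R) ->
  (exists M, forall x, D x -> `|f x| <= M) ->
  (@leb3 R).-integrable (@vec3 R @^-1` D) (EFin \o (f \o @vec3 R)).
Proof.
move=> mD bD mf [M HM]; have fin := measure_bounded3_lty mD bD.
apply: (@measurable_bounded_integrable _ _ _ (@leb3 R) (f \o @vec3 R) _ mD fin mf).
exists M; split; first exact: num_real.
by move=> N MN p /HM /le_trans; apply; exact: ltW.
Qed.

Lemma continuous_integrable3 K D f : measurable (@vec3 R @^-1` D) -> bounded3 K D ->
  continuous f -> (@leb3 R).-integrable (@vec3 R @^-1` D) (EFin \o (f \o @vec3 R)).
Proof.
move=> mD bD cf; apply: (bounded_integrable3 mD bD).
  by apply: measurable_funTS; exact: continuous_measurable_vec3.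
by have [M HM] := continuous_bounded3 K cf; exists M => x /bD; exact: HM.
Qed.

End ContinuousIntegrals.

(** * The divergence theorem on a tetrahedron *)

(** Both sides split into positive and negative parts, and a factor c >= 0 commutes with taking
    these parts. *)
Lemma integral_subst_signed d (T : measurableType d) (R : realType) (mu : {measure set T -> \bar R})
    (U : T -> T) (c : R) (f : T -> \bar R) : 0 <= c ->
  (forall f : T -> \bar R, measurable_fun setT f -> (forall x, 0 <= f x)%E ->
    (\int[mu]_u f u = \int[mu]_u (c%:E * f (U u)))%E) ->
  measurable_fun setT f -> (\int[mu]_u f u = \int[mu]_u (c%:E * f (U u)))%E.
Proof.
move=> c0 H mf; rewrite [LHS]integralE [RHS]integralE.
rewrite [X in (X - _)%E]H; [|exact: measurable_funepos|by move=> u; exact: funepos_ge0].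
rewrite [X in (_ - X)%E]H; [|exact: measurable_funeneg|by move=> u; exact: funeneg_ge0].
congr (_ - _)%E; apply: eq_integral => u _.
  (* The identity between functions is instantiated on [unit] to obtain its value at the single
     point [U u]. *)
  have E := congr1 (fun h => h tt) (ge0_funeposM (fun _ : unit => f (U u)) c0).
  by rewrite !funeposE /= in E *; rewrite E.
have E := congr1 (fun h => h tt) (ge0_funenegM (fun _ : unit => f (U u)) c0).
by rewrite !funenegE /= in E *; rewrite E.
Qed.

Section ReferenceTetrahedron.
Variable R : realType.
Local Notation mu := (@lebesgue_measure R).
Local Notation P := 'rV[R]_3.
Local Notation R3 := (R * R * R)%type.

Section ContinuousOps.
Variables (T : topologicalType) (f g : T -> R).

Lemma cont_cst (c : R) : continuous (fun _ : T => c).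
Proof. by move=> x; exact: cvg_cst. Qed.

Lemma contD : continuous f -> continuous g -> continuous (fun x => f x + g x).
Proof. by move=> cf cg x; apply: cvgD; [exact: cf|exact: cg]. Qed.

Lemma contB : continuous f -> continuous g -> continuous (fun x => f x - g x).
Proof. by move=> cf cg x; apply: cvgB; [exact: cf|exact: cg]. Qed.

Lemma contM : continuous f -> continuous g -> continuous (fun x => f x * g x).
Proof. by move=> cf cg x; apply: cvgM; [exact: cf|exact: cg]. Qed.

Lemma cont_norm : continuous f -> continuous (fun x => `|f x|).
Proof. by move=> cf x; apply: cvg_norm; exact: cf. Qed.

End ContinuousOps.

Lemma contX (T : topologicalType) (f : T -> R) n : continuous f -> continuous (fun x => f x ^+ n).
Proof.
move=> cf; elim: n => [|n IH]; first exact: cont_cst.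
by under eq_fun do rewrite exprS; exact: contM.
Qed.

Lemma cont_sum (T : topologicalType) (I : Type) (r : seq I) (p : pred I) (F : I -> T -> R) :
  (forall i, continuous (F i)) -> continuous (fun x => \sum_(i <- r | p i) F i x).
Proof.
move=> cF; elim: r => [|i r IH]; first by under eq_fun do rewrite big_nil; exact: cont_cst.
under eq_fun do rewrite big_cons; case: (p i) => //; exact: contD.
Qed.

Lemma cont_coord (i : 'I_3) : continuous (fun x : P => x 0 i).
Proof. by move=> x; exact: coord_continuous. Qed.

Lemma continuous_rV3 (T : topologicalType) (h : T -> P) :
  (forall i, continuous (fun x => h x 0 i)) -> continuous h.
Proof.
move=> ch x.
have -> : h = fun y => h y 0 0 *: delta_mx 0 0 + h y 0 1 *: delta_mx 0 1
    + h y 0 ord_max *: delta_mx 0 ord_max.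
  by apply/funext => y; rewrite {1}[h y]row_sum_delta sum3.
by apply: cvgD; first apply: cvgD; apply: cvgZ; [exact: ch|exact: cvg_cst|exact: ch|exact: cvg_cst|exact: ch|exact: cvg_cst].
Qed.

Lemma continuous_affine (x0 : P) (B : 'M[R]_3) : continuous (fun y : P => x0 + y *m B).
Proof.
apply: continuous_rV3 => i.
have -> : (fun y : P => (x0 + y *m B) 0 i) =
   fun y : P => x0 0 i + (y 0 0 * B 0 i + y 0 1 * B 1 i + y 0 ord_max * B ord_max i).
  by apply/funext => y; rewrite !mxE sum3.
apply: contD; first exact: cont_cst.
by apply: contD; [apply: contD|]; apply: contM; (exact: cont_coord || exact: cont_cst).
Qed.

Lemma subst3_integral (T : R3 -> R3) c (f : R3 -> \bar R) : subst3 T c ->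
  measurable_fun setT f -> (\int[@leb3 R]_u f u = \int[@leb3 R]_u (c%:E * f (T u)))%E.
Proof. by move=> [_ c0 H]; exact: (@integral_subst_signed _ _ _ (@leb3 R) T c f c0 H). Qed.

Lemma vint_affine (x0 : P) (B : 'M[R]_3) (D E : set P) (g : P -> R) : \det B != 0 ->
  continuous g -> measurable (@vec3 R @^-1` D) ->
  (forall y, E y <-> D (x0 + y *m B)) ->
  vint D g = \int[@leb3 R]_(u in @vec3 R @^-1` E) (`|\det B| * g (x0 + vec3 u *m B)).
Proof.
move=> B0 cg mD DE; rewrite /vint -/(@leb3 R) /Rintegral; congr fine.
rewrite integral_mkcond (subst3_integral (subst3_affine x0 B0)); last first.
  apply/(measurable_restrictT _ mD)/measurable_EFinP/measurable_funTS.
  exact: continuous_measurable_vec3.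
rewrite [RHS]integral_mkcond; apply: eq_integral => u _.
rewrite /patch; have [Eu|nEu] := pselect (E (vec3 u)).
  by rewrite !mem_set //= ?unvec3K ?EFinM //; exact/DE.
by rewrite !memNset ?mule0 //= unvec3K => /DE.
Qed.

Definition delta3 : set P := [set y | (forall i, 0 < y 0 i) /\ y 0 0 + y 0 1 + y 0 ord_max < 1].
Definition delta2 : set (R * R) := [set w | [/\ 0 < w.1, 0 < w.2 & w.1 + w.2 < 1]].

Lemma open_pos (f : P -> R) : continuous f -> open [set y | 0 < f y].
Proof.
move=> cf; have -> : [set y | 0 < f y] = f @^-1` `]0, +oo[%classic.
  by apply/seteqP; split=> y; rewrite /= in_itv /= andbT.
by move/continuousP: cf; apply; exact: interval_open.
Qed.

Lemma open_delta3 : open delta3.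
Proof.
have -> : delta3 = [set y : P | 0 < y 0 0] `&` [set y : P | 0 < y 0 1] `&`
    [set y : P | 0 < y 0 ord_max] `&` [set y : P | 0 < 1 - (y 0 0 + y 0 1 + y 0 ord_max)].
  apply/seteqP; split => y /=; rewrite subr_gt0; first by move=> [].
  by move=> [[[? ?] ?] ?]; split => //; exact: forall3.
apply: openI; first apply: openI; first apply: openI; try (apply: open_pos; exact: cont_coord).
apply: open_pos; apply: contB; first exact: cont_cst.
by apply: contD; [apply: contD|]; exact: cont_coord.
Qed.

Lemma bounded_delta3 : bounded3 1 delta3.
Proof.
move=> y [y0 y1]; have := y0 0; have := y0 1; have := y0 ord_max => h2 h1 h0.
by apply: forall3; rewrite ger0_norm; lra.
Qed.

Lemma is_derive_line (f : P -> R) (y v : P) (z d : R) : is_derive (y + z *: v) v f d ->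
  is_derive z 1 (fun t => f (y + t *: v)) d.
Proof.
move=> [df vf]; have E : (fun h : R => h^-1 *: (((fun t => f (y + t *: v)) \o shift z) (h *: 1) - f (y + z *: v)))
    = (fun h => h^-1 *: ((f \o shift (y + z *: v)) (h *: v) - f (y + z *: v))).
  apply/funext => h /=; congr (_ *: (f _ - _)).
  by rewrite -[h *: 1]/(h * 1) mulr1 scalerDl addrCA.
by split; rewrite /derivable /derive E.
Qed.

Lemma ftc_line (f g : P -> R) (y v : P) (b : R) : 0 < b -> continuous f -> continuous g ->
  (forall x, is_derive x v f (g x)) ->
  (\int[mu]_(z in `]0%R, b[) (g (y + z *: v))%:E = (f (y + b *: v) - f y)%:E)%E.
Proof.
move=> b0 cf cg fg.
have cl : continuous (fun z : R => y + z *: v).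
  move=> z; apply: cvgD; first exact: cvg_cst.
  by apply: cvgZ; [exact: cvg_id|exact: cvg_cst].
have cfl : continuous (fun z : R => f (y + z *: v)).
  by move=> z; apply: (continuous_comp (cl z)); exact: cf.
have cgl : continuous (fun z : R => g (y + z *: v)).
  by move=> z; apply: (continuous_comp (cl z)); exact: cg.
have mg (A : set R) : measurable_fun A (fun z : R => (g (y + z *: v))%:E).
  by apply/measurable_EFinP/measurable_funTS; exact: continuous_measurable_fun.
rewrite integral_itv_bndo_bndc // integral_itv_obnd_cbnd //.
rewrite (@continuous_FTC2 _ (fun z => g (y + z *: v)) (fun z => f (y + z *: v))) //.
- by rewrite scale0r addr0 EFinB.
- exact: continuous_subspaceT.
- split.
  + by move=> z _; exact: (@ex_derive _ _ _ _ _ _ _ (is_derive_line (fg _))).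
  + by apply: cvg_at_right_filter; exact: cfl.
  + by apply: cvg_at_left_filter; exact: cfl.
- by move=> z _; rewrite derive1E (@derive_val _ _ _ _ _ _ _ (is_derive_line (fg _))).
Qed.

(** Fubini in the last coordinate: above a point of [delta2] the section of the tetrahedron is an
    open interval, where the fundamental theorem of calculus applies; above any other point it is
    empty. *)
Lemma vint_delta3 (F F' : P -> R) : continuous F -> continuous F' ->
  (forall y, is_derive y (delta_mx 0 ord_max) F (F' y)) ->
  vint delta3 F' = \int[@leb2 R]_(w in delta2)
    (F (vec3 (w.1, w.2, 1 - w.1 - w.2)) - F (vec3 (w.1, w.2, 0))).
Proof.
move=> cF cF' FF'; rewrite /vint -/(@leb3 R) /Rintegral; congr fine.
have mD := open_measurable_vec3 open_delta3.
have int := iffLR (@integrable_mkcond _ _ _ (@leb3 R) _ _ mD)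
  (continuous_integrable3 mD bounded_delta3 cF').
rewrite integral_mkcond -(@integral12_prod_meas1 _ _ _ _ _ (@leb2 R) mu _ int).
rewrite [RHS]integral_mkcond; apply: eq_integral => w _; rewrite /fubini_F /patch.
have [[w1 w2 w12]|nw] := pselect (delta2 w).
  rewrite mem_set //.
  have b0 : 0 < 1 - w.1 - w.2 by lra.
  have /= := ftc_line (vec3 (w.1, w.2, 0)) b0 cF cF' FF'.
  have E z : vec3 (w.1, w.2, 0) + z *: delta_mx 0 ord_max = vec3 (w.1, w.2, z) :> P.
    by apply/rowP; apply: forall3; rewrite !mxE /=; ring.
  rewrite E => <-; rewrite [RHS]integral_mkcond; apply: eq_integral => z _; rewrite /patch E.
  have [/andP[z0 z1]|nz] := boolP ((0 < z) && (z < 1 - w.1 - w.2)).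
    rewrite !mem_set //=; first by rewrite in_itv /= z0 z1.
    split; last by rewrite !vec3E /=; lra.
    by apply: forall3; rewrite !vec3E.
  rewrite !memNset //=; first by rewrite in_itv /=; exact/negP.
  move=> [h0 h1]; case/negP: nz; have := h0 ord_max; move: h1; rewrite !vec3E /=.
  by move=> ? ->; lra.
rewrite memNset // integral0_eq // => z _; rewrite memNset //= => -[h0 h1]; apply: nw.
have := h0 0; have := h0 1; have := h0 ord_max; move: h1; rewrite !vec3E /= => *.
by split; lra.
Qed.

End ReferenceTetrahedron.

(** * Integrals over triangles in barycentric parametrisation *)

Section TriangleIntegral.
Variable R : realType.
Local Notation mu := (@lebesgue_measure R).
Local Notation P := 'rV[R]_3.
Local Notation R2 := (R * R)%type.
Implicit Types (f g : P -> R) (a b c : P).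

Definition tri_pt a b c (w : R2) : P := a + w.1 *: (b - a) + w.2 *: (c - a).

(** No Jacobian is included: this is the surface integral divided by twice the area of the triangle.
    The missing factor is the length of the cross product of the two edges, which serves as an
    unnormalised normal in the fluxes. *)
Definition tri_int a b c f : R := \int[@leb2 R]_(w in @delta2 R) f (tri_pt a b c w).

Lemma measurable_delta2 : measurable (@delta2 R).
Proof.
have -> : @delta2 R = [set w : R2 | w.1 \in `]0, +oo[] `&` [set w | w.2 \in `]0, +oo[]
    `&` [set w | w.1 + w.2 \in `]-oo, 1[].
  apply/seteqP; split => w /=; rewrite !in_itv /= !andbT; first by move=> [].
  by move=> [[]].
have M (h : R2 -> R) (i : interval R) : measurable_fun setT h -> measurable [set w | h w \in i].
  by move=> mh; have := mh measurableT _ (measurable_itv i); rewrite setTI.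
apply: measurableI; first apply: measurableI; apply: M; [exact: measurable_fst|exact: measurable_snd|].
by apply: measurable_funD; [exact: measurable_fst|exact: measurable_snd].
Qed.

Lemma tri_ptE a b c w :
  tri_pt a b c w = a + vec3 (w.1, w.2, 0) *m rows3 (b - a) (c - a) 0.
Proof. by rewrite mul_rows3 /tri_pt /= scale0r addr0 addrA. Qed.

Lemma measurable_tri f a b c : continuous f ->
  measurable_fun setT (fun w : R2 => f (tri_pt a b c w)).
Proof.
move=> cf; under eq_fun do rewrite tri_ptE.
have cg : continuous (fun y : P => f (a + y *m rows3 (b - a) (c - a) 0)).
  by move=> y; apply: (continuous_comp (@continuous_affine _ _ _ y)); exact: cf.
have mp : measurable_fun setT (fun w : R2 => (w.1, w.2, 0 : R)).
  by apply: measurable_fun_pair => //; apply: measurable_fun_pair.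
exact: (measurableT_comp (continuous_measurable_vec3 cg) mp).
Qed.

Lemma integrable_tri f a b c : continuous f ->
  (@leb2 R).-integrable (@delta2 R) (EFin \o (fun w => f (tri_pt a b c w))).
Proof.
move=> cf.
have fin : (@leb2 R (@delta2 R) < +oo)%E.
  have F : mu `[0, 1]%classic \is a fin_num.
    by rewrite ge0_fin_numE // lebesgue_measure_itv /=; case: ifP => _; rewrite -?EFinB ltry.
  apply: (@le_lt_trans _ _ (@leb2 R (`[0, 1]%classic `*` `[0, 1]%classic))%R).
    apply: le_measure; rewrite ?inE; [exact: measurable_delta2|exact: measurableX|].
    by move=> w [w1 w2 w3]; split; rewrite /= in_itv /=; apply/andP; split; lra.
  by rewrite /leb2 product_measure1E // -ge0_fin_numE ?fin_numM ?mule_ge0.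
apply: (@measurable_bounded_integrable _ _ _ (@leb2 R) _ _ measurable_delta2 fin).
  by apply: measurable_funTS; exact: measurable_tri.
have cg : continuous (fun y : P => f (a + y *m rows3 (b - a) (c - a) 0)).
  by move=> y; apply: (continuous_comp (@continuous_affine _ _ _ y)); exact: cf.
have [M HM] := continuous_bounded3 1 cg.
exists M; split; first exact: num_real.
move=> N MN w [w1 w2 w3]; apply: le_trans (ltW MN); rewrite /= tri_ptE; apply: HM.
by apply: forall3; rewrite vec3E /= ger0_norm; lra.
Qed.

Lemma tri_intD a b c f g : continuous f -> continuous g ->
  tri_int a b c (fun x => f x + g x) = tri_int a b c f + tri_int a b c g.
Proof.
by move=> cf cg; rewrite /tri_int (@RintegralD _ _ _ (@leb2 R) _ _ _ measurable_delta2 (integrable_tri _ _ _ cf) (integrable_tri _ _ _ cg)).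
Qed.

Lemma tri_intZ a b c f k : continuous f ->
  tri_int a b c (fun x => k * f x) = k * tri_int a b c f.
Proof.
by move=> cf; rewrite /tri_int (@RintegralZl _ _ _ (@leb2 R) _ _ _ measurable_delta2 (integrable_tri _ _ _ cf)).
Qed.

Lemma le_tri_int a b c f g : continuous f -> continuous g ->
  (forall w, delta2 w -> f (tri_pt a b c w) <= g (tri_pt a b c w)) ->
  tri_int a b c f <= tri_int a b c g.
Proof.
move=> cf cg fg.
exact: (@le_Rintegral _ _ _ (@leb2 R) _ _ _ measurable_delta2 (integrable_tri _ _ _ cf) (integrable_tri _ _ _ cg) fg).
Qed.

Lemma eq_tri_int a b c f g :
  (forall w, delta2 w -> f (tri_pt a b c w) = g (tri_pt a b c w)) ->
  tri_int a b c f = tri_int a b c g.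
Proof. by move=> fg; apply: eq_Rintegral => w; rewrite inE; exact: fg. Qed.

(** The planar case follows from the spatial one: [f] is multiplied by the indicator of [0, 1] in a
    third variable, whose integral is 1 and which the block matrix [B] leaves alone. *)
Lemma subst2 (o1 o2 m11 m12 m21 m22 : R) (f : R2 -> \bar R) : m11 * m22 - m12 * m21 != 0 ->
  measurable_fun setT f -> (forall x, 0 <= f x)%E ->
  (\int[@leb2 R]_w f w = \int[@leb2 R]_w (`|m11 * m22 - m12 * m21|%:E *
     f (o1 + m11 * w.1 + m21 * w.2, o2 + m12 * w.1 + m22 * w.2)%R))%E.
Proof.
move=> d0 mf f0.
pose I (z : R) : \bar R := (\1_(`[0%R, 1%R]%classic : set R) z)%:E.
have mI : measurable_fun setT I by apply/measurable_EFinP; exact: measurable_indic.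
have I0 z : (0 <= I z)%E by rewrite lee_fin indicE.
have intI (x : \bar R) : (0 <= x)%E -> (\int[mu]_z (x * I z) = x)%E.
  move=> x0; have I1 : (\int[mu]_z I z = 1)%E.
    have m01 : mu `[0%R, 1%R]%classic = 1%E.
      by rewrite lebesgue_measure_itv /= lte_fin ltr01 oppr0 adde0.
    by rewrite integral_indic // setIT; exact: m01.
  by rewrite -[x in RHS]mule1 -I1 ge0_integralZl //.
pose B := rows3 (vec3 (m11, m12, 0)) (vec3 (m21, m22, 0)) (vec3 (0, 0, 1) : P).
have dB : \det B = m11 * m22 - m12 * m21.
  by rewrite det_rows3 dotpE !vec3E /=; ring.
have B0 : \det B != 0 by rewrite dB.
have [mT c0 H] := subst3_affine (vec3 (o1, o2, 0)) B0.
have TE u : unvec3 (vec3 (o1, o2, 0) + vec3 u *m B) =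
    (o1 + m11 * u.1.1 + m21 * u.1.2, o2 + m12 * u.1.1 + m22 * u.1.2, u.2).
  by rewrite mul_rows3 /unvec3 !mxE /=; congr (_, _, _); ring.
have mF : measurable_fun setT (fun p : R * R * R => f p.1 * I p.2)%E.
  by apply: emeasurable_funM; exact: measurableT_comp.
have F0 (p : R * R * R) : (0 <= f p.1 * I p.2)%E by rewrite mule_ge0.
have E1 : (\int[@leb2 R]_w f w = \int[@leb3 R]_p (f p.1 * I p.2))%E.
  rewrite (tonelli21 mF F0) /=; apply: eq_integral => w _.
  by rewrite intI // -surjective_pairing.
rewrite E1 H //; under eq_integral do rewrite TE /=.
have m1 : measurable_fun setT (fun p : R * R * R => (`|\det B|%:E *
    (f (o1 + m11 * p.1.1 + m21 * p.1.2, o2 + m12 * p.1.1 + m22 * p.1.2)%R * I p.2))%E).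
  apply: emeasurable_funM => //; have := measurableT_comp mF mT.
  by congr (measurable_fun _ _); apply/funext => p; rewrite /comp TE.
rewrite (tonelli21 m1) /=; last by move=> p; apply: mule_ge0; [rewrite lee_fin|exact: mule_ge0].
apply: eq_integral => w _.
under eq_integral do rewrite muleA.
by rewrite intI ?dB // mule_ge0 // lee_fin.
Qed.

Lemma subst2_signed (o1 o2 m11 m12 m21 m22 : R) (f : R2 -> \bar R) : m11 * m22 - m12 * m21 != 0 ->
  measurable_fun setT f ->
  (\int[@leb2 R]_w f w = \int[@leb2 R]_w (`|m11 * m22 - m12 * m21|%:E *
     f (o1 + m11 * w.1 + m21 * w.2, o2 + m12 * w.1 + m22 * w.2)%R))%E.
Proof.
move=> d0; pose U (w : R2) : R2 := (o1 + m11 * w.1 + m21 * w.2, o2 + m12 * w.1 + m22 * w.2).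
apply: (@integral_subst_signed _ _ _ (@leb2 R) U) => // g mg g0; exact: subst2.
Qed.

(** Meant for relabelling the vertices, which is an affine automorphism of [delta2] of determinant 1
    or -1. *)
Lemma tri_int_subst (o1 o2 m11 m12 m21 m22 : R) a b c a' b' c' f :
  `|m11 * m22 - m12 * m21| = 1 -> continuous f ->
  (forall w, delta2 w <-> delta2 (o1 + m11 * w.1 + m21 * w.2, o2 + m12 * w.1 + m22 * w.2)) ->
  (forall w, tri_pt a b c (o1 + m11 * w.1 + m21 * w.2, o2 + m12 * w.1 + m22 * w.2) = tri_pt a' b' c' w) ->
  tri_int a b c f = tri_int a' b' c' f.
Proof.
move=> d1 cf dE tE; rewrite /tri_int /Rintegral; congr fine.
have d0 : m11 * m22 - m12 * m21 != 0 by rewrite -normr_eq0 d1 oner_eq0.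
rewrite integral_mkcond (subst2_signed o1 o2 d0); last first.
  apply/(measurable_restrictT _ measurable_delta2)/measurable_EFinP/measurable_funTS.
  exact: measurable_tri.
rewrite [RHS]integral_mkcond; apply: eq_integral => w _; rewrite d1 mul1e /patch.
have [Dw|nDw] := pselect (delta2 w).
  by have Dw' := (dE w).1 Dw; rewrite !mem_set //= tE.
have nDw' : ~ delta2 (o1 + m11 * w.1 + m21 * w.2, o2 + m12 * w.1 + m22 * w.2).
  by move=> /(dE w).2.
by rewrite !memNset.
Qed.

Lemma tri_int_swap23 a b c f : continuous f -> tri_int a b c f = tri_int a c b f.
Proof.
move=> cf; apply: (@tri_int_subst 0 0 0 1 1 0) => //.
- by rewrite mul0r mulr1 sub0r normrN1.
- move=> [w1 w2]; rewrite /delta2 /=; split => -[*]; split; lra.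
- by move=> [w1 w2]; apply/rowP => j; rewrite !mxE /=; ring.
Qed.

Lemma tri_int_swap12 a b c f : continuous f -> tri_int a b c f = tri_int b a c f.
Proof.
move=> cf; apply: (@tri_int_subst 1 0 (-1) 0 (-1) 1) => //.
- by rewrite mul0r mulr1 subr0 normrN1.
- move=> [w1 w2]; rewrite /delta2 /=; split => -[*]; split; lra.
- by move=> [w1 w2]; apply/rowP => j; rewrite !mxE /=; ring.
Qed.

End TriangleIntegral.

(** * The divergence theorem on an arbitrary tetrahedron *)

Section TetrahedronDivergence.
Variable R : realType.
Local Notation P := 'rV[R]_3.
Implicit Types (f g : P -> R) (x a b c : P).

Definition osimp (x0 x1 x2 x3 : P) : set P := [set x | exists y : P, delta3 y /\
  x = x0 + (y 0 0 *: (x1 - x0) + y 0 1 *: (x2 - x0) + y 0 ord_max *: (x3 - x0))].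

(** Six times the signed volume. *)
Definition vol (x0 x1 x2 x3 : P) : R := dotp (x3 - x0) (crossp (x1 - x0) (x2 - x0)).

Lemma osimp_rot x0 x1 x2 x3 : osimp x0 x1 x2 x3 = osimp x0 x2 x3 x1.
Proof.
apply/seteqP; split => x [y [[y0 y1] ->]].
  exists (vec3 (y 0 1, y 0 ord_max, y 0 0)); split; last by rewrite !vec3E /=; vec_ring.
  split; last by rewrite !vec3E /=; lra.
  by apply: forall3; rewrite !vec3E /=; exact: y0.
exists (vec3 (y 0 ord_max, y 0 0, y 0 1)); split; last first.
  by rewrite !vec3E /=; vec_ring.
split; last by rewrite !vec3E /=; lra.
by apply: forall3; rewrite !vec3E /=; exact: y0.
Qed.

Lemma vol_rot x0 x1 x2 x3 : vol x0 x1 x2 x3 = vol x0 x2 x3 x1.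
Proof. by rewrite /vol !dotpE !vec3E !mxE /=; ring. Qed.

Lemma lincomb_rows3 (y u v w : P) : y 0 0 *: u + y 0 1 *: v + y 0 ord_max *: w = y *m rows3 u v w.
Proof. by rewrite -[y in RHS]unvec3K mul_rows3. Qed.

Lemma osimpP x0 x1 x2 x3 (y : P) : vol x0 x1 x2 x3 != 0 ->
  delta3 y <-> osimp x0 x1 x2 x3 (x0 + y *m rows3 (x1 - x0) (x2 - x0) (x3 - x0)).
Proof.
move=> V0; have uB : rows3 (x1 - x0) (x2 - x0) (x3 - x0) \in unitmx.
  by rewrite unitmxE unitfE det_rows3.
split=> [dy|[y' [dy' /addrI]]]; first by exists y; split => //; rewrite lincomb_rows3.
by rewrite lincomb_rows3 => /(can_inj (mulmxK uB)) ->.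
Qed.

Lemma osimpE x0 x1 x2 x3 : vol x0 x1 x2 x3 != 0 -> osimp x0 x1 x2 x3 =
  (fun x => - x0 *m invmx (rows3 (x1 - x0) (x2 - x0) (x3 - x0)) +
     x *m invmx (rows3 (x1 - x0) (x2 - x0) (x3 - x0))) @^-1` @delta3 R.
Proof.
move=> V0; have uB : rows3 (x1 - x0) (x2 - x0) (x3 - x0) \in unitmx.
  by rewrite unitmxE unitfE det_rows3.
apply/seteqP; split => x /=; rewrite -mulmxDl addrC.
  by move=> [y [dy ->]]; rewrite addrC addKr lincomb_rows3 mulmxK.
by move=> h; exists ((x - x0) *m invmx (rows3 (x1 - x0) (x2 - x0) (x3 - x0)));
   split => //; rewrite lincomb_rows3 mulmxKV // addrC subrK.
Qed.

Lemma open_osimp x0 x1 x2 x3 : vol x0 x1 x2 x3 != 0 -> open (osimp x0 x1 x2 x3).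
Proof.
move=> V0; rewrite osimpE //; move: (@open_delta3 R).
by move: (@continuous_affine R (- x0 *m invmx (rows3 (x1 - x0) (x2 - x0) (x3 - x0)))
  (invmx (rows3 (x1 - x0) (x2 - x0) (x3 - x0)))) => /continuousP; exact.
Qed.

Lemma is_derive_affine f x0 (B : 'M[R]_3) (y v : P) d : is_derive (x0 + y *m B) (v *m B) f d ->
  is_derive y v (fun z => f (x0 + z *m B)) d.
Proof.
move=> [df vf]; have E : (fun h : R => h^-1 *: (((fun z => f (x0 + z *m B)) \o shift y) (h *: v) - f (x0 + y *m B)))
    = (fun h => h^-1 *: ((f \o shift (x0 + y *m B)) (h *: (v *m B)) - f (x0 + y *m B))).
  apply/funext => h /=; congr (_ *: (f _ - _)).
  by rewrite mulmxDl -scalemxAl addrCA.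
by split; rewrite /derivable /derive E.
Qed.

Lemma comp_affine_continuous f x0 (B : 'M[R]_3) : continuous f -> continuous (fun y : P => f (x0 + y *m B)).
Proof. by move=> cf y; apply: (continuous_comp (@continuous_affine _ _ _ y)); exact: cf. Qed.

Lemma vint_osimp x0 x1 x2 x3 g : vol x0 x1 x2 x3 != 0 -> continuous g ->
  vint (osimp x0 x1 x2 x3) g = `|vol x0 x1 x2 x3| *
    vint (@delta3 R) (fun y => g (x0 + y *m rows3 (x1 - x0) (x2 - x0) (x3 - x0))).
Proof.
move=> V0 cg; have dB := det_rows3 (x1 - x0) (x2 - x0) (x3 - x0).
have B0 : \det (rows3 (x1 - x0) (x2 - x0) (x3 - x0)) != 0 by rewrite dB.
have mO := open_measurable_vec3 (open_osimp V0).
rewrite (vint_affine B0 cg mO (fun y => osimpP y V0)) dB.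
have mD := open_measurable_vec3 (@open_delta3 R).
have cF := comp_affine_continuous (x0 := x0) (B := rows3 (x1 - x0) (x2 - x0) (x3 - x0)) cg.
exact: (@RintegralZl _ _ _ (@leb3 R) _ _ _ mD (continuous_integrable3 mD (@bounded_delta3 R) cF)).
Qed.

(** In reference coordinates the edge [x3 - x0] is the last axis. Its segments start on the face x0
    x1 x2 and end on the slanted face, over which (w1, w2, 1 - w1 - w2) is exactly
    [tri_pt x3 x1 x2]. *)
Lemma osimp_ftc x0 x1 x2 x3 f g : vol x0 x1 x2 x3 != 0 -> continuous f -> continuous g ->
  (forall x, is_derive x (x3 - x0) f (g x)) ->
  vint (osimp x0 x1 x2 x3) g = `|vol x0 x1 x2 x3| * (tri_int x3 x1 x2 f - tri_int x0 x1 x2 f).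
Proof.
move=> V0 cf cg fg; rewrite vint_osimp //; congr (_ * _).
set B := rows3 _ _ _.
have cF := comp_affine_continuous (x0 := x0) (B := B) cf.
have cF' := comp_affine_continuous (x0 := x0) (B := B) cg.
have e3B : delta_mx 0 ord_max *m B = x3 - x0.
  by rewrite -rowE; apply/rowP => j; rewrite !mxE.
have dF (y : P) : is_derive y (delta_mx 0 ord_max) (fun z => f (x0 + z *m B)) (g (x0 + y *m B)).
  by apply: is_derive_affine; rewrite e3B.
rewrite (vint_delta3 cF cF' dF).
rewrite /tri_int -(@RintegralB _ _ _ (@leb2 R) _ _ _ (@measurable_delta2 R) (integrable_tri _ _ _ cf) (integrable_tri _ _ _ cf)).
apply: eq_Rintegral => w _; congr (f _ - f _); rewrite mul_rows3 /tri_pt /=.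
  by vec_ring.
by rewrite scale0r addr0 addrA.
Qed.

Definition nice (D : set P) : Prop := measurable (@vec3 R @^-1` D) /\ exists K, bounded3 K D.

Lemma nice_integrable D f : nice D -> continuous f ->
  (@leb3 R).-integrable (@vec3 R @^-1` D) (EFin \o (f \o @vec3 R)).
Proof. by move=> [mD [K bD]] cf; exact: continuous_integrable3 bD cf. Qed.

Lemma vintD D f g : nice D -> continuous f -> continuous g ->
  vint D (fun x => f x + g x) = vint D f + vint D g.
Proof.
move=> nD cf cg; have [mD _] := nD.
exact: (@RintegralD _ _ _ (@leb3 R) _ _ _ mD (nice_integrable nD cf) (nice_integrable nD cg)).
Qed.

Lemma vintZ D f k : nice D -> continuous f -> vint D (fun x => k * f x) = k * vint D f.
Proof.
move=> nD cf; have [mD _] := nD.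
exact: (@RintegralZl _ _ _ (@leb3 R) _ _ _ mD (nice_integrable nD cf)).
Qed.

Lemma le_vint D f g : nice D -> continuous f -> continuous g -> (forall x, D x -> f x <= g x) ->
  vint D f <= vint D g.
Proof.
move=> nD cf cg fg; have [mD _] := nD.
exact: (@le_Rintegral _ _ _ (@leb3 R) _ _ _ mD (nice_integrable nD cf) (nice_integrable nD cg) (fun p => fg (vec3 p))).
Qed.

Lemma nice_osimp x0 x1 x2 x3 : vol x0 x1 x2 x3 != 0 -> nice (osimp x0 x1 x2 x3).
Proof.
move=> V0; split; first exact: (open_measurable_vec3 (open_osimp V0)).
pose B := rows3 (x1 - x0) (x2 - x0) (x3 - x0).
have H i : exists M, forall y : P, (forall i, `|y 0 i| <= 1) -> `|(x0 + y *m B) 0 i| <= M.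
  by apply: continuous_bounded3; exact: (comp_affine_continuous (@cont_coord R i)).
have [M0 H0] := H 0; have [M1 H1] := H 1; have [M2 H2] := H ord_max.
exists (Num.max M0 (Num.max M1 M2)) => x [y [dy ->]]; rewrite lincomb_rows3.
have by1 := bounded_delta3 dy.
by apply: forall3; rewrite !le_max ?H0 ?H1 ?H2 ?orbT.
Qed.

(** The gradient is explicit data, so that divergences of products come out as formulas accessible
    to [ring]. *)
Definition C1 f (G : P -> P) : Prop := [/\ continuous f,
  forall i, continuous (fun x => G x 0 i) & forall x v, is_derive x v f (dotp (G x) v)].

(* For a tetrahedron with apex p, the outward flux of w through the face abc: the
   sign makes it independent of the order of a, b, c. *)
Definition outflux (p a b c : P) (w : P -> P) : R :=
  - (Num.sg (dotp (p - a) (crossp (b - a) (c - a))) *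
     tri_int a b c (fun x => dotp (w x) (crossp (b - a) (c - a)))).

Lemma cont_dotp (T : topologicalType) (w : T -> P) (v : P) : (forall i, continuous (fun t => w t 0 i)) ->
  continuous (fun t => dotp (w t) v).
Proof. by move=> cw; apply: cont_sum => i; apply: contM => //; exact: cont_cst. Qed.

Lemma dotp_C1 (w : P -> P) (G : 'I_3 -> P -> P) (v : P) : (forall i, C1 (fun x => w x 0 i) (G i)) ->
  C1 (fun x => dotp (w x) v) (fun x => \sum_i v 0 i *: G i x).
Proof.
move=> hw; split.
- by apply: cont_dotp => i; case: (hw i).
- move=> j; under eq_fun do rewrite summxE; apply: cont_sum => i.
  under eq_fun do rewrite mxE; apply: contM; first exact: cont_cst.
  by case: (hw i).
- move=> x u.
  have -> : (fun y => dotp (w y) v) = \sum_i (fun y => v 0 i *: w y 0 i).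
    by apply/funext => y; rewrite fct_sumE; apply: eq_bigr => i _; rewrite mulrC.
  have -> : dotp (\sum_i v 0 i *: G i x) u = \sum_i (v 0 i *: dotp (G i x) u).
    rewrite /dotp; under [RHS]eq_bigr do rewrite scaler_sumr.
    rewrite exchange_big /=; apply: eq_bigr => j _.
    by rewrite summxE mulr_suml; apply: eq_bigr => i _; rewrite mxE -mulrA.
  apply: is_derive_sum => i; apply: is_deriveZ.
  by have [_ _ /(_ x u)] := hw i.
Qed.

(** Expressed in the basis of the edges issuing from [x0], the divergence is a sum of three
    derivatives along edges, each integrated by [osimp_ftc]. Each yields the flux through one face
    at [x0] and a term on the opposite face. *)
Lemma osimp_divergence x0 x1 x2 x3 (w : P -> P) (G : 'I_3 -> P -> P) : vol x0 x1 x2 x3 != 0 ->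
  (forall i, C1 (fun x => w x 0 i) (G i)) ->
  vint (osimp x0 x1 x2 x3) (fun x => \sum_i G i x 0 i) =
    outflux x0 x1 x2 x3 w + outflux x1 x0 x2 x3 w + outflux x2 x0 x1 x3 w + outflux x3 x0 x1 x2 w.
Proof.
move=> V0 hw; set V := vol x0 x1 x2 x3 in V0 *.
pose e1 := x1 - x0; pose e2 := x2 - x0; pose e3 := x3 - x0.
pose c1 := crossp e2 e3; pose c2 := crossp e3 e1; pose c3 := crossp e1 e2.
pose d (c : P) x : P := \sum_i c 0 i *: G i x.
have hd c : C1 (fun x => dotp (w x) c) (d c) by exact: dotp_C1.
have cw c : continuous (fun x => dotp (w x) c) by have [] := hd c.
have cd c v : continuous (fun x => dotp (d c x) v).
  by apply: cont_dotp => i; have [] := hd c.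
have ftc (y1 y2 y3 c : P) : osimp x0 y1 y2 y3 = osimp x0 x1 x2 x3 -> vol x0 y1 y2 y3 = V ->
    vint (osimp x0 x1 x2 x3) (fun x => dotp (d c x) (y3 - x0)) =
    `|V| * (tri_int y3 y1 y2 (fun x => dotp (w x) c) - tri_int x0 y1 y2 (fun x => dotp (w x) c)).
  move=> <- yV; rewrite -yV; apply: osimp_ftc => //; first by rewrite yV.
  by move=> x; have [_ _] := hd c; exact.
have nD := nice_osimp V0.
have VE : V = dotp e3 c3 by [].
(* c1, c2, c3 is V times the dual basis of e1, e2, e3. *)
have trace x : V * \sum_i G i x 0 i = dotp (d c1 x) e1 + (dotp (d c2 x) e2 + dotp (d c3 x) e3).
  rewrite VE /d /c1 /c2 /c3 !sum3 !dotpE !vec3E; move: (e1) (e2) (e3) => u1 u2 u3.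
  by rewrite !mxE /=; ring.
have cdiv : continuous (fun x => \sum_i G i x 0 i).
  by apply: cont_sum => i; have [_ ] := hw i.
apply: (mulfI V0); rewrite -vintZ //.
under [X in vint _ X]funext do rewrite trace.
rewrite vintD //; last by apply: contD; exact: cd.
rewrite vintD //.
rewrite (ftc x2 x3 x1 c1); [|exact/esym/osimp_rot|exact/esym/vol_rot].
rewrite (ftc x3 x1 x2 c2); [|exact: osimp_rot|exact: vol_rot].
rewrite (ftc x1 x2 x3 c3) //.
(* The three terms on the face x1 x2 x3 recombine into one flux because c0 = c1 + c2 + c3. *)
pose c0 := crossp (x2 - x1) (x3 - x1).
have c0E : tri_int x1 x2 x3 (fun x => dotp (w x) c0) = tri_int x1 x2 x3 (fun x => dotp (w x) c1)
    + (tri_int x1 x2 x3 (fun x => dotp (w x) c2) + tri_int x1 x2 x3 (fun x => dotp (w x) c3)).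
  rewrite -tri_intD // -tri_intD //; last by apply: contD; exact: cw.
  apply: eq_tri_int => t _; rewrite !dotpE /c0 /c1 /c2 /c3 /e1 /e2 /e3 !vec3E !mxE /=; ring.
have f0 : outflux x0 x1 x2 x3 w = Num.sg V * tri_int x1 x2 x3 (fun x => dotp (w x) c0).
  rewrite /outflux -/c0; have -> : dotp (x0 - x1) c0 = - V.
    by rewrite VE !dotpE /c0 /c3 /e1 /e2 /e3 !vec3E !mxE /=; ring.
  by rewrite sgrN mulNr opprK.
have f1 : outflux x1 x0 x2 x3 w = - (Num.sg V * tri_int x0 x2 x3 (fun x => dotp (w x) c1)).
  rewrite /outflux -/e2 -/e3 -/c1; have -> // : dotp (x1 - x0) c1 = V.
  by rewrite VE !dotpE /c1 /c3 /e1 /e2 /e3 !vec3E !mxE /=; ring.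
have f2 : outflux x2 x0 x1 x3 w = - (Num.sg V * tri_int x0 x1 x3 (fun x => dotp (w x) c2)).
  rewrite /outflux -/e1 -/e3; have -> : dotp (x2 - x0) (crossp e1 e3) = - V.
    by rewrite VE !dotpE /c3 /e1 /e2 /e3 !vec3E !mxE /=; ring.
  have -> : (fun x => dotp (w x) (crossp e1 e3)) = (fun x => -1 * dotp (w x) c2).
    by apply/funext => x; rewrite !dotpE /c2 !vec3E /=; ring.
  by rewrite tri_intZ // sgrN; ring.
have f3 : outflux x3 x0 x1 x2 w = - (Num.sg V * tri_int x0 x1 x2 (fun x => dotp (w x) c3)) by [].
rewrite f0 f1 f2 f3 c0E (tri_int_swap23 x2 x3 x1) // (tri_int_swap12 x2 x1 x3) //.
rewrite (tri_int_swap23 x0 x3 x1) // (tri_int_swap12 x3 x1 x2) // (tri_int_swap23 x1 x3 x2) //.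
rewrite [`|V|]normrEsg.
repeat match goal with |- context [tri_int ?a ?b ?c ?f] => move: (tri_int a b c f) end.
by move: (Num.sg V) => *; ring.
Qed.

End TetrahedronDivergence.

(** * Calculus of fluxes and the trace inequality *)

Section Flux.
Variable R : realType.
Local Notation P := 'rV[R]_3.
Implicit Types (f g : P -> R) (p a b c v : P) (w : P -> P).

Definition contv w : Prop := forall i, continuous (fun x => w x 0 i).

Lemma outflux_swap23 p a b c w : contv w -> outflux p a b c w = outflux p a c b w.
Proof.
move=> cw; rewrite /outflux.
have E v : dotp v (crossp (c - a) (b - a)) = - dotp v (crossp (b - a) (c - a)).
  by rewrite !dotpE !vec3E /=; ring.
rewrite E sgrN; under [X in tri_int a c b X]funext do rewrite E -mulN1r.
rewrite tri_intZ ?(tri_int_swap23 a c b); try by [exact: cont_dotp]; ring.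
Qed.

Lemma outflux_swap12 p a b c w : contv w -> outflux p a b c w = outflux p b a c w.
Proof.
move=> cw; rewrite /outflux.
have E v : dotp v (crossp (a - b) (c - b)) = - dotp v (crossp (b - a) (c - a)).
  by rewrite !dotpE !vec3E !mxE /=; ring.
rewrite E sgrN; under [X in tri_int b a c X]funext do rewrite E -mulN1r.
have -> : dotp (p - b) (crossp (b - a) (c - a)) = dotp (p - a) (crossp (b - a) (c - a)).
  by rewrite !dotpE !vec3E !mxE /=; ring.
rewrite tri_intZ ?(tri_int_swap12 b a c); try by [exact: cont_dotp]; ring.
Qed.

Lemma outflux_opp p q a b c w :
  Num.sg (dotp (q - a) (crossp (b - a) (c - a))) = - Num.sg (dotp (p - a) (crossp (b - a) (c - a))) ->
  outflux q a b c w = - outflux p a b c w.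
Proof. by rewrite /outflux => ->; ring. Qed.

Lemma outfluxB p a b c w w' : contv w -> contv w' ->
  outflux p a b c (fun x => w x - w' x) = outflux p a b c w - outflux p a b c w'.
Proof.
move=> cw cw'; rewrite /outflux.
have -> : (fun x => dotp (w x - w' x) (crossp (b - a) (c - a))) =
   (fun x => dotp (w x) (crossp (b - a) (c - a)) + -1 * dotp (w' x) (crossp (b - a) (c - a))).
  by apply/funext => x; rewrite !dotpE !mxE; ring.
have cd := cont_dotp (v := crossp (b - a) (c - a)) cw; have cd' := cont_dotp (v := crossp (b - a) (c - a)) cw'.
rewrite tri_intD //; last by apply: contM => //; exact: cont_cst.
by rewrite tri_intZ //; ring.
Qed.

Lemma outflux_eq0 p a b c w :
  (forall t, delta2 t -> dotp (w (tri_pt a b c t)) (crossp (b - a) (c - a)) = 0) -> outflux p a b c w = 0.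
Proof.
move=> w0; rewrite /outflux (@eq_tri_int _ _ _ _ _ (fun=> 0)) //.
by rewrite /tri_int /Rintegral integral0 mulr0 oppr0.
Qed.

Lemma tri_int_ge0 a b c f : (forall x, 0 <= f x) -> 0 <= tri_int a b c f.
Proof. by move=> f0; apply: Rintegral_ge0. Qed.

Lemma norm_outflux p a b c w : contv w ->
  `|outflux p a b c w| <= tri_int a b c (fun x => `|dotp (w x) (crossp (b - a) (c - a))|).
Proof.
move=> cw; have cd := cont_dotp (v := crossp (b - a) (c - a)) cw.
rewrite normrN normrM; apply: (@le_trans _ _ (1 * `|tri_int a b c (fun x => dotp (w x) (crossp (b - a) (c - a)))|)).
  by apply: ler_wpM2r => //; rewrite normr_sg lern1 leq_b1.
rewrite mul1r ler_norml; apply/andP; split.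
  rewrite lerNl -mulN1r -tri_intZ //; apply: le_tri_int.
  - by apply: contM => //; exact: cont_cst.
  - exact: cont_norm.
  - by move=> t _; rewrite mulN1r; apply: le_trans (ler_norm _) _; rewrite normrN.
apply: le_tri_int => //; first exact: cont_norm.
by move=> t _; exact: ler_norm.
Qed.

Lemma C1_cst (k : R) : C1 (fun=> k) (fun=> 0 : P).
Proof.
split; first exact: cont_cst.
  by move=> i; exact: cont_cst.
move=> x v; rewrite /dotp big1; last by move=> i _; rewrite mxE mul0r.
exact: is_derive_cst.
Qed.

Lemma C1_coord i : C1 (fun x : P => x 0 i) (fun=> delta_mx 0 i).
Proof.
split; first exact: cont_coord.
  by move=> j; exact: cont_cst.
move=> x v; have -> : dotp (delta_mx 0 i) v = v 0 i.
  rewrite /dotp (bigD1 i) //= big1 => [|j ji]; first by rewrite mxE !eqxx mul1r addr0.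
  by rewrite mxE (negbTE ji) andbF mul0r.
have E : (fun h : R => h^-1 *: (((fun y : P => y 0 i) \o shift x) (h *: v) - x 0 i)) @ 0^' --> v 0 i.
  apply: (@cvg_trans _ ((fun=> v 0 i) @ (0 : R)^')); last exact: cvg_cst.
  apply: near_eq_cvg; near=> h.
  have h0 : h != 0 by near: h; exact: nbhs_dnbhs_neq.
  by rewrite /= !mxE addrK -[_ *: _]/(_ * _) mulKf.
by split; [apply/cvg_ex; exists (v 0 i)|exact: cvg_lim].
Unshelve. all: by end_near.
Qed.

Lemma C1D f g (F G : P -> P) : C1 f F -> C1 g G -> C1 (fun x => f x + g x) (fun x => F x + G x).
Proof.
move=> [cf cF df] [cg cG dg]; split; first exact: contD.
  by move=> i; under eq_fun do rewrite mxE; exact: contD.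
move=> x v; have -> : dotp (F x + G x) v = dotp (F x) v + dotp (G x) v.
  by rewrite !dotpE !mxE; ring.
exact: (is_deriveD (df x v) (dg x v)).
Qed.

Lemma C1M f g (F G : P -> P) : C1 f F -> C1 g G ->
  C1 (fun x => f x * g x) (fun x => f x *: G x + g x *: F x).
Proof.
move=> [cf cF df] [cg cG dg]; split; first exact: contM.
  by move=> i; under eq_fun do rewrite !mxE; apply: contD; exact: contM.
move=> x v; have -> : dotp (f x *: G x + g x *: F x) v = f x *: dotp (G x) v + g x *: dotp (F x) v.
  by rewrite !dotpE !mxE -!/(_ * _) /GRing.scale /=; ring.
exact: (is_deriveM (df x v) (dg x v)).
Qed.

Lemma dotp_sqr_ge0 (v : P) : 0 <= dotp v v.
Proof. by rewrite dotpE -!expr2 !addr_ge0 ?sqr_ge0. Qed.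

Lemma dotp_CS (u v : P) : dotp u v ^+ 2 <= dotp u u * dotp v v.
Proof.
rewrite -subr_ge0; have -> : dotp u u * dotp v v - dotp u v ^+ 2 = dotp (crossp u v) (crossp u v).
  by rewrite !dotpE !vec3E /=; ring.
exact: dotp_sqr_ge0.
Qed.

(** The divergence of the field is 3 f^2 + 2 f G.(x - p), and the last term is at most f^2 + |G|^2
    |x - p|^2; hence the constants 4 and [h]. *)
Lemma trace_inequality p a b c f (G : P -> P) h : C1 f G -> vol p a b c != 0 ->
  (forall x, osimp p a b c x -> dotp (x - p) (x - p) <= h) ->
  `|vol p a b c| * tri_int a b c (fun x => f x ^+ 2) <=
    vint (osimp p a b c) (fun x => 4 * f x ^+ 2 + h * dotp (G x) (G x)).
Proof.
move=> hf V0 hh; have [cf cG df] := hf.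
(* This field has no flux through the three faces containing p. *)
pose w x : P := f x ^+ 2 *: (x - p).
pose Gw i x : P := (f x * f x) *: (delta_mx 0 i + 0) + (x 0 i - p 0 i) *: (f x *: G x + f x *: G x).
have hw i : C1 (fun x => w x 0 i) (Gw i).
  have -> : (fun x => w x 0 i) = (fun x => (f x * f x) * (x 0 i + - p 0 i)).
    by apply/funext => x; rewrite !mxE expr2.
  exact: (C1M (C1M hf hf) (C1D (C1_coord i) (C1_cst (- p 0 i)))).
have cw : contv w by move=> i; have [] := hw i.
have nD := nice_osimp V0.
have := osimp_divergence V0 hw.
have D : dotp (p - a) (crossp (b - a) (c - a)) = - vol p a b c.
  by rewrite /vol !dotpE !vec3E !mxE /=; ring.
(* On the face opposite to [p], the product of x - p with the normal is constant, equal to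
   [vol p a b c]. *)
have -> : outflux p a b c w = `|vol p a b c| * tri_int a b c (fun x => f x ^+ 2).
  rewrite /outflux D sgrN.
  rewrite (@eq_tri_int _ _ _ _ _ (fun x => vol p a b c * f x ^+ 2)).
    by rewrite tri_intZ; [rewrite [`|_|]normrEsg; ring|exact: contX].
  by move=> t _; rewrite /w /vol /tri_pt !dotpE !vec3E !mxE /=; ring.
rewrite (@outflux_eq0 a); last by move=> t _; rewrite /w /tri_pt !dotpE !vec3E !mxE /=; ring.
rewrite (@outflux_eq0 b); last by move=> t _; rewrite /w /tri_pt !dotpE !vec3E !mxE /=; ring.
rewrite (@outflux_eq0 c); last by move=> t _; rewrite /w /tri_pt !dotpE !vec3E !mxE /=; ring.
rewrite !addr0 => <-; apply: le_vint => //.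
- by apply: cont_sum => i; have [_ ] := hw i.
- apply: contD; apply: contM; try exact: cont_cst; first exact: contX.
  by rewrite /dotp; apply: cont_sum => i; apply: contM; exact: cG.
move=> x /hh hx.
have -> : \sum_i Gw i x 0 i = 3 * f x ^+ 2 + 2 * (f x * dotp (G x) (x - p)).
  by rewrite sum3 dotpE /Gw !mxE /=; ring.
have := dotp_CS (G x) (x - p); have := sqr_ge0 (f x - dotp (G x) (x - p)).
have := ler_wpM2l (dotp_sqr_ge0 (G x)) hx.
by rewrite sqrrB (mulrC h); lra.
Qed.

End Flux.

(** * Triangles in the orthonormal charts of mesh faces *)

Section Charts.
Variable R : realType.
Local Notation P := 'rV[R]_3.
Local Notation R2 := (R * R)%type.
Implicit Types (a b c v o : P) (Q : 'M[R]_3).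

Definition otri a b c : set P := [set x | exists w, delta2 w /\ x = tri_pt a b c w].

(* [fchart F] is [chart (fframe F) (forigin F)]. *)
Definition chart Q o (s : R2) : P := o + s.1 *: row 0 Q + s.2 *: row 1 Q.

Lemma orthogonal_dotp Q i j : orthogonal_mx Q -> dotp (row i Q) (row j Q) = (i == j)%:R.
Proof.
move=> oQ; have := congr1 (fun M : 'M[R]_3 => M i j) oQ; rewrite !mxE => <-.
by apply: eq_bigr => k _; rewrite !mxE.
Qed.

Lemma orthogonal_decomp Q v : orthogonal_mx Q ->
  v = dotp v (row 0 Q) *: row 0 Q + dotp v (row 1 Q) *: row 1 Q + dotp v (row ord_max Q) *: row ord_max Q.
Proof.
move=> /mulmx1C oQ; rewrite -[v in LHS]mulmx1 -oQ mulmxA mulmx_sum_row sum3.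
have E i : (v *m Q^T) 0 i = dotp v (row i Q).
  by rewrite mxE; apply: eq_bigr => k _; rewrite !mxE.
by rewrite !E.
Qed.

Lemma dotpDl u v v' : dotp (u + v) v' = dotp u v' + dotp v v' :> R.
Proof. by rewrite !dotpE !mxE; ring. Qed.

Lemma dotpZl (k : R) (v v' : P) : dotp (k *: v) v' = k * dotp v v'.
Proof. by rewrite !dotpE !mxE; ring. Qed.

(** The cross product of the first two rows of an orthogonal matrix is the last row up to the sign
    of the determinant, which the absolute values absorb. *)
Lemma orthogonal_normal Q v : orthogonal_mx Q ->
  `|dotp v (crossp (row 0 Q) (row 1 Q))| = `|dotp v (row ord_max Q)|.
Proof.
move=> oQ; rewrite {1}(orthogonal_decomp v oQ) !dotpDl !dotpZl.
have -> : dotp (row 0 Q) (crossp (row 0 Q) (row 1 Q)) = 0 by rewrite dotpE !vec3E /=; ring.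
have -> : dotp (row 1 Q) (crossp (row 0 Q) (row 1 Q)) = 0 by rewrite dotpE !vec3E /=; ring.
have -> : dotp (row ord_max Q) (crossp (row 0 Q) (row 1 Q)) = \det Q.
  rewrite -det_rows3; congr (\det _); apply/matrixP => i j; rewrite !mxE.
  by move: i; apply: forall3.
have : \det Q ^+ 2 = 1 by rewrite expr2 -[in X in _ * X]det_tr -det_mulmx oQ det1.
rewrite !mulr0 !add0r normrM => /eqP; rewrite sqrf_eq1 => /orP[]/eqP ->;
  by rewrite ?normrN normr1 mulr1.
Qed.

Lemma chart_tri_pt Q o s : chart Q o s = tri_pt o (o + row 0 Q) (o + row 1 Q) s.
Proof. by rewrite /chart /tri_pt; vec_ring. Qed.

Lemma chart_coord Q o s : orthogonal_mx Q ->
  dotp (chart Q o s - o) (row 0 Q) = s.1 /\ dotp (chart Q o s - o) (row 1 Q) = s.2.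
Proof.
move=> oQ; have -> : chart Q o s - o = s.1 *: row 0 Q + s.2 *: row 1 Q.
  by rewrite /chart; vec_ring.
by split; rewrite dotpDl !dotpZl !(orthogonal_dotp _ _ oQ) /= ?mulr1 ?mulr0 ?addr0 ?add0r.
Qed.

(** In chart coordinates the triangle is the image of [delta2] under the affine map [S], and J is
    the absolute determinant of [S]. The same determinant relates the cross product of the edges to
    the unit normal, so one J serves for the surface integral and for the fluxes. *)
Lemma tri_chart Q o a b c : orthogonal_mx Q ->
  dotp (a - o) (row ord_max Q) = 0 -> dotp (b - o) (row ord_max Q) = 0 ->
  dotp (c - o) (row ord_max Q) = 0 ->
  exists J : R, [/\ 0 <= J,
    forall v, `|dotp v (crossp (b - a) (c - a))| = J * `|dotp v (row ord_max Q)| &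
    crossp (b - a) (c - a) != 0 -> measurable (chart Q o @^-1` otri a b c) /\
      forall g : P -> R, continuous g ->
      (\int[@leb2 R]_(s in chart Q o @^-1` otri a b c) (g (chart Q o s))%:E =
        (J * tri_int a b c g)%:E)%E].
Proof.
move=> oQ ha hb hc.
have co x : dotp (x - o) (row ord_max Q) = 0 ->
    x = chart Q o (dotp (x - o) (row 0 Q), dotp (x - o) (row 1 Q)).
  move=> hx; rewrite /chart /= -addrA; have := orthogonal_decomp (x - o) oQ.
  by rewrite hx scale0r addr0 => <-; rewrite addrC subrK.
pose al x := dotp (x - o) (row 0 Q); pose be x := dotp (x - o) (row 1 Q).
have Ea : a = chart Q o (al a, be a) by exact: co.
have Eb : b = chart Q o (al b, be b) by exact: co.
have Ec : c = chart Q o (al c, be c) by exact: co.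
pose m11 := al b - al a; pose m12 := be b - be a.
pose m21 := al c - al a; pose m22 := be c - be a.
pose dl := m11 * m22 - m12 * m21.
pose S (w : R2) : R2 := (al a + m11 * w.1 + m21 * w.2, be a + m12 * w.1 + m22 * w.2).
have tS w : tri_pt a b c w = chart Q o (S w).
  rewrite {1}Ea {1}Eb {1}Ec /tri_pt /chart /S /=; apply/rowP => j.
  by rewrite !mxE /m11 /m12 /m21 /m22; ring.
have cE : crossp (b - a) (c - a) = dl *: crossp (row 0 Q) (row 1 Q).
  have ba : b - a = m11 *: row 0 Q + m12 *: row 1 Q.
    rewrite {1}Ea {1}Eb /chart /=; apply/rowP => j; rewrite !mxE /m11 /m12; ring.
  have ca : c - a = m21 *: row 0 Q + m22 *: row 1 Q.
    rewrite {1}Ea {1}Ec /chart /=; apply/rowP => j; rewrite !mxE /m21 /m22; ring.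
  rewrite ba ca /dl; move: (row 0 Q) (row 1 Q) (m11) (m12) (m21) (m22) => t1 t2 n11 n12 n21 n22.
  by vec_ring3.
have dv v : `|dotp v (crossp (b - a) (c - a))| = `|dl| * `|dotp v (row ord_max Q)|.
  rewrite cE -(orthogonal_normal v oQ) -normrM; congr `|_|.
  by rewrite !dotpE !mxE /=; ring.
exists `|dl|; split => // n0.
have d0 : dl != 0 by apply: contraNneq n0 => d0; rewrite cE d0 scale0r.
have cinj : injective (chart Q o).
  move=> s s' E; have [] := chart_coord o s oQ; have [] := chart_coord o s' oQ.
  by rewrite E [s]surjective_pairing [s']surjective_pairing /= => -> -> -> ->.
pose S' (s : R2) : R2 := ((m22 * (s.1 - al a) - m21 * (s.2 - be a)) / dl,
    (m11 * (s.2 - be a) - m12 * (s.1 - al a)) / dl).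
have SK w : S' (S w) = w.
  rewrite /S' /S /= [RHS]surjective_pairing; congr (_, _); rewrite /dl in d0 *; field; exact: d0.
have S'K s : S (S' s) = s.
  rewrite /S' /S /= [RHS]surjective_pairing; congr (_, _); rewrite /dl in d0 *; field; exact: d0.
have preE : chart Q o @^-1` otri a b c = S' @^-1` @delta2 R.
  apply/seteqP; split => s /=.
    by move=> [w [dw]]; rewrite tS => /cinj ->; rewrite SK.
  by move=> ds; exists (S' s); split => //; rewrite tS S'K.
have m1 (k k' k'' : R) : measurable_fun setT (fun s : R2 => (k * (s.1 - k'') - k' * (s.2 - be a)) / dl).
  apply: measurable_funM => //; apply: measurable_funB; apply: measurable_funM => //;
  by apply: measurable_funB.
have m2 (k k' k'' : R) : measurable_fun setT (fun s : R2 => (k * (s.2 - k'') - k' * (s.1 - al a)) / dl).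
  apply: measurable_funM => //; apply: measurable_funB; apply: measurable_funM => //;
  by apply: measurable_funB.
have mS' : measurable_fun setT S' by apply: measurable_fun_pair; [exact: m1|exact: m2].
have mpre : measurable (chart Q o @^-1` otri a b c).
  by rewrite preE -[_ @^-1` _]setTI; apply: mS' => //; exact: measurable_delta2.
split => // g cg.
have mg : measurable_fun setT (fun s => g (chart Q o s)).
  by under eq_fun do rewrite chart_tri_pt; exact: measurable_tri.
rewrite integral_mkcond (subst2_signed (al a) (be a) d0); last first.
  by apply/(measurable_restrictT _ mpre)/measurable_EFinP/measurable_funTS.
have int := integrable_tri a b c cg.
transitivity (\int[@leb2 R]_(w in @delta2 R) (`|dl| * g (tri_pt a b c w))%:E)%E.
  rewrite [RHS]integral_mkcond; apply: eq_integral => w _; rewrite -/(S w) /patch preE.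
  have [Dw|nDw] := pselect (delta2 w).
    have Dw' : (S' @^-1` @delta2 R) (S w) by rewrite /= SK.
    by rewrite !mem_set //= tS EFinM.
  have nDw' : ~ (S' @^-1` @delta2 R) (S w) by rewrite /= SK.
  by rewrite !memNset ?mule0.
have -> : (\int[@leb2 R]_(w in @delta2 R) (`|dl| * g (tri_pt a b c w))%:E =
    `|dl|%:E * \int[@leb2 R]_(w in @delta2 R) (g (tri_pt a b c w))%:E)%E.
  rewrite -(@integralZl _ _ _ (@leb2 R) _ (@measurable_delta2 R) _ int).
  by apply: eq_integral => w _; rewrite EFinM.
rewrite EFinM /tri_int /Rintegral fineK //.
exact: (@integrable_fin_num _ _ _ (@leb2 R) _ (@measurable_delta2 R) _ int).
Qed.

End Charts.

(** * Simplicial complexes and meshes *)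

Section Simplices.
Variable R : realType.
Local Notation P := 'rV[R]_3.
Variables (I : finType) (x : I -> P).
Implicit Types (s t : {set I}) (a b c p q : I).

(** The open simplex. In a complex the open simplices are pairwise disjoint, whereas the closed ones
    share faces. *)
Definition ohull s : set P := [set y | exists u : I -> R, [/\ forall i, i \in s -> 0 < u i,
  \sum_(i in s) u i = 1 & y = \sum_(i in s) u i *: x i]].

Lemma ohull_hull s : ohull s `<=` conv_hull x s.
Proof. by move=> y [u [u0 u1 uy]]; exists u; split => // i /u0 /ltW. Qed.

Lemma ohull_nonempty s : s != finset.set0 -> ohull s !=set0.
Proof.
rewrite -card_gt0 => s0; exists (\sum_(i in s) #|s|%:R^-1 *: x i), (fun=> #|s|%:R^-1).
split => // [i _|]; first by rewrite invr_gt0 ltr0n.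
by rewrite sumr_const -[_ *+ _]mulr_natr mulVf // pnatr_eq0 -lt0n.
Qed.

Lemma sum_sub s t (V : nmodType) (F : I -> V) : s \subset t ->
  \sum_(i in s) F i = \sum_(i in t) (if i \in s then F i else 0).
Proof.
move=> /fintype.subsetP st; rewrite -big_mkcondr /=; apply: eq_bigl => i.
by case: (boolP (i \in s)) => [/st -> //|_]; rewrite andbF.
Qed.

(* The open simplex determines the barycentric coordinates, which are positive:
   a simplex meeting it along a common subface contains all its vertices. *)
Lemma ohull_subset s t y : affine_indep x s -> ohull s y -> conv_hull x (s :&: t)%SET y -> s \subset t.
Proof.
move=> hs [u [u0 u1 uy]] [w [w0 w1 wy]].
have ss : (s :&: t)%SET \subset s by apply: subsetIl.
pose w' i := if i \in (s :&: t)%SET then w i else 0.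
have E i : i \in s -> u i - w' i = 0.
  apply: (hs (fun i => u i - w' i)).
    by rewrite sumrB u1 /w' -(sum_sub w ss) w1 subrr.
  under eq_bigr do rewrite scalerBl.
  rewrite sumrB -uy wy (sum_sub _ ss) -sumrB big1 // => j _; rewrite /w'.
  by case: ifP => _; rewrite ?scale0r subrr.
apply/fintype.subsetP => i si; have := u0 _ si.
rewrite (subr0_eq (E _ si)) /w' inE si /=.
by case: ifP => //; rewrite ltxx.
Qed.

(** The hull is the continuous image of the compact set [K] of barycentric coordinates. Coordinates
    outside [s] are free in [0, 1] and do not affect the image. *)
Lemma conv_hull_compact s : compact (conv_hull x s).
Proof.
pose n := #|I|.
pose B : set 'rV[R]_n := [set v | forall j, (`[0, 1]%classic : set R) (v 0 j)].
have cB : compact B by exact: (@rV_compact R n (fun=> `[0, 1]%classic) (fun=> @segment_compact R 0 1)).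
pose g (v : 'rV[R]_n) : R := \sum_(i in s) v 0 (enum_rank i).
have cg : continuous g by apply: cont_sum => i v; exact: coord_continuous.
pose K := B `&` g @^-1` [set 1].
have cK : compact K.
  apply: compact_closedI => //; apply: closed_comp => [v _|]; first exact: cg.
  exact: closed_eq.
have -> : conv_hull x s = (fun v : 'rV[R]_n => \sum_(i in s) v 0 (enum_rank i) *: x i) @` K.
  apply/seteqP; split => [y [u [u0 u1 ->]]|y [v [Bv gv] <-]].
    exists (\row_j (if enum_val j \in s then u (enum_val j) else 0)); last first.
      by apply: eq_bigr => i si; rewrite mxE enum_rankK si.
    split; last first.
      by rewrite /= /g -[RHS]u1; apply: eq_bigr => i si; rewrite mxE enum_rankK si.
    move=> j; rewrite /= mxE in_itv /=; case: ifP => js; last by rewrite lexx ler01.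
    rewrite u0 //= -u1 (bigD1 (enum_val j)) //= lerDl sumr_ge0 // => i /andP[si _].
    exact: u0.
  exists (fun i => v 0 (enum_rank i)); split => //.
  by move=> i _; have := Bv (enum_rank i); rewrite /= in_itv /= => /andP[].
apply: continuous_compact => //; apply: continuous_subspaceT.
apply: continuous_rV3 => j.
under eq_fun do rewrite summxE.
apply: cont_sum => i; under eq_fun do rewrite mxE.
by apply: contM; [move=> v; exact: coord_continuous|exact: cont_cst].
Qed.

Lemma closed_conv_hull s : closed (conv_hull x s).
Proof. by apply: compact_closed; [exact: norm_hausdorff|exact: conv_hull_compact]. Qed.

Lemma bounded_conv_hull s : exists K, bounded3 K (conv_hull x s).
Proof.
exists (\sum_(i in s) (`|x i 0 0| + `|x i 0 1| + `|x i 0 ord_max|)) => y [u [u0 u1 ->]] j.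
have le1 i : i \in s -> u i <= 1.
  move=> si; rewrite -u1 (bigD1 i) //= lerDl sumr_ge0 // => k /andP[sk _]; exact: u0.
rewrite summxE; apply: le_trans (ler_norm_sum _ _ _) _; apply: ler_sum => i si.
rewrite mxE normrM ger0_norm ?u0 //.
apply: le_trans (ler_pM (u0 _ si) (normr_ge0 _) (le1 _ si) (lexx _)) _; rewrite mul1r.
have h0 := normr_ge0 (x i 0 0); have h1 := normr_ge0 (x i 0 1); have h2 := normr_ge0 (x i 0 ord_max).
by move: j; apply: forall3; lra.
Qed.

(** Affine independence is linear independence of the rows (1, x i), which have four entries. *)
Lemma affine_indep_card s : affine_indep x s -> (#|s| <= 4)%N.
Proof.
move=> hs; have [->|[i0 si0]] := set_0Vmem s; first by rewrite cards0.
pose A : 'M[R]_(#|s|, 1 + 3) := row_mx (const_mx 1) (\matrix_j x (enum_val j)).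
suff : row_free A by rewrite /row_free => /eqP <-; exact: rank_leq_col.
apply: inj_row_free => v; rewrite mul_mx_row => /eqP; rewrite -[X in _ == X]row_mx0 => /eqP.
move=> /eq_row_mx[v1 vx].
pose u i := v 0 (enum_rank_in si0 i).
have uE j : u (enum_val j) = v 0 j by rewrite /u enum_valK_in.
apply/rowP => j; rewrite mxE -uE; apply: hs; last exact: enum_valP.
  rewrite big_enum_val /=; have := congr1 (fun M : 'M[R]_1 => M 0 0) v1; rewrite !mxE => /(etrans _); apply.
  by apply: eq_bigr => k _; rewrite uE mxE mulr1.
rewrite big_enum_val /=; apply: etrans vx; rewrite mulmx_sum_row; apply: eq_bigr => k _.
by rewrite uE rowK.
Qed.

Lemma big_set2 (V : nmodType) (F : I -> V) a b : a != b ->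
  \sum_(i in (a |: [set b])%SET) F i = F a + F b.
Proof. by move=> ab; rewrite big_setU1 ?inE // big_set1. Qed.

Lemma big_set3 (V : nmodType) (F : I -> V) a b c : a != b -> a != c -> b != c ->
  \sum_(i in (a |: (b |: [set c]))%SET) F i = F a + (F b + F c).
Proof. by move=> ab ac bc; rewrite big_setU1 ?big_set2 // !inE negb_or ab. Qed.

Lemma big_set4 (V : nmodType) (F : I -> V) p a b c : p \notin (a |: (b |: [set c]))%SET ->
  a != b -> a != c -> b != c ->
  \sum_(i in (p |: (a |: (b |: [set c])))%SET) F i = F p + (F a + (F b + F c)).
Proof. by move=> pt ab ac bc; rewrite big_setU1 // big_set3. Qed.

Lemma pick3 (V : Type) a b c (k l m : V) : a != b -> a != c -> b != c ->
  exists u : I -> V, [/\ u a = k, u b = l & u c = m].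
Proof.
move=> ab ac bc; exists (fun i => if i == a then k else if i == b then l else m).
by rewrite !eqxx !(eq_sym _ a) (eq_sym c b) (negbTE ab) (negbTE ac) (negbTE bc).
Qed.

Lemma pick4 (V : Type) p a b c (k l m n : V) : p \notin (a |: (b |: [set c]))%SET ->
  a != b -> a != c -> b != c -> exists u : I -> V, [/\ u p = k, u a = l, u b = m & u c = n].
Proof.
rewrite !inE !negb_or => /and3P[pa pb pc] ab ac bc; have [u [ua ub uc]] := pick3 l m n ab ac bc.
by exists (fun i => if i == p then k else u i); rewrite eqxx !(eq_sym _ p) (negbTE pa) (negbTE pb) (negbTE pc).
Qed.

Lemma cards3P t : #|t| = 3 -> exists a b c, [/\ a != b, a != c, b != c & t = (a |: (b |: [set c]))%SET].
Proof.
move=> t3; have [a ta] : exists a, a \in t by apply/card_gt0P; rewrite t3.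
have : #|(t :\ a)%SET| == 2 by move: t3; rewrite (cardsD1 a) ta => /eqP; rewrite eqSS.
move=> /cards2P[b [c [bc E]]]; exists a, b, c.
have ba : b \in (t :\ a)%SET by rewrite E !inE eqxx.
have ca : c \in (t :\ a)%SET by rewrite E !inE eqxx orbT.
move: ba ca; rewrite !inE => /andP[ba _] /andP[ca _]; rewrite (eq_sym a b) (eq_sym a c); split => //.
by rewrite -E finset.setD1K.
Qed.

End Simplices.

Section LowSimplices.
Variable R : realType.
Local Notation P := 'rV[R]_3.
Variables (I : finType) (x : I -> P).
Implicit Types (s t : {set I}) (a b c p q : I).
Local Notation tri a b c := (a |: (b |: [set c]))%SET.

Lemma affine_indep3 a b c (k l : R) : a != b -> a != c -> b != c -> affine_indep x (tri a b c) ->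
  k *: (x b - x a) + l *: (x c - x a) = 0 -> k = 0 /\ l = 0.
Proof.
move=> ab ac bc hs E.
have [u [ua ub uc]] := pick3 (- (k + l)) k l ab ac bc.
have U := hs u; rewrite !big_set3 // ua ub uc in U.
have U0 : - (k + l) + (k + l) = 0 by ring.
have U1 : - (k + l) *: x a + (k *: x b + l *: x c) = 0.
  by rewrite -E; vec_ring.
by split; [rewrite -ub|rewrite -uc]; apply: U => //; rewrite !inE eqxx ?orbT.
Qed.

Lemma affine_indep4 p a b c (k l m : R) : p \notin tri a b c -> a != b -> a != c -> b != c ->
  affine_indep x (p |: tri a b c)%SET ->
  k *: (x a - x p) + l *: (x b - x p) + m *: (x c - x p) = 0 -> [/\ k = 0, l = 0 & m = 0].
Proof.
move=> pt ab ac bc hs E.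
have [u [up ua ub uc]] := pick4 (- (k + l + m)) k l m pt ab ac bc.
have U := hs u; rewrite !big_set4 // up ua ub uc in U.
have U0 : - (k + l + m) + (k + (l + m)) = 0 by ring.
have U1 : - (k + l + m) *: x p + (k *: x a + (l *: x b + m *: x c)) = 0.
  by rewrite -E; vec_ring.
by split; [rewrite -ua|rewrite -ub|rewrite -uc]; apply: U => //; rewrite !inE eqxx ?orbT.
Qed.

Lemma dotp_eq0 (v : P) : dotp v v = 0 -> v = 0.
Proof.
rewrite dotpE -!expr2 => E; apply/rowP => i; rewrite mxE; apply/eqP; rewrite -sqrf_eq0.
have h0 := sqr_ge0 (v 0 0); have h1 := sqr_ge0 (v 0 1); have h2 := sqr_ge0 (v 0 ord_max).
by apply/eqP; move: i; apply: forall3; lra.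
Qed.

Lemma cross_cross (u v : P) : crossp u (crossp u v) = dotp u v *: u - dotp u u *: v.
Proof. by apply/rowP; apply: forall3; rewrite !dotpE !mxE /= ?mxE /=; ring. Qed.

(** If e1 x e2 = 0, then e1 x (e1 x e2) = 0 is a linear relation in which e2 has coefficient |e1|^2.
    Independence gives e1 = 0, which is itself a relation. *)
Lemma affine_indep_cross a b c : a != b -> a != c -> b != c -> affine_indep x (tri a b c) ->
  crossp (x b - x a) (x c - x a) != 0.
Proof.
move=> ab ac bc hs; apply/eqP => n0.
set e1 := x b - x a in n0; set e2 := x c - x a in n0.
have E : (- dotp e1 e2) *: e1 + dotp e1 e1 *: e2 = 0.
  have -> : (- dotp e1 e2) *: e1 + dotp e1 e1 *: e2 = - crossp e1 (crossp e1 e2).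
    by rewrite cross_cross; vec_ring.
  by rewrite n0; vec_ring3.
have [_ /dotp_eq0 e10] := affine_indep3 ab ac bc hs E.
have [] : (1 : R) = 0 /\ (0 : R) = 0.
  by apply: (affine_indep3 ab ac bc hs); rewrite -/e1 e10 scaler0 scale0r addr0.
by move/eqP; rewrite oner_eq0.
Qed.

Lemma affine_indep_vol p a b c : p \notin tri a b c -> a != b -> a != c -> b != c ->
  affine_indep x (p |: tri a b c)%SET -> vol (x p) (x a) (x b) (x c) != 0.
Proof.
move=> pt ab ac bc hs; rewrite /vol -det_rows3; apply/negP => /det0P[v v0].
rewrite -lincomb_rows3 => E.
have [h0 h1 h2] := affine_indep4 pt ab ac bc hs E.
by move/eqP: v0; apply; apply/rowP; apply: forall3; rewrite mxE.
Qed.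

Lemma ohull3 a b c : a != b -> a != c -> b != c -> ohull x (tri a b c) = otri (x a) (x b) (x c).
Proof.
move=> ab ac bc; apply/seteqP; split => y.
  move=> [u [u0 u1 ->]]; rewrite !big_set3 // in u1 *.
  have h i : i \in tri a b c -> 0 < u i by exact: u0.
  have ha : 0 < u a by apply: h; rewrite !inE eqxx.
  have hb : 0 < u b by apply: h; rewrite !inE eqxx orbT.
  have hc : 0 < u c by apply: h; rewrite !inE eqxx !orbT.
  exists (u b, u c); split; first by split => //=; lra.
  have -> : u a = 1 - (u b + u c) by lra.
  by rewrite /tri_pt /=; vec_ring.
move=> [w [[w1 w2 w3] ->]].
have [u [ua ub uc]] := pick3 (1 - w.1 - w.2) w.1 w.2 ab ac bc.
exists u; rewrite !big_set3 // ua ub uc; split.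
- by move=> i; rewrite !inE => /or3P[]/eqP ->; rewrite ?ua ?ub ?uc; lra.
- by ring.
- by rewrite /tri_pt; vec_ring.
Qed.

Lemma ohull4 p a b c : p \notin tri a b c -> a != b -> a != c -> b != c ->
  ohull x (p |: tri a b c)%SET = osimp (x p) (x a) (x b) (x c).
Proof.
move=> pt ab ac bc.
apply/seteqP; split => y.
  move=> [u [u0 u1 ->]]; rewrite !big_set4 // in u1 *.
  have hp : 0 < u p by apply: u0; rewrite !inE eqxx.
  have ha : 0 < u a by apply: u0; rewrite !inE eqxx orbT.
  have hb : 0 < u b by apply: u0; rewrite !inE eqxx !orbT.
  have hc : 0 < u c by apply: u0; rewrite !inE eqxx !orbT.
  exists (vec3 (u a, u b, u c)); split.
    split; last by rewrite !vec3E /=; lra.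
    by apply: forall3; rewrite !vec3E.
  have -> : u p = 1 - (u a + u b + u c) by lra.
  by rewrite !vec3E /=; vec_ring.
move=> [w [[w0 w1] ->]].
have h0 := w0 0; have h1 := w0 1; have h2 := w0 ord_max.
have [u [up ua ub uc]] := pick4 (1 - (w 0 0 + w 0 1 + w 0 ord_max)) (w 0 0) (w 0 1) (w 0 ord_max) pt ab ac bc.
exists u; rewrite !big_set4 // up ua ub uc; split.
- move=> i; rewrite !inE => /or4P[]/eqP ->; rewrite ?up ?ua ?ub ?uc; lra.
- by ring.
- by vec_ring.
Qed.

(** The signed distance to the plane of the triangle, times twice its area. It is affine, hence
    averages with barycentric weights. *)
Definition side a b c (y : P) : R := dotp (y - x a) (crossp (x b - x a) (x c - x a)).

Lemma side_vertex a b c : [/\ side a b c (x a) = 0, side a b c (x b) = 0 & side a b c (x c) = 0].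
Proof. by split; rewrite /side dotpE !vec3E !mxE /=; ring. Qed.

Lemma side_sum a b c s (u : I -> R) : \sum_(i in s) u i = 1 ->
  side a b c (\sum_(i in s) u i *: x i) = \sum_(i in s) u i * side a b c (x i).
Proof.
move=> u1; rewrite /side.
have -> : \sum_(i in s) u i *: x i - x a = \sum_(i in s) u i *: (x i - x a).
  by under [RHS]eq_bigr do rewrite scalerBr; rewrite sumrB -scaler_suml u1 scale1r.
rewrite /dotp; under eq_bigr do rewrite summxE mulr_suml.
rewrite exchange_big /=; apply: eq_bigr => i _; rewrite mulr_sumr; apply: eq_bigr => j _.
by rewrite mxE mulrA.
Qed.

Lemma side_hull3 a b c y : a != b -> a != c -> b != c -> conv_hull x (tri a b c) y -> side a b c y = 0.
Proof.
move=> ab ac bc [u [_ u1 ->]]; rewrite side_sum // big_set3 //.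
by have [-> -> ->] := side_vertex a b c; rewrite !mulr0 !addr0.
Qed.

Lemma vol_side p a b c : vol (x p) (x a) (x b) (x c) = - side a b c (x p).
Proof. by rewrite /vol /side !dotpE !vec3E !mxE /=; ring. Qed.

Lemma side_neq0 p a b c : p \notin tri a b c -> a != b -> a != c -> b != c ->
  affine_indep x (p |: tri a b c)%SET -> side a b c (x p) != 0.
Proof.
by move=> *; have := @affine_indep_vol p a b c; rewrite vol_side oppr_eq0; apply.
Qed.

Lemma cards4P t s : t \subset s -> #|t| = 3 -> #|s| = 4 -> exists2 p, p \notin t & s = (p |: t)%SET.
Proof.
move=> ts t3 s4; have : #|(s :\: t)%SET| == 1 by rewrite cardsD (finset.setIidPr ts) s4 t3.
move=> /cards1P[p E]; exists p.
  have : p \in (s :\: t)%SET by rewrite E inE.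
  by rewrite inE => /andP[].
rewrite -E; apply/setP => i; rewrite !inE.
by case: (boolP (i \in t)) => [/(fintype.subsetP ts) ->|_] /=; rewrite ?orbT ?orbF.
Qed.

End LowSimplices.

(** * The tetrahedra adjacent to a triangle *)

Section ComplexGeometry.
Variable R : realType.
Local Notation P := 'rV[R]_3.
Variables (Omega : set P) (S : complex R).
Hypothesis cS : is_complex S.
Local Notation x := (@position R S).
Implicit Types (s t : {set vertex S}) (a b c p q : vertex S).
Local Notation tri a b c := (a |: (b |: [set c]))%SET.

Lemma complex_indep s : s \in simplices S -> affine_indep x s.
Proof. by case: cS => _ _ + _; exact. Qed.

Lemma complex_subset s t y : s \in simplices S -> t \in simplices S ->
  ohull x s y -> hull t y -> s \subset t.
Proof.
move=> sS tS ys yt; case: cS => _ _ _ /(_ s t sS tS) E.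
apply: (ohull_subset (complex_indep sS) ys); rewrite -[conv_hull _ _]/(hull _) -E.
by split => //; exact: ohull_hull.
Qed.

Lemma ohull_disjoint s t y : s \in simplices S -> t \in simplices S ->
  ohull x s y -> ohull x t y -> s = t.
Proof.
move=> sS tS ys yt; apply/eqP; rewrite finset.eqEsubset; apply/andP.
by split; [apply: (complex_subset sS tS ys)|apply: (complex_subset tS sS yt)]; exact: ohull_hull.
Qed.

Lemma tri_of_tet a b c p : (p |: tri a b c)%SET \in simplices S -> tri a b c \in simplices S.
Proof.
move=> sS; case: cS => _ + _ _ => /(_ _ (tri a b c) sS); apply; first exact: finset.subsetUr.
by apply/set0Pn; exists a; rewrite !inE eqxx.
Qed.

Lemma tet_side p a b c : p \notin tri a b c -> a != b -> a != c -> b != c ->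
  (p |: tri a b c)%SET \in simplices S -> side x a b c (x p) != 0.
Proof. by move=> pt ab ac bc /complex_indep; exact: side_neq0. Qed.

(** Two tetrahedra on the same side of a common face overlap near the barycentre of this face, and
    open simplices of a complex that meet are equal. *)
Lemma one_tet_per_side p q a b c : a != b -> a != c -> b != c ->
  p \notin tri a b c -> q \notin tri a b c ->
  (p |: tri a b c)%SET \in simplices S -> (q |: tri a b c)%SET \in simplices S ->
  Num.sg (side x a b c (x p)) = Num.sg (side x a b c (x q)) -> p = q.
Proof.
move=> ab ac bc pt qt pS qS sgE.
have p0 := tet_side pt ab ac bc pS; have q0 := tet_side qt ab ac bc qS.
have qV : \det (rows3 (x b - x a) (x c - x a) (x q - x a)) != 0 by rewrite det_rows3.
have uB : rows3 (x b - x a) (x c - x a) (x q - x a) \in unitmx by rewrite unitmxE unitfE.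
pose v := (x p - x a) *m invmx (rows3 (x b - x a) (x c - x a) (x q - x a)).
have vE : x p - x a = v 0 0 *: (x b - x a) + v 0 1 *: (x c - x a) + v 0 ord_max *: (x q - x a).
  by rewrite lincomb_rows3 /v mulmxKV.
have sE : side x a b c (x p) = v 0 ord_max * side x a b c (x q).
  rewrite /side vE (dotpDl (_ + _)) (dotpDl (v 0 0 *: _)) !dotpZl; have [_] := side_vertex x a b c; rewrite /side => -> ->.
  by rewrite !mulr0 !add0r.
(* In the frame of the tetrahedron with apex [q], the transversal coordinate of [p] is the quotient
   of the two values of [side], positive by the sign hypothesis. *)
have v3 : 0 < v 0 ord_max.
  have : Num.sg (v 0 ord_max) = 1.
    move: sgE; rewrite sE sgrM -[RHS]mul1r => /mulIf; apply.
    by rewrite sgr_eq0.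
  by move=> /eqP; rewrite sgr_cp0.
move: v3 vE {sE}; move: (v 0 0) (v 0 1) (v 0 ord_max) => l m n n0 vE.
have pE : x p = (1 - l - m - n) *: x a + (l *: x b + (m *: x c + n *: x q)).
  rewrite -[x p](subrK (x a)) vE; vec_ring.
pose A : R := `|1 - l - m - n| + `|l| + `|m|.
have nk := normr_ge0 (1 - l - m - n); have nl := normr_ge0 l; have nm := normr_ge0 m.
have A0 : 0 <= A by rewrite !addr_ge0.
(* The weight [e] of the apex is so small that e A < d, where d = (1 - e) / 3 is the weight of a, b
   and c. The weights d + e k obtained by expressing [p] through [q] then stay positive for |k| <=
   A. *)
pose e : R := (4 * (1 + A))^-1.
have e0 : 0 < e by rewrite invr_gt0; lra.
have eA : e + e * A = 1 / 4.
  have A1 : 4 * (1 + A) != 0 by rewrite gt_eqF //; lra.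
  have -> : e + e * A = (1 + A) * e by ring.
  by rewrite /e; field; rewrite gt_eqF //; lra.
have eA0 : 0 <= e * A by rewrite mulr_ge0 // ltW.
pose d : R := (1 - e) / 3.
have d0 : e * A < d by rewrite /d; lra.
have bd k : `|k| <= A -> 0 < d + e * k.
  move=> kA; have : - (e * A) <= e * k.
    rewrite -mulrN ler_pM2l //; rewrite lerNl; apply: le_trans kA.
    by rewrite -normrN; exact: ler_norm.
  by lra.
(* A point near the barycentre of abc, pushed towards p: it lies in both open
   tetrahedra. *)
pose y : P := d *: x a + d *: x b + d *: x c + e *: x p.
have H r (u0 ua ub uc : R) z : r \notin tri a b c -> 0 < u0 -> 0 < ua -> 0 < ub -> 0 < uc ->
    u0 + (ua + (ub + uc)) = 1 -> z = u0 *: x r + (ua *: x a + (ub *: x b + uc *: x c)) ->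
    ohull x (r |: tri a b c)%SET z.
  move=> rt h0 ha hb hc h1 hz; have [u [ur ua' ub' uc']] := pick4 u0 ua ub uc rt ab ac bc.
  exists u; rewrite !big_set4 // ur ua' ub' uc'; split => //.
  by move=> i; rewrite !inE => /or4P[]/eqP ->; rewrite ?ur ?ua' ?ub' ?uc'.
have yp : ohull x (p |: tri a b c)%SET y.
  have d1 : 0 < d by rewrite /d; lra.
  apply: (H p e d d d) => //; first by rewrite /d; lra.
  by rewrite /y; vec_ring.
have yq : ohull x (q |: tri a b c)%SET y.
  apply: (H q (e * n) (d + e * (1 - l - m - n)) (d + e * l) (d + e * m)) => //.
  - by rewrite mulr_gt0.
  - by apply: bd; rewrite /A; move: nk nl nm; lra.
  - by apply: bd; rewrite /A; move: nk nl nm; lra.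
  - by apply: bd; rewrite /A; move: nk nl nm; lra.
  - by rewrite /d; field.
  - by rewrite /y pE; vec_ring.
have /setP /(_ p) := ohull_disjoint pS qS yp yq.
by rewrite !inE eqxx /= => /esym; case/or4P => /eqP // E; move: pt; rewrite E !inE eqxx ?orbT.
Qed.

Hypothesis oO : open Omega.
Hypothesis covS : \bigcup_(s in [set s | s \in simplices S]) hull s = closure Omega.

Lemma cover_hull y : Omega y -> exists2 s, s \in simplices S & hull s y.
Proof.
move=> Oy; have : closure Omega y by exact: subset_closure.
by rewrite -covS => -[s /= sS ys]; exists s.
Qed.

(** Here [e] is 1 or -1 and selects the side. A short step from [y] along e nu leads to a point z of
    Omega, hence of some simplex s. This s also contains [y], so it has the triangle as a face; it
    is larger because z is off the plane, and its extra vertex lies on the side of z. *)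
Lemma two_sided a b c y (e : R) : a != b -> a != c -> b != c -> tri a b c \in simplices S ->
  ohull x (tri a b c) y -> Omega y -> Num.sg e = e -> e != 0 ->
  exists p, [/\ p \notin tri a b c, (p |: tri a b c)%SET \in simplices S &
    Num.sg (side x a b c (x p)) = e].
Proof.
move=> ab ac bc tS yt Oy sge e0.
set nu := crossp (x b - x a) (x c - x a).
have nu0 : nu != 0 by apply: (affine_indep_cross ab ac bc); exact: complex_indep.
have nu2 : 0 < dotp nu nu.
  by rewrite lt_neqAle dotp_sqr_ge0 andbT eq_sym; apply: contraNneq nu0 => /dotp_eq0 ->.
(* Hulls are closed, so near y there are only simplices containing y. *)
have U : nbhs y [set z | Omega z /\ forall s, hull s z -> hull s y].
  apply: (@filterI _ (nbhs y)); first exact: open_nbhs_nbhs.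
  apply: (@filter_forall _ _ _ (nbhs y)) => s; have [ys|nys] := pselect (hull s y).
    by apply: (@filterS _ _ _ setT) => //; exact: filterT.
  have : nbhs y (~` hull s).
    by apply: open_nbhs_nbhs; split => //; apply: closed_openC; exact: closed_conv_hull.
  by apply: filterS => z nz /nz.
have cl : continuous (fun r : R => y + r *: (e *: nu)).
  move=> r; apply: cvgD; first exact: cvg_cst.
  by apply: cvgZ; [exact: cvg_id|exact: cvg_cst].
have U' : nbhs (y + 0 *: (e *: nu)) [set z | Omega z /\ forall s, hull s z -> hull s y].
  by rewrite scale0r addr0.
have /nbhs_ballP[d /= d0 sub] := cl 0 _ U'.
have [|Oz hz] := sub (d / 2).
  by rewrite /ball /= sub0r normrN ger0_norm; lra.
set r := d / 2 in Oz hz; have r0 : 0 < r by rewrite /r; lra.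
clearbody r.
set z := y + r *: (e *: nu) in Oz hz.
have sz : side x a b c z = r * e * dotp nu nu.
  rewrite /side -/nu /z; have -> : y + r *: (e *: nu) - x a = (y - x a) + (r * e) *: nu.
    by vec_ring.
  rewrite dotpDl dotpZl; have := side_hull3 ab ac bc (ohull_hull yt).
  by rewrite /side -/nu => ->; rewrite add0r.
have [s sS zs] := cover_hull Oz.
have ts := complex_subset tS sS yt (hz _ zs).
have t3 : #|tri a b c| = 3.
  by rewrite !cardsU1 cards1 !inE negb_or ab ac bc.
have := affine_indep_card (complex_indep sS); rewrite leq_eqVlt ltnS => /orP[/eqP s4|s3]; last first.
  have ets : tri a b c = s by apply/eqP; rewrite eqEcard ts t3.
  have := side_hull3 (x := x) (y := z) ab ac bc; rewrite ets => /(_ zs) /eqP.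
  by rewrite sz !mulf_eq0 (negbTE e0) !gt_eqF.
have [p pt sE] := cards4P ts t3 s4; rewrite sE in sS zs.
exists p; split => //.
have [u [u0 u1 uz]] := zs.
have [h1 h2 h3] := side_vertex x a b c.
have : side x a b c z = u p * side x a b c (x p).
  by rewrite uz side_sum // big_set4 // h1 h2 h3 !mulr0 !addr0.
rewrite sz => E; have up : 0 < u p.
  rewrite lt_neqAle u0 ?inE ?eqxx // andbT eq_sym; apply/negP => /eqP up.
  by move/eqP: E; rewrite up mul0r !mulf_eq0 (negbTE e0) !gt_eqF.
have := congr1 Num.sg E; rewrite !sgrM (gtr0_sg r0) (gtr0_sg nu2) (gtr0_sg up).
by rewrite mul1r mulr1 mul1r sge.
Qed.

(** Dropping the vertices with zero barycentric coordinate leaves a face that has the point in its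
    open simplex. *)
Lemma cover_ohull y : Omega y -> exists2 s, s \in simplices S & ohull x s y.
Proof.
move=> /cover_hull[s sS [u [u0 u1 uy]]].
pose t := [set i in s | 0 < u i]%SET.
have ts : t \subset s by apply/fintype.subsetP => i; rewrite inE => /andP[].
have z i : i \in s -> i \notin t -> u i = 0.
  move=> si; rewrite inE si /= -leNgt => ui; apply/eqP; rewrite eq_le ui /=; exact: u0.
have E (V : nmodType) (F : vertex S -> V) : (forall i, u i = 0 -> F i = 0) ->
    \sum_(i in s) F i = \sum_(i in t) F i.
  move=> F0; rewrite (sum_sub _ ts); apply: eq_bigr => i si.
  by case: ifPn => // /(z _ si) /F0.
have u1' : \sum_(i in t) u i = 1 by rewrite -E.
exists t.
  case: cS => _ + _ _ => /(_ _ t sS ts); apply; apply/eqP => t0.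
  by move: u1'; rewrite t0 big_set0 => /eqP; rewrite eq_sym oner_eq0.
exists u; split => //; first by move=> i; rewrite inE => /andP[].
by rewrite uy; apply: E => i ->; rewrite scale0r.
Qed.

End ComplexGeometry.

(** * Diameters and inradii *)

Section Sizes.
Variable R : realType.
Local Notation P := 'rV[R]_3.
Implicit Types (A B : set P) (u v : P).

Lemma enorm_ge0 u : 0 <= enorm u.
Proof. exact: sqrtr_ge0. Qed.

Lemma enorm_sqr u : enorm u ^+ 2 = dotp u u.
Proof. by rewrite sqr_sqrtr // dotp_sqr_ge0. Qed.

Lemma enorm_gt0 u : u != 0 -> 0 < enorm u.
Proof.
move=> u0; rewrite lt_neqAle enorm_ge0 andbT eq_sym; apply: contraNneq u0 => E.
by apply/eqP/dotp_eq0; rewrite -enorm_sqr E expr0n.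
Qed.

Lemma bounded3_enorm K A u v : bounded3 K A -> A u -> A v -> dotp (u - v) (u - v) <= 12 * K ^+ 2.
Proof.
move=> bA Au Av.
have H i : (u - v) 0 i ^+ 2 <= 4 * K ^+ 2.
  have := bA _ Au i; have := bA _ Av i; rewrite !mxE => hv hu.
  have -> : 4 * K ^+ 2 = (2 * K) ^+ 2 by ring.
  rewrite -ler_sqrt; last by rewrite sqr_ge0.
  rewrite !sqrtr_sqr; apply: le_trans (ler_normB _ _) _.
  by apply: le_trans (ler_norm _); lra.
by rewrite dotpE -!expr2; have := H 0; have := H 1; have := H ord_max; lra.
Qed.

Lemma has_sup_diam K A : bounded3 K A -> A !=set0 ->
  has_sup [set r | exists x y, [/\ A x, A y & r = enorm (x - y)]].
Proof.
move=> bA [x Ax]; split; first by exists (enorm (x - x)), x, x.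
exists (Num.sqrt (12 * K ^+ 2)) => r [y [z [Ay Az ->]]].
by rewrite ler_wsqrtr //; exact: bounded3_enorm bA Ay Az.
Qed.

Lemma diam_ge K A x y : bounded3 K A -> A x -> A y -> enorm (x - y) <= diam A.
Proof.
move=> bA Ax Ay; apply: ub_le_sup; last by exists x, y.
by have [] : has_sup _ := has_sup_diam bA (ex_intro _ x Ax).
Qed.

Lemma diam_le K A B : bounded3 K B -> A !=set0 -> A `<=` B -> diam A <= diam B.
Proof.
move=> bB [x Ax] AB; apply: sup_le_ub; first by exists (enorm (x - x)), x, x.
by move=> r [y [z [Ay Az ->]]]; apply: (diam_ge bB); exact: AB.
Qed.

End Sizes.

Section Inradius.
Variable R : realType.
Local Notation P := 'rV[R]_3.
Variables (I : finType) (x : I -> P).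
Implicit Types (a b c p : I).
Local Notation tri a b c := (a |: (b |: [set c]))%SET.

(** A ball of radius r in the tetrahedron contains its centre and the point at distance r along the
    normal, where [side] differs by r |nu|. On the tetrahedron [side] ranges between 0 and its value
    at the apex. *)
Lemma inradius_le_height p a b c : p \notin tri a b c -> a != b -> a != c -> b != c ->
  inradius (conv_hull x (p |: tri a b c)%SET) * enorm (crossp (x b - x a) (x c - x a))
    <= `|side x a b c (x p)|.
Proof.
move=> pt ab ac bc; set nu := crossp _ _; set s := (p |: _)%SET.
have [nu0|nu0] := eqVneq nu 0.
  by rewrite nu0 /enorm dotpE !mxE !mulr0 !addr0 sqrtr0 mulr0.
have nup := enorm_gt0 nu0; rewrite -ler_pdivlMr //.
have sideP y : conv_hull x s y -> exists2 k, 0 <= k <= 1 & side x a b c y = k * side x a b c (x p).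
  move=> [u [u0 u1 ->]]; exists (u p).
    have ps : p \in s by rewrite !inE eqxx.
    by rewrite u0 //= -u1 (bigD1 p) //= lerDl sumr_ge0 // => i /andP[/u0].
  have [h1 h2 h3] := side_vertex x a b c.
  by rewrite side_sum // big_set4 // h1 h2 h3 !mulr0 !addr0.
apply: sup_le_ub.
  (* Radius 0 is admissible at any point of the hull, here the apex, so the supremum is over a
     nonempty set. *)
  exists 0; split => //; exists (x p) => y yp.
  have -> : y = x p.
    apply/eqP; rewrite -subr_eq0; apply/negPn/negP => ne.
    by have := enorm_gt0 ne; rewrite ltNge yp.
  have ps : p \in s by rewrite !inE eqxx.
  exists (fun i => (i == p)%:R); split.
  - by move=> i _; rewrite ler0n.
  - by rewrite (bigD1 p) //= eqxx big1 ?addr0 // => i /andP[_ /negbTE ->].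
  - rewrite (bigD1 p) //= eqxx scale1r big1 ?addr0 // => i /andP[_ /negbTE ->].
    by rewrite scale0r.
move=> r [r0 [y hy]]; rewrite ler_pdivlMr //.
have yy : conv_hull x s y.
  by apply: hy; rewrite subrr /enorm dotpE !mxE !mulr0 !addr0 sqrtr0.
pose z := y + (r / enorm nu) *: nu.
have zE : enorm (z - y) = r.
  rewrite /z addrC addKr /enorm dotpZl.
  have -> : dotp nu ((r / enorm nu) *: nu) = (r / enorm nu) * enorm nu ^+ 2.
    by rewrite enorm_sqr !dotpE !mxE; ring.
  have -> : r / enorm nu * (r / enorm nu * enorm nu ^+ 2) = r ^+ 2.
    by field; rewrite gt_eqF.
  by rewrite sqrtr_sqr ger0_norm.
have [k /andP[k0 k1] ky] := sideP _ yy.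
have [m /andP[m0 m1] mz] : exists2 k, 0 <= k <= 1 & side x a b c z = k * side x a b c (x p).
  by apply/sideP/hy; rewrite zE.
have E : side x a b c z - side x a b c y = r * enorm nu.
  rewrite /side -/nu; have -> : z - x a = (r / enorm nu) *: nu + (y - x a).
    by rewrite /z; vec_ring.
  by rewrite (dotpDl (_ *: _)) dotpZl addrK -enorm_sqr; field; rewrite gt_eqF.
rewrite -E mz ky -mulrBl; apply: le_trans (ler_norm _) _.
rewrite normrM -[leRHS]mul1r; apply: ler_wpM2r => //.
by rewrite ler_norml; apply/andP; split; lra.
Qed.

End Inradius.

(** * Mesh cells as unions of simplices of the submesh *)

Section MeshGeometry.
Variable R : realType.
Local Notation P := 'rV[R]_3.
Variables (Omega : set P) (M : mesh R) (S : complex R).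
Hypotheses (hM : is_mesh Omega M) (hS : simplicial_submesh Omega M S).
Local Notation x := (@position R S).
Implicit Types (s t : {set vertex S}) (c T F : cell M).
Local Notation tri a b c := (a |: (b |: [set c]))%SET.

Lemma submesh_complex : is_complex S.
Proof. by case: hS. Qed.
Let cS := submesh_complex.

Lemma cell_mem c y : carrier c y ->
  exists s, [/\ s \in simplices S, #|s| = (cdim c).+1, hull s y & hull s `<=` carrier c].
Proof.
case: hS => _ _ /(_ c)[A [hA ->]] [s As ys]; have [sS sc] := hA _ As.
by exists s; split => //; exact: bigcup_sup.
Qed.

(** The point also lies in a simplex of full dimension inside the cell, and that simplex must
    contain every vertex of [s]. *)
Lemma cell_card s c y : s \in simplices S -> ohull x s y -> carrier c y -> (#|s| <= (cdim c).+1)%N.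
Proof.
move=> sS ys /cell_mem[t [tS <- yt _]].
by apply: subset_leq_card; exact: (complex_subset cS sS tS ys yt).
Qed.

Lemma cell_hull s c y : s \in simplices S -> ohull x s y -> carrier c y -> #|s| = (cdim c).+1 ->
  hull s `<=` carrier c.
Proof.
move=> sS ys /cell_mem[t [tS tc yt tsub]] sc.
suff -> : s = t by [].
by apply/eqP; rewrite eqEcard sc tc leqnn andbT; exact: (complex_subset cS sS tS ys yt).
Qed.

Lemma simplex_ohull s : s \in simplices S -> ohull x s !=set0.
Proof. by move=> sS; apply: ohull_nonempty; case: cS => + _ _ _; apply. Qed.

Lemma tet_cell s : s \in simplices S -> #|s| = 4 -> exists2 T : cell M, cdim T = 3 & hull s `<=` carrier T.
Proof.
move=> sS s4; have [y ys] := simplex_ohull sS.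
have : closure Omega y.
  by case: hS => _ <- _; exists s => //; exact: ohull_hull.
case: hM => _ _ [<- _ _ _] _ _ [T /= T3 yT].
by exists T => //; apply: (cell_hull sS ys yT); rewrite s4 T3.
Qed.

Lemma open_ohull s : s \in simplices S -> #|s| = 4 -> open (ohull x s).
Proof.
move=> sS s4; have [p ps] : exists p, p \in s by apply/card_gt0P; rewrite s4.
have t3 : #|(s :\ p)%SET| = 3 by move: s4; rewrite (cardsD1 p) ps => -[].
have [a [b [c [ab ac bc tE]]]] := cards3P t3.
have pt : p \notin tri a b c by rewrite -tE !inE eqxx.
have sE : s = (p |: tri a b c)%SET by rewrite -tE finset.setD1K.
rewrite sE ohull4 //; apply: open_osimp; apply: affine_indep_vol => //.
by rewrite -sE; exact: complex_indep.
Qed.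

Lemma ohull_interior s T : s \in simplices S -> #|s| = 4 -> hull s `<=` carrier T ->
  ohull x s `<=` interior (carrier T).
Proof.
move=> sS s4 sT; rewrite -open_subsetE; last exact: open_ohull.
by apply: subset_trans sT; exact: ohull_hull.
Qed.

(** A common point of two distinct 3-cells is in the relative boundary of [T], but an open
    tetrahedron inside [T] consists of interior points. *)
Lemma tet_cell_unique s T T' y : s \in simplices S -> #|s| = 4 -> cdim T = 3 -> cdim T' = 3 ->
  hull s `<=` carrier T -> ohull x s y -> carrier T' y -> T' = T.
Proof.
move=> sS s4 T3 T3' sT ys yT'; apply: contrapT => ne.
have yT := ohull_interior sS s4 sT ys.
case: hM => _ _ [_ _ _ H] _ _.
have yT1 : carrier T y by exact: (interior_subset yT).
have le : (cdim T' <= cdim T)%N by rewrite T3 T3'.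
have [_] := H T' T ne le (ex_intro _ y (conj yT' yT1)) y (conj yT' yT1).
apply; split => //; rewrite /= in yT.
by apply: filterS yT => z zT _.
Qed.

Lemma broken_tet (v : hybrid M) s T y : s \in simplices S -> #|s| = 4 -> cdim T = 3 ->
  hull s `<=` carrier T -> ohull x s y -> broken v y = cell_field v T y.
Proof.
move=> sS s4 T3 sT ys; rewrite /broken (bigD1 T) ?T3 //=.
rewrite indicE mem_set ?scale1r; last exact: (ohull_interior sS s4 sT ys).
rewrite big1 ?addr0 // => T' /andP[/eqP T3' ne].
rewrite indicE memNset ?scale0r // => yT'; move/eqP: ne; apply.
exact: (tet_cell_unique sS s4 T3 T3' sT ys (interior_subset yT')).
Qed.

(** A point y of the open triangle is in the boundary of both cells, hence in a face of each. Were
    the two faces distinct, y would lie in the boundary of one of them, thus in a 1-cell;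
    [cell_card] excludes this for a point of an open triangle. *)
Lemma interface_face t s s' T T' : t \in simplices S -> #|t| = 3 -> t \subset s -> t \subset s' ->
  cdim T = 3 -> cdim T' = 3 -> hull s `<=` carrier T -> hull s' `<=` carrier T' -> T <> T' ->
  exists F : cell M, [/\ cdim F = 2, face_of F T, face_of F T' & hull t `<=` carrier F].
Proof.
move=> tS t3 ts ts' T3 T3' sT sT' ne; have [y yt] := simplex_ohull tS.
have sub (r : {set vertex S}) : t \subset r -> hull r y.
  move=> tr; have [u [u0 u1 ->]] := yt.
  exists (fun i => if i \in t then u i else 0); split.
  - by move=> i _; case: ifP => // /u0 /ltW.
  - by rewrite -(sum_sub u tr).
  - rewrite (sum_sub (fun i => u i *: x i) tr); apply: eq_bigr => i _.
    by case: ifP => // _; rewrite scale0r.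
have yT := sT _ (sub _ ts); have yT' := sT' _ (sub _ ts').
case: hM => _ _ [_ hbd _ H] _ _.
have bd (e f : cell M) : e <> f -> cdim e = cdim f -> carrier e y -> carrier f y -> rel_boundary (carrier f) y.
  by move=> ef de ye yf; apply: (H e f ef); [rewrite de|exists y|].
have face (Z Z' : cell M) : Z <> Z' -> cdim Z = 3 -> cdim Z' = 3 -> carrier Z y -> carrier Z' y ->
    exists F : cell M, [/\ cdim F = 2, face_of F Z, carrier F y & hull t `<=` carrier F].
  move=> zz Z3 Z3' yZ yZ'.
  have := bd Z' Z (nesym zz) (etrans Z3' (esym Z3)) yZ' yZ.
  have [A [hA E]] := hbd Z; rewrite E => -[F AF yF].
  have F2 : cdim F = 2 by apply/eqP; have := hA _ AF; rewrite Z3 eqSS.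
  exists F; split => //.
    by rewrite /face_of F2 eqxx /=; apply/asboolP; rewrite E; exact: bigcup_sup.
  by apply: (cell_hull tS yt yF); rewrite t3 F2.
have [F [F2 FT yF tF]] := face T T' ne T3 T3' yT yT'.
have [F' [F2' FT' yF' _]] := face T' T (nesym ne) T3' T3 yT' yT.
suff FF : F' = F by exists F; split => //; rewrite -FF.
apply: contrapT => nF; have := bd F' F nF (etrans F2' (esym F2)) yF' yF.
have [A [hA ->]] := hbd F => -[e Ae ye].
have e1 : cdim e = 1 by apply/eqP; have := hA _ Ae; rewrite F2 eqSS.
by have := cell_card tS yt ye; rewrite t3 e1.
Qed.

Lemma bounded_cell c : exists K, bounded3 K (carrier c).
Proof.
case: hS => _ _ /(_ c)[A [_ ->]].
have [K hK] := choice (fun s => bounded_conv_hull x s).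
exists (\sum_s `|K s|) => y [s _ ys] i; apply: le_trans (hK s y ys i) _.
apply: le_trans (ler_norm _) _.
by rewrite (bigD1 s) //= lerDl sumr_ge0.
Qed.

Lemma closed_cell c : closed (carrier c).
Proof. by case: hM => _ /(_ c)[_ []]. Qed.

Lemma face_subset F T : face_of F T -> carrier F `<=` carrier T.
Proof. by move=> /andP[_ /asboolP sub] y /sub[]. Qed.

End MeshGeometry.

(** * Polynomials and test functions as C1 functions *)

Section PolynomialsAndTests.
Variable R : realType.
Local Notation P := 'rV[R]_3.
Implicit Types (f g phi psi : P -> R) (p q : mpoly 3 R).

Definition pgrad p (x : P) : P := \row_i peval (mderiv i p) x.

Lemma eq_C1 f g (F G : P -> P) : C1 f F -> f =1 g -> F =1 G -> C1 g G.
Proof. by move=> h /funext <- /funext <-. Qed.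

Lemma peval_C1 p : C1 (peval p) (pgrad p).
Proof.
pose Q r := C1 (peval r) (pgrad r); rewrite -/(Q p).
have QC c : Q (mpolyC 3 c).
  apply: (eq_C1 (C1_cst c)) => y; first by rewrite /peval mevalC.
  by apply/rowP => j; rewrite !mxE mderivC /peval meval0.
have QM r r' : Q r -> Q r' -> Q (r * r').
  move=> h h'; apply: (eq_C1 (C1M h h')) => y; first by rewrite /peval mevalM.
  by apply/rowP => j; rewrite !mxE mderivM /peval mevalD !mevalM addrC mulrC [X in _ + X]mulrC.
have QD r r' : Q r -> Q r' -> Q (r + r').
  move=> h h'; apply: (eq_C1 (C1D h h')) => y; first by rewrite /peval mevalD.
  by apply/rowP => j; rewrite !mxE mderivD /peval mevalD.
have QX i : Q (mpolyX R (mnm1 i)).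
  apply: (eq_C1 (C1_coord R i)) => y; first by rewrite /peval mevalXU.
  apply/rowP => j; rewrite !mxE mderivX mnm1E /peval mevalZ eqxx /= eq_sym.
  case: eqP => [->|_]; last by rewrite mul0r.
  have E (k : 'I_3) : mnm_sub (mnm1 k) (mnm1 k) = mnm0 by apply/mnmP => l; rewrite mnmBE subnn mnm0E.
  by rewrite mul1r E mpolyX0 meval1.
have QE m : Q (mpolyX R m).
  rewrite mpolyXE_id; apply: big_ind => [||i _] //; first by rewrite -mpolyC1.
  elim: (m i) => [|k IH]; first by rewrite expr0 -mpolyC1.
  by rewrite exprS; exact: QM.
elim/mpolyind: p => [|c m r _ _ hr]; first by rewrite -mpolyC0.
by apply: QD => //; rewrite -mul_mpolyC; exact: QM.
Qed.

Lemma cont_peval p : continuous (peval p).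
Proof. by have [] := peval_C1 p. Qed.

Lemma derive_dotp f x v : differentiable f x -> 'D_v f x = dotp (grad f x) v.
Proof.
move=> df; rewrite deriveE // {1}[v]row_sum_delta linear_sum /dotp.
apply: eq_bigr => i _; rewrite linearZ /= mxE /partial deriveE // mulrC.
by [].
Qed.

Lemma smooth_C1 f : smooth f -> C1 f (grad f).
Proof.
move=> sf; split.
- by move=> x; apply: differentiable_continuous; exact: (sf [::]).
- move=> i; under eq_fun do rewrite mxE.
  by move=> x; apply: differentiable_continuous; exact: (sf [:: i]).
- move=> x v; have df : differentiable f x by exact: (sf [::]).
  by split; [exact: diff_derivable|exact: derive_dotp].
Qed.

Lemma partialD i f g (k : R) x : differentiable f x -> differentiable g x ->
  partial i (fun y => f y + k * g y) x = partial i f x + k * partial i g x.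
Proof.
move=> df dg; rewrite /partial.
have -> : (fun y => f y + k * g y) = f + k \*: g by [].
rewrite deriveD; [|exact: diff_derivable|by apply: derivableZ; exact: diff_derivable].
by rewrite deriveZ //; exact: diff_derivable.
Qed.

Lemma smoothD f g (k : R) : smooth f -> smooth g -> smooth (fun y => f y + k * g y).
Proof.
move=> sf sg s x.
have -> : foldr (@partial R) (fun y => f y + k * g y) s =
    foldr (@partial R) f s + k \*: foldr (@partial R) g s.
  elim: s => [//|i s IH] /=; rewrite IH; apply/funext => y.
  by rewrite (partialD _ _ (sf s y) (sg s y)).
by apply: differentiableD => //; exact: differentiableZ.
Qed.

Lemma gradD f g (k : R) x : smooth f -> smooth g ->
  grad (fun y => f y + k * g y) x = grad f x + k *: grad g x.
Proof.
move=> sf sg; apply/rowP => i; rewrite !mxE.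
by rewrite (partialD _ _ (sf [::] x) (sg [::] x)).
Qed.

Variable Omega : set P.

Lemma test_functionD phi psi (k : R) : test_function Omega phi -> test_function Omega psi ->
  test_function Omega (fun y => phi y + k * psi y).
Proof.
move=> [s1 [K1 [c1 k1 z1]]] [s2 [K2 [c2 k2 z2]]]; split; first exact: smoothD.
exists (K1 `|` K2); split; first exact: compactU.
  by move=> x [/k1|/k2].
by move=> x /not_orP[/z1 -> /z2 ->]; rewrite mulr0 addr0.
Qed.

Lemma test_function0 : test_function Omega (fun=> 0).
Proof.
split; last by exists set0; split => //; exact: compact0.
have E s : foldr (@partial R) (fun=> 0) s = (fun=> 0).
  elim: s => [//|i s IH] /=; rewrite IH; apply/funext => x.
  by rewrite /partial -[fun=> 0]/(cst (0 : R)) derive_cst.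
by move=> s x; rewrite E; exact: differentiable_cst.
Qed.

Lemma test_vanish phi x : test_function Omega phi -> ~ Omega x -> phi x = 0 /\ grad phi x = 0.
Proof.
move=> [s [K [cK KO z]]] nO; have nK : ~ K x by move=> /KO.
split; first exact: z.
have cl : closed K by apply: compact_closed => //; exact: norm_hausdorff.
apply/rowP => i; rewrite !mxE /partial.
rewrite (@near_eq_derive _ _ _ phi (cst 0)) ?derive_cst //.
have : nbhs x (~` K) by apply: open_nbhs_nbhs; split => //; exact: closed_openC.
by apply: filterS => y /z.
Qed.

End PolynomialsAndTests.

(** * Fluxes through the triangles of the submesh *)

Lemma perm3_cases (T : eqType) (a b c u v r : T) : a != b -> a != c -> b != c ->
  [|| a == u, a == v | a == r] -> [|| b == u, b == v | b == r] -> [|| c == u, c == v | c == r] ->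
  [/\ a = u, b = v & c = r] \/ [/\ a = u, b = r & c = v] \/ [/\ a = v, b = u & c = r] \/
  [/\ a = v, b = r & c = u] \/ [/\ a = r, b = u & c = v] \/ [/\ a = r, b = v & c = u].
Proof.
move=> ab ac bc /or3P[]/eqP ea /or3P[]/eqP eb /or3P[]/eqP ec; move: ab ac bc; rewrite ea eb ec ?eqxx //= => _ _ _;
  first [by left | by right; left | by right; right; left | by right; right; right; left
  | by right; right; right; right; left | by right; right; right; right; right].
Qed.

Section FluxSums.
Variable R : realType.
Local Notation P := 'rV[R]_3.
Variables (Omega : set P) (S : complex R).
Hypothesis cS : is_complex S.
Local Notation x := (@position R S).
Implicit Types (s t : {set vertex S}) (a b c p q : vertex S) (w : P -> P).
Local Notation tri a b c := (a |: (b |: [set c]))%SET.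

Definition tets : {set {set vertex S}} := [set s in simplices S | #|s| == 4]%SET.

Lemma tetsP s : reflect (s \in simplices S /\ #|s| = 4) (s \in tets).
Proof. by rewrite inE; apply: (iffP andP) => -[? /eqP]. Qed.

Lemma face_points_exists t : exists abc : P * P * P, #|t| = 3 -> exists a b c,
  [/\ a != b, a != c, b != c, t = tri a b c & abc = (x a, x b, x c)].
Proof.
have [t3|nt] := eqVneq #|t| 3; last by exists (0, 0, 0) => t3; rewrite t3 eqxx in nt.
by have [a [b [c [? ? ? E]]]] := cards3P t3; exists (x a, x b, x c) => _; exists a, b, c.
Qed.

(* The three vertices in some order, which is irrelevant by [fluxE]. *)
Definition face_points t : P * P * P := sval (cid (face_points_exists t)).

Definition flux t (p : P) w : R :=
  outflux p (face_points t).1.1 (face_points t).1.2 (face_points t).2 w.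

Lemma fluxE a b c (p : P) w : a != b -> a != c -> b != c -> contv w ->
  flux (tri a b c) p w = outflux p (x a) (x b) (x c) w.
Proof.
move=> ab ac bc cw; rewrite /flux /face_points.
case: cid => -[[pa pb] pc] /=; case.
  by rewrite !cardsU1 cards1 !inE negb_or ab ac bc.
move=> a' [b' [c' [ab' ac' bc' E [-> -> ->]]]].
have h z : z \in tri a b c -> z \in tri a' b' c' by rewrite E.
have := h a; have := h b; have := h c; rewrite !inE !eqxx !orbT.
move=> /(_ isT) hc /(_ isT) hb /(_ isT) ha.
have s1 := fun u v r => @outflux_swap12 R p u v r w cw.
have s2 := fun u v r => @outflux_swap23 R p u v r w cw.
case: (perm3_cases ab ac bc ha hb hc) => [|[|[|[|[|]]]]] [-> -> ->].
- by [].
- by rewrite s2.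
- by rewrite s1.
- by rewrite s1 s2.
- by rewrite s2 s1.
- by rewrite s1 s2 s1.
Qed.

(** Double counting: a tetrahedron with a chosen vertex is the same as a triangle with an apex. Sums
    over faces of tetrahedra become sums over triangles. *)
Lemma sum_pairs (V : nmodType) (X : {set {set vertex S}}) (F : {set vertex S} -> vertex S -> V) :
  \sum_(s in X) \sum_(p in s) F s p =
  \sum_(t : {set vertex S}) \sum_(p : vertex S | (p \notin t) && ((p |: t)%SET \in X)) F (p |: t)%SET p.
Proof.
rewrite (exchange_big_dep predT) //= [RHS](exchange_big_dep predT) //=.
apply: eq_bigr => p _.
rewrite (reindex_onto (fun t => (p |: t)%SET) (fun s => (s :\ p)%SET)) /=; last first.
  by move=> s /andP[_ ps]; rewrite finset.setD1K.
apply: eq_bigl => t; rewrite setU11 andbT andbC; congr (_ && _).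
by apply/eqP/idP => [<-|pt]; [rewrite !inE eqxx|rewrite setU1K].
Qed.

Lemma tetE s : s \in tets -> exists p a b c,
  [/\ p \notin tri a b c, a != b, a != c, b != c & s = (p |: tri a b c)%SET].
Proof.
move=> /tetsP[sS s4]; have [p ps] : exists p, p \in s by apply/card_gt0P; rewrite s4.
have t3 : #|(s :\ p)%SET| = 3 by move: s4; rewrite (cardsD1 p) ps => -[].
have [a [b [c [ab ac bc tE]]]] := cards3P t3; exists p, a, b, c; split => //.
  by rewrite -tE !inE eqxx.
by rewrite -tE finset.setD1K.
Qed.

Lemma tet_ohull p a b c : (p |: tri a b c)%SET \in tets -> p \notin tri a b c ->
  a != b -> a != c -> b != c ->
  ohull x (p |: tri a b c)%SET = osimp (x p) (x a) (x b) (x c) /\ vol (x p) (x a) (x b) (x c) != 0.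
Proof.
move=> /tetsP[sS _] pt ab ac bc; split; first exact: ohull4.
by apply: affine_indep_vol => //; exact: complex_indep.
Qed.

Lemma nice_tet s : s \in tets -> nice (ohull x s).
Proof.
move=> st; have [p [a [b [c [pt ab ac bc sE]]]]] := tetE st; rewrite sE in st *.
by have [-> V0] := tet_ohull st pt ab ac bc; exact: nice_osimp.
Qed.

Lemma tet_divergence s w (G : 'I_3 -> P -> P) : s \in tets ->
  (forall i, C1 (fun y => w y 0 i) (G i)) ->
  vint (ohull x s) (fun y => \sum_i G i y 0 i) = \sum_(p in s) flux (s :\ p)%SET (x p) w.
Proof.
move=> st hw; have cw : contv w by move=> i; have [] := hw i.
have [p [a [b [c [pt ab ac bc sE]]]]] := tetE st; rewrite sE in st *.
have [-> V0] := tet_ohull st pt ab ac bc.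
rewrite (osimp_divergence V0 hw) big_set4 //.
have [pa [pb pc]] : p != a /\ p != b /\ p != c.
  by move: pt; rewrite !inE !negb_or => /and3P[].
rewrite setU1K // fluxE //.
have -> : ((p |: tri a b c) :\ a)%SET = tri p b c.
  apply/setP => i; rewrite !inE; have [->|] := eqVneq i a; rewrite ?(negbTE ab) ?(negbTE ac) //=.
  by rewrite eq_sym (negbTE pa).
have -> : ((p |: tri a b c) :\ b)%SET = tri p a c.
  apply/setP => i; rewrite !inE; have [->|] := eqVneq i b; rewrite ?orbF //=.
  by rewrite eq_sym (negbTE pb) eq_sym (negbTE ab) (negbTE bc).
have -> : ((p |: tri a b c) :\ c)%SET = tri p a b.
  apply/setP => i; rewrite !inE; have [->|] := eqVneq i c; rewrite ?orbF //=.
  by rewrite eq_sym (negbTE pc) eq_sym (negbTE ac) eq_sym (negbTE bc).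
by rewrite !fluxE // !addrA.
Qed.

Hypothesis oO : open Omega.
Hypothesis covS : \bigcup_(s in [set s | s \in simplices S]) hull s = closure Omega.

(** Sliding z towards a point of the open simplex makes all barycentric coordinates positive at
    once, and a small displacement stays in the open set Omega. *)
Lemma ohull_meets t (z : P) : t \in simplices S -> hull t z -> Omega z ->
  exists2 y, ohull x t y & Omega y.
Proof.
move=> tS [u [u0 u1 zE]] Oz.
have [y0 [k [k0 k1 yE]]] : ohull x t !=set0.
  by apply: ohull_nonempty; case: cS => + _ _ _; apply.
have cl : continuous (fun r : R => z + r *: (y0 - z)).
  move=> r; apply: cvgD; first exact: cvg_cst.
  by apply: cvgZ; [exact: cvg_id|exact: cvg_cst].
have U' : nbhs (z + 0 *: (y0 - z)) Omega by rewrite scale0r addr0; exact: open_nbhs_nbhs.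
have /nbhs_ballP[d /= d0 sub] := cl 0 _ U'.
pose r := Num.min (d / 2) 1.
have r0 : 0 < r by rewrite /r lt_min ltr01 andbT; lra.
have r1 : r <= 1 by rewrite /r ge_min lexx orbT.
have rd : r < d by rewrite /r gt_min; apply/orP; left; lra.
exists (z + r *: (y0 - z)); last by apply: sub; rewrite /ball /= sub0r normrN ger0_norm // ltW.
exists (fun i => (1 - r) * u i + r * k i); split.
- move=> i it; have := mulr_gt0 r0 (k0 i it).
  have : 0 <= (1 - r) * u i by rewrite mulr_ge0 ?u0 //; lra.
  by lra.
- by rewrite big_split /= -!mulr_sumr u1 k1; ring.
- under eq_bigr do rewrite scalerDl -!scalerA.
  rewrite big_split /= -!scaler_sumr -zE -yE.
  by vec_ring.
Qed.

(** Says that [p] is the apex of a tetrahedron of the submesh over the triangle [t]. *)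
Definition valid t p : bool := (p \notin t) && ((p |: t)%SET \in tets).

Lemma valid_face t p : valid t p -> t \in simplices S /\ #|t| = 3.
Proof.
move=> /andP[pt /tetsP[sS]]; rewrite cardsU1 pt add1n => -[t3]; split => //.
case: cS => _ + _ _ => /(_ _ t sS); apply; first exact: finset.subsetUr.
by rewrite -card_gt0 t3.
Qed.

(** Each side of the triangle has an apex by [two_sided] and only one by [one_tet_per_side]. Apexes
    on opposite sides see opposite outward normals. *)
Lemma valid_pair t z : t \in simplices S -> #|t| = 3 -> hull t z -> Omega z ->
  exists p q, [/\ p != q, valid t p, valid t q, forall r, valid t r = (r == p) || (r == q) &
    forall w, contv w -> flux t (x q) w = - flux t (x p) w].
Proof.
move=> tS t3 tz Oz; have [y yt Oy] := ohull_meets tS tz Oz.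
have [a [b [c [ab ac bc tE]]]] := cards3P t3; rewrite tE in tS yt *.
have val r : r \notin tri a b c -> (r |: tri a b c)%SET \in simplices S -> valid (tri a b c) r.
  by move=> rt rS; apply/andP; split => //; apply/tetsP; split => //; rewrite cardsU1 rt -tE t3.
have [||p [pt pS sp]] := two_sided cS oO covS (e := 1) ab ac bc tS yt Oy; rewrite ?sgr1 ?oner_neq0 //.
have [||q [qt qS sq]] := two_sided cS oO covS (e := -1) ab ac bc tS yt Oy.
- by rewrite sgrN sgr1.
- by rewrite oppr_eq0 oner_neq0.
exists p, q; split; [|exact: val|exact: val| |].
- by apply/eqP => pq; move: sp; rewrite pq sq => /eqP; rewrite -subr_eq0 -opprD oppr_eq0 (pnatr_eq0 R 2).
- move=> r; apply/idP/orP => [/andP[rt /tetsP[rS _]]|[]/eqP ->]; try exact: val.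
  have := tet_side cS rt ab ac bc rS; rewrite neq_lt => /orP[] rs.
    by right; apply/eqP/(one_tet_per_side cS ab ac bc rt qt rS qS); rewrite sq ltr0_sg.
  by left; apply/eqP/(one_tet_per_side cS ab ac bc rt pt rS pS); rewrite sp gtr0_sg.
- move=> w cw; rewrite !fluxE //; apply: outflux_opp.
  by rewrite -[LHS]/(Num.sg (side x a b c (x q))) -[X in - Num.sg X]/(side x a b c (x p)) sp sq.
Qed.

Variable phi : P -> R.
Hypothesis cphi : continuous phi.
Hypothesis phi0 : forall z, ~ Omega z -> phi z = 0.

Lemma flux_vanish t (p : P) w : #|t| = 3 -> (forall z, hull t z -> phi z = 0) -> contv w ->
  flux t p (fun y => phi y *: w y) = 0.
Proof.
move=> t3 z0 cw; have [a [b [c [ab ac bc tE]]]] := cards3P t3; rewrite tE in z0 *.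
rewrite fluxE //; last by move=> i; under eq_fun do rewrite mxE; exact: contM.
apply: outflux_eq0 => v dv; rewrite z0 ?dotpZl ?mul0r //.
by apply: ohull_hull; rewrite ohull3 //; exists v.
Qed.

(** Either phi vanishes on the whole triangle, or the triangle has a point in Omega and [valid_pair]
    applies. Boundary triangles are thus never singled out. The field [w] must be the same from both
    sides. *)
Lemma flux_cancel t w : contv w -> \sum_(p | valid t p) flux t (x p) (fun y => phi y *: w y) = 0.
Proof.
move=> cw; have [p0 vp0|nv] := pickP (valid t); last by rewrite big_pred0.
have [tS t3] := valid_face vp0.
have [z0|] := pselect (forall z, hull t z -> phi z = 0).
  by rewrite big1 // => p _; exact: flux_vanish.
move=> /existsNP[z /not_implyP[tz nz]].
have Oz : Omega z by apply: contrapT => /phi0.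
have [p [q [pq vp vq E opp]]] := valid_pair tS t3 tz Oz.
rewrite (bigD1 p) //= (bigD1 q) /=; last by rewrite vq eq_sym.
rewrite big1 ?addr0 => [|r /andP[/andP[vr rp] rq]]; last by move: vr; rewrite E (negbTE rp) (negbTE rq).
by rewrite opp ?subrr // => i; under eq_fun do rewrite mxE; exact: contM.
Qed.

Lemma flux_sum0 w : contv w ->
  \sum_(s in tets) \sum_(p in s) flux (s :\ p)%SET (x p) (fun y => phi y *: w y) = 0.
Proof.
move=> cw; rewrite (sum_pairs _ (fun s p => flux (s :\ p)%SET (x p) (fun y => phi y *: w y))).
rewrite big1 // => t _; rewrite -[RHS](flux_cancel t cw).
by apply: eq_bigr => p /andP[pt _]; rewrite setU1K.
Qed.

End FluxSums.

(** * The skeleton is negligible; integrals as sums over tetrahedra *)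

Section NullSkeleton.
Variable R : realType.
Local Notation P := 'rV[R]_3.
Local Notation mu := (@lebesgue_measure R).

Lemma measurable_plane (a nu : P) : measurable (@vec3 R @^-1` [set y | dotp (y - a) nu = 0]).
Proof.
apply: closed_measurable_vec3; apply: (@closed_comp _ _ (fun y : P => dotp (y - a) nu) [set 0]).
  move=> y _; move: y; apply: cont_dotp => i; under eq_fun do rewrite !mxE.
  by apply: contB; [exact: cont_coord|exact: cont_cst].
exact: closed_eq.
Qed.

(** By Tonelli, since every line parallel to a suitable coordinate axis meets the plane in a single
    point. *)
Lemma plane_null (a nu : P) : nu != 0 -> @leb3 R (@vec3 R @^-1` [set y | dotp (y - a) nu = 0]) = 0%E.
Proof.
move=> nu0; set A := _ @^-1` _.
have mA : measurable A := measurable_plane a nu.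
have [k nuk] : exists k, nu 0 k != 0.
  apply: contrapT => H; case/eqP: nu0; apply/rowP => k; rewrite mxE.
  by apply: contrapT => nk; apply: H; exists k; exact/eqP.
(* After this swap of coordinates the last component of the normal is nonzero. *)
pose B : 'M[R]_3 := tperm_mx k ord_max.
have B0 : \det B != 0 by rewrite det_perm signr_eq0.
have dE u : dotp (a + vec3 u *m B - a) nu = dotp (vec3 u) (nu *m B).
  rewrite addrC addKr /B /tperm_mx -[tperm k _]tpermV -!col_permE.
  rewrite /dotp (reindex_inj (@perm_inj _ (tperm k ord_max))) /=; apply: eq_bigr => i _.
  by rewrite !mxE tpermK.
have nB : (nu *m B) 0 ord_max != 0.
  by rewrite /B /tperm_mx -[tperm k _]tpermV -col_permE mxE tpermR.
pose m := nu *m B; rewrite -/m in dE nB.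
have -> : @leb3 R A = (\int[@leb3 R]_p (\1_A p)%:E)%E by rewrite integral_indic // setIT.
have mI : measurable_fun setT (fun p : R * R * R => (\1_A p : R)%:E).
  by apply/measurable_EFinP; exact: measurable_indic.
have sub := subst3_affine a B0.
rewrite (subst3_integral sub mI).
have [msub _ _] := sub.
rewrite tonelli3; last 2 first.
- by apply: emeasurable_funM => //; exact: (measurableT_comp mI msub).
- by move=> p; rewrite -EFinM lee_fin mulr_ge0.
rewrite integral0_eq // => y _; rewrite integral0_eq // => z _.
pose z0 := - (y * m 0 0 + z * m 0 1) / m 0 ord_max.
have E (r : R) : \1_A (unvec3 (a + vec3 (y, z, r) *m B)) = \1_[set z0] r :> R.
  rewrite !indicE; congr (_%:R); congr nat_of_bool.
  have AE : A (unvec3 (a + vec3 (y, z, r) *m B)) <-> [set z0] r.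
    rewrite /A /= unvec3K dE dotpE !vec3E /= /z0; split => [h|->]; last by field.
    have -> : r = (r * m 0 ord_max) / m 0 ord_max by field.
    by congr (_ / _); lra.
  by apply/idP/idP; rewrite !inE => /AE.
under eq_integral do rewrite E.
rewrite ge0_integralZl_EFin //; last by apply/measurable_EFinP; exact: measurable_indic.
rewrite integral_indic // setIT [X in (_ * X)%E](_ : _ = 0%E) ?mule0 //.
exact: lebesgue_measure_set1.
Qed.

Variables (I : finType) (x : I -> P).

Lemma hull_null (s : {set I}) : s != finset.set0 -> (#|s| <= 3)%N ->
  (@leb3 R).-negligible (@vec3 R @^-1` conv_hull x s).
Proof.
move=> s0 s3; have [a [b [c [as' sE]]]] : exists a b c, a \in s /\ s \subset (a |: (b |: [set c]))%SET.
  move: s3; rewrite leq_eqVlt => /orP[/eqP /cards3P[a [b [c [_ _ _ ->]]]]|].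
    by exists a, b, c; rewrite !inE eqxx.
  rewrite ltnS leq_eqVlt => /orP[/cards2P[a [b [_ ->]]]|].
    by exists a, b, b; rewrite !inE eqxx; split => //; apply/fintype.subsetP => i; rewrite !inE orbb.
  rewrite ltnS leq_eqVlt => /orP[/cards1P[a ->]|]; last by rewrite ltnS leqn0 cards_eq0 (negbTE s0).
  by exists a, a, a; rewrite !inE eqxx; split => //; apply/fintype.subsetP => i; rewrite !inE !orbb.
(* A normal to both edges, found in the kernel of a matrix with a zero row; this covers dependent
   edges too, in particular repeated vertices. *)
have [nu nu0 nuE] : exists2 nu : P, nu != 0 & nu *m (rows3 (x b - x a) (x c - x a) 0)^T = 0.
  by apply/det0P; rewrite det_tr det_rows3 dotpE !mxE !mul0r !addr0.
have row0 (w : P) i : row i (rows3 (x b - x a) (x c - x a) 0) = w -> dotp w nu = 0.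
  move=> <-; have := congr1 (fun A : P => A 0 i) nuE; rewrite !mxE => <-.
  by rewrite /dotp; apply: eq_bigr => j _; rewrite !mxE mulrC.
have hb : dotp (x b - x a) nu = 0 by apply: (row0 _ 0); apply/rowP => j; rewrite !mxE.
have hc : dotp (x c - x a) nu = 0 by apply: (row0 _ 1); apply/rowP => j; rewrite !mxE.
have hs i : i \in s -> dotp (x i - x a) nu = 0.
  move=> /(fintype.subsetP sE); rewrite !inE => /or3P[]/eqP -> //.
  by rewrite subrr dotpE !mxE !mul0r !addr0.
exists (@vec3 R @^-1` [set y | dotp (y - x a) nu = 0]); split.
- exact: measurable_plane.
- exact: plane_null.
- move=> p /= [u [u0 u1 ->]].
  have -> : \sum_(i in s) u i *: x i - x a = \sum_(i in s) u i *: (x i - x a).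
    by under [RHS]eq_bigr do rewrite scalerBr; rewrite sumrB -scaler_suml u1 scale1r.
  rewrite /dotp; under eq_bigr do rewrite summxE mulr_suml; rewrite exchange_big /= big1 // => i si.
  under eq_bigr do rewrite mxE -mulrA; rewrite -mulr_sumr -[X in _ * X]/(dotp (x i - x a) nu).
  by rewrite hs // mulr0.
Qed.

End NullSkeleton.

Section Decomposition.
Variable R : realType.
Local Notation P := 'rV[R]_3.
Variables (Omega : set P) (M : mesh R) (S : complex R).
Hypotheses (hM : is_mesh Omega M) (hS : simplicial_submesh Omega M S).
Local Notation x := (@position R S).
Let cS := submesh_complex hS.
Let covS : \bigcup_(s in [set s | s \in simplices S]) hull s = closure Omega.
Proof. by case: hS. Qed.
Implicit Types g : P -> R.

Let F (s : {set vertex S}) : set (R * R * R) := if s \in tets S then @vec3 R @^-1` ohull x s else set0.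
Let U := \big[setU/set0]_(s <- enum {set vertex S}) F s.

Let mF s : measurable (F s).
Proof. by rewrite /F; case: ifPn => // /(nice_tet cS)[]. Qed.

Let mU : measurable U. Proof. exact: bigsetU_measurable. Qed.

Let UP p : U p <-> exists2 s, s \in tets S & ohull x s (vec3 p).
Proof.
rewrite /U -bigcup_seq; split => [[s _]|[s st ps]].
  by rewrite /F; case: ifPn => // st ps; exists s.
by exists s; rewrite /= ?mem_enum // /F st.
Qed.

Lemma skeleton_null : (@leb3 R).-negligible (@vec3 R @^-1` Omega `\` U).
Proof.
pose N (s : {set vertex S}) : set (R * R * R) :=
  if (s \in simplices S) && (#|s| <= 3)%N then @vec3 R @^-1` conv_hull x s else set0.
have : (@leb3 R).-negligible (\big[setU/set0]_(s <- enum {set vertex S}) N s).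
  apply: big_ind => [|A B hA hB|s _]; [exact: negligible_set0|exact: negligibleU|].
  rewrite /N; case: ifPn => [/andP[sS s3]|_]; last exact: negligible_set0.
  by apply: hull_null => //; case: cS => + _ _ _; apply.
apply: negligibleS => p [/= /(cover_ohull cS covS)[s sS ps] nU].
rewrite -bigcup_seq; exists s; rewrite /= ?mem_enum // /N sS /=.
case: leqP => s3; first exact: ohull_hull.
case: nU; apply/UP; exists s => //; apply/tetsP; split => //; apply/eqP.
by rewrite eqn_leq s3 andbT; exact: (affine_indep_card (complex_indep cS sS)).
Qed.

(** The integrand [g] may jump across triangles; [h s] is its continuous representative on one open
    tetrahedron. Since [g] vanishes off Omega, the domain Omega can be exchanged for the whole space
    and then for the union of the open tetrahedra. *)
Lemma tet_decomposition g (h : {set vertex S} -> P -> R) :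
  measurable_fun setT (g \o @vec3 R) -> (forall z, ~ Omega z -> g z = 0) ->
  (forall s, s \in tets S -> continuous (h s)) ->
  (forall s y, s \in tets S -> ohull x s y -> g y = h s y) ->
  vint Omega g = \sum_(s in tets S) vint (ohull x s) (h s).
Proof.
move=> mg g0 ch gh; pose f p := (g (vec3 p))%:E.
have mf : measurable_fun setT f by exact/measurable_EFinP.
have E1 : (\int[@leb3 R]_(p in @vec3 R @^-1` Omega) f p = \int[@leb3 R]_p f p)%E.
  rewrite integral_mkcond; apply: eq_integral => p _; rewrite /patch.
  by case: ifPn => // /negP; rewrite inE /= /f => /g0 ->.
have E2 : (\int[@leb3 R]_p f p = \int[@leb3 R]_(p in U) f p)%E.
  rewrite [RHS]integral_mkcond; apply: ae_eq_integral => //.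
    by apply/(measurable_restrictT _ mU); exact: measurable_funTS.
  have [N [mN N0 sub]] := skeleton_null; exists N; split => // p /= nE; apply: sub.
  have [Up|nUp] := pselect (U p).
    by case: nE => _; rewrite /patch mem_set.
  split => //=; apply: contrapT => nO; apply: nE => _.
  by rewrite /patch memNset // /f g0.
have tF : trivIset [set` enum {set vertex S}] F.
  move=> s t _ _ [p []]; rewrite /F; case: ifPn => // st ps; case: ifPn => // tt pt.
  have /tetsP[sS _] := st; have /tetsP[tS _] := tt.
  exact: (ohull_disjoint cS sS tS ps pt).
rewrite /vint -/(@leb3 R) /Rintegral -/(f) E1 E2.
rewrite (@integral_bigsetU_EFin _ _ _ (@leb3 R) _ F (g \o @vec3 R) _ mF (enum_uniq _) tF); last first.
  exact: measurable_funTS.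
have Eh s : (\int[@leb3 R]_(p in F s) ((g \o @vec3 R) p)%:E = (if s \in tets S then vint (ohull x s) (h s) else 0)%:E)%E.
  rewrite /F; case: ifPn => st; last by rewrite integral_set0.
  rewrite /vint -/(@leb3 R) /Rintegral fineK; last first.
    apply: integrable_fin_num; first by have [] := nice_tet cS st.
    exact: (nice_integrable (nice_tet cS st) (ch _ st)).
  by apply: eq_integral => p; rewrite inE /= => ps; rewrite (gh s).
under eq_bigr do rewrite Eh.
by rewrite sumEFin big_enum /= -big_mkcond.
Qed.

Variable v : hybrid M.

Lemma measurable_broken i : measurable_fun setT ((fun y => broken v y 0 i) \o @vec3 R).
Proof.
have -> : (fun y => broken v y 0 i) \o @vec3 R = (fun p => \sum_(T : cell M | cdim T == 3)
    (\1_(@vec3 R @^-1` interior (carrier T)) p : R) * peval (hcell v T i) (vec3 p)).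
  apply/funext => p /=; rewrite /broken summxE; apply: eq_bigr => T _.
  by rewrite !mxE; congr (_ * _); rewrite !indicE.
under eq_fun do rewrite big_mkcond; apply: measurable_sum => T.
have [_|_] := boolP (cdim T == 3); last exact: measurable_cst.
apply: measurable_funM.
  by apply: measurable_indic; apply: open_measurable_vec3; exact: open_interior.
by apply: continuous_measurable_vec3; exact: cont_peval.
Qed.

End Decomposition.

(** * The duality estimate *)

Section DisjointIntegrals.
Local Open Scope ereal_scope.

(** Passes from the simplices of a cell or face to the whole of it: the part of [B] outside the
    pieces contributes a nonnegative amount. *)
Lemma sum_Rintegral_le d (T : measurableType d) (R : realType) (mu : {measure set T -> \bar R})
    (I : finType) (Q : pred I) (A : I -> set T) (B : set T) (f : T -> R) :
  measurable B -> (forall i, Q i -> measurable (A i)) ->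
  (forall i j y, Q i -> Q j -> A i y -> A j y -> i = j) -> (forall i, Q i -> A i `<=` B) ->
  mu.-integrable B (EFin \o f) -> (forall y, (0 <= f y)%R) ->
  (\sum_(i | Q i) \int[mu]_(y in A i) f y <= \int[mu]_(y in B) f y)%R.
Proof.
move=> mB mA dA AB intf f0.
have f0' y : 0 <= (EFin \o f) y by rewrite lee_fin.
have mf : measurable_fun B (EFin \o f) by have /integrableP[] := intf.
have fin i : Q i -> \int[mu]_(y in A i) (f y)%:E \is a fin_num.
  by move=> Qi; apply: integrable_fin_num; [exact: mA|exact: (integrableS mB (mA _ Qi) (AB _ Qi) intf)].
rewrite -lee_fin -sumEFin.
have -> : \sum_(i | Q i) (\int[mu]_(y in A i) f y)%R%:E = \sum_(i | Q i) \int[mu]_(y in A i) (f y)%:E.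
  by apply: eq_bigr => i Qi; rewrite /Rintegral fineK //; exact: fin.
rewrite /Rintegral fineK; last exact: integrable_fin_num.
pose F i := if Q i then A i else set0.
have mF i : measurable (F i) by rewrite /F; case: ifPn => // Qi; exact: mA.
have tF : trivIset [set` enum I] F.
  move=> i j _ _ [y [+ +]]; rewrite /F.
  by case: ifPn => // Qi Ai; case: ifPn => // Qj Aj; exact: (dA i j y).
have U : \big[setU/set0]_(i <- enum I) F i `<=` B.
  elim/big_ind: _ => // [X Y hX hY|i _]; first by move=> y [/hX|/hY].
  by rewrite /F; case: ifPn => [Qi|_]; [exact: AB|exact: classical_sets.sub0set].
have mU : measurable (\big[setU/set0]_(i <- enum I) F i) by exact: bigsetU_measurable.
have E := @ge0_integral_bigsetU _ _ _ mu _ F (EFin \o f) (enum I) mF (enum_uniq I) tF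
  (measurable_funS mB U mf) (fun y _ => f0' y).
apply: (@le_trans _ _ (\int[mu]_(y in \big[setU/set0]_(i <- enum I) F i) (f y)%:E)).
  rewrite E big_mkcond big_enum /=; apply: lee_sum => i _; rewrite /F.
  by case: ifPn => // _; rewrite integral_set0.
exact: (ge0_subset_integral mu mU mB mf (fun y _ => f0' y) U).
Qed.

End DisjointIntegrals.

(** The converse of Young's inequality, by optimising in lam. *)
Lemma young_optimal (R : realType) (X a b : R) : 0 <= a -> 0 <= b ->
  (forall lam, 0 < lam -> 2 * `|X| <= lam * a + lam^-1 * b) -> X ^+ 2 <= a * b.
Proof.
move=> a0 b0 h; rewrite -(real_normK (num_real X)).
have [X0|Xp] := eqVneq `|X| 0; first by rewrite X0 expr0n mulr_ge0.
have {}Xp : 0 < `|X| by rewrite lt_neqAle eq_sym Xp normr_ge0.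
move: (`|X|) Xp h => {}X Xp h.
have {}h lam : 0 < lam -> 2 * X * lam <= lam ^+ 2 * a + b.
  move=> l0; have := ler_wpM2r (ltW l0) (h _ l0).
  by have -> : (lam * a + lam^-1 * b) * lam = lam ^+ 2 * a + b by field; rewrite gt_eqF.
have [a00|an] := eqVneq a 0.
  (* If a = 0, then 2 X lam <= b for all lam, and this value of lam is large enough for a
     contradiction. *)
  have l0 : 0 < b / X + 1 by rewrite ltr_wpDl // divr_ge0 // ltW.
  have := h _ l0; rewrite a00 mulr0 add0r.
  have -> : 2 * X * (b / X + 1) = 2 * b + 2 * X by field; rewrite gt_eqF.
  by lra.
have ap : 0 < a by rewrite lt_neqAle eq_sym an.
have := h _ (divr_gt0 Xp ap).
have -> : 2 * X * (X / a) = 2 * X ^+ 2 / a by field; rewrite gt_eqF.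
have -> : (X / a) ^+ 2 * a = X ^+ 2 / a by field; rewrite gt_eqF.
move=> H; have : X ^+ 2 / a <= b by lra.
by rewrite ler_pdivrMr // mulrC.
Qed.

(** * From fluxes to the discrete seminorm *)

Section MeshEstimate.
Variable R : realType.
Local Notation P := 'rV[R]_3.
Variables (Omega : set P) (M : mesh R) (S : complex R) (rho : R).
Hypotheses (hM : is_mesh Omega M) (hS : simplicial_submesh Omega M S) (hR : regular_mesh rho M S).
Hypothesis rho0 : 0 < rho.
Local Notation x := (@position R S).
Implicit Types (s t : {set vertex S}) (T F : cell M).
Local Notation tri a b c := (a |: (b |: [set c]))%SET.
Let cS := submesh_complex hS.
Let covS : \bigcup_(s in [set s | s \in simplices S]) hull s = closure Omega.
Proof. by case: hS. Qed.

Variable D2 : R.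
Hypothesis D20 : 0 <= D2.
Hypothesis hD2 : forall y, closure Omega y -> dotp y y <= D2.
Hypothesis oO : open Omega.

Lemma hull_closure s : s \in simplices S -> hull s `<=` closure Omega.
Proof. by case: hS => _ <- _ sS; exact: bigcup_sup. Qed.

(** By the parallelogram law. *)
Lemma dist_closure y z : closure Omega y -> closure Omega z -> dotp (y - z) (y - z) <= 4 * D2.
Proof.
move=> /hD2 hy /hD2 hz; have := dotp_sqr_ge0 (y + z).
have -> : dotp (y + z) (y + z) = 2 * dotp y y + 2 * dotp z z - dotp (y - z) (y - z).
  by rewrite !dotpE !mxE; ring.
by lra.
Qed.

Lemma vertex_hull s p : p \in s -> hull s (x p).
Proof.
move=> ps; exists (fun i => (i == p)%:R); split.
- by move=> i _; rewrite ler0n.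
- by rewrite (bigD1 p) //= eqxx big1 ?addr0 // => i /andP[_ /negbTE ->].
- rewrite (bigD1 p) //= eqxx scale1r big1 ?addr0 // => i /andP[_ /negbTE ->].
  by rewrite scale0r.
Qed.

Variable v : hybrid M.

Definition jump F T (y : P) : R := dotp (cell_field v T y) (Defs.normal F) - peval (hface v F) y.

Definition jump_int F t T : R :=
  \int[@leb2 R]_(s in chart (fframe F) (forigin F) @^-1` ohull x t) jump F T (chart (fframe F) (forigin F) s) ^+ 2.

Lemma contv_cell_field T : contv (cell_field v T).
Proof. by move=> i; under eq_fun do rewrite mxE; have [] := peval_C1 (hcell v T i). Qed.

Lemma cont_jump F T : continuous (jump F T).
Proof. by apply: contB; [apply: cont_dotp; exact: contv_cell_field|exact: cont_peval]. Qed.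

Lemma face_dim F T : face_of F T -> cdim F = 2.
Proof. by move=> /andP[/eqP]. Qed.

Lemma face_frame F : cdim F = 2 -> orthogonal_mx (fframe F).
Proof. by case: hM => _ _ _ _ /(_ F) + F2 => /(_ F2)[]. Qed.

Lemma face_plane F y : cdim F = 2 -> carrier F y -> dotp (y - forigin F) (row ord_max (fframe F)) = 0.
Proof. by case: hM => _ _ _ _ /(_ F) + F2 => /(_ F2)[_]; apply. Qed.

Lemma face_chart F t : cdim F = 2 -> t \in simplices S -> #|t| = 3 -> hull t `<=` carrier F ->
  exists a b c (J : R), [/\ [/\ a != b, a != c, b != c & t = tri a b c],
    0 < J, forall w, `|dotp w (crossp (x b - x a) (x c - x a))| = J * `|dotp w (Defs.normal F)|,
    J = enorm (crossp (x b - x a) (x c - x a)) &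
    measurable (chart (fframe F) (forigin F) @^-1` ohull x t) /\
    forall g : P -> R, continuous g ->
      (\int[@leb2 R]_(s in chart (fframe F) (forigin F) @^-1` ohull x t) (g (chart (fframe F) (forigin F) s))%:E =
        (J * tri_int (x a) (x b) (x c) g)%:E)%E].
Proof.
move=> F2 tS t3 tF; have [a [b [c [ab ac bc tE]]]] := cards3P t3.
have pl z : z \in t -> dotp (x z - forigin F) (row ord_max (fframe F)) = 0.
  by move=> zt; apply: face_plane => //; apply: tF; exact: vertex_hull.
have ha : a \in t by rewrite tE !inE eqxx.
have hb : b \in t by rewrite tE !inE eqxx orbT.
have hc : c \in t by rewrite tE !inE eqxx !orbT.
have [J [J0 Jw Jg]] := tri_chart (face_frame F2) (pl _ ha) (pl _ hb) (pl _ hc).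
have n0 : crossp (x b - x a) (x c - x a) != 0.
  by apply: affine_indep_cross => //; rewrite -tE; exact: complex_indep.
(* Applied to nu, the cross product of the edges, and to the unit normal n, [Jw] gives |nu|^2 = J
   |nu.n| = J^2. *)
have JE : J = enorm (crossp (x b - x a) (x c - x a)).
  have nn : dotp (Defs.normal F) (Defs.normal F) = 1 by rewrite (orthogonal_dotp _ _ (face_frame F2)) eqxx.
  have sy (u w : P) : dotp u w = dotp w u by rewrite !dotpE; ring.
  have E1 := Jw (crossp (x b - x a) (x c - x a)); have E2 := Jw (Defs.normal F).
  rewrite -[row ord_max (fframe F)]/(Defs.normal F) nn normr1 mulr1 in E2.
  rewrite -[row ord_max (fframe F)]/(Defs.normal F) (sy _ (Defs.normal F)) E2 ger0_norm ?dotp_sqr_ge0 // in E1.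
  by rewrite /enorm E1 -expr2 sqrtr_sqr ger0_norm.
have [mt ig] := Jg n0.
exists a, b, c, J; rewrite tE ohull3 //; split => //.
by rewrite JE enorm_gt0.
Qed.

(** Mesh regularity enters here. Twice rho is paid in rho^2 diam F <= rho^2 diam T <= rho diam s <=
    inradius s, and the inradius is compared with the height over the triangle by
    [inradius_le_height]. *)
Lemma face_size F T t p a b c : cdim T = 3 -> face_of F T -> a != b -> a != c -> b != c ->
  p \notin tri a b c -> (p |: tri a b c)%SET \in tets S -> hull (p |: tri a b c)%SET `<=` carrier T ->
  t = tri a b c -> hull t `<=` carrier F ->
  0 < diam (carrier F) /\
  rho ^+ 2 * (diam (carrier F) * enorm (crossp (x b - x a) (x c - x a))) <= `|vol (x p) (x a) (x b) (x c)|.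
Proof.
move=> T3 FT ab ac bc pt /tetsP[sS s4] sT tE tF.
have [KT bT] := bounded_cell hS T; have [KF bF] := bounded_cell hS F.
have Fa : carrier F (x a) by apply: tF; apply: vertex_hull; rewrite tE !inE eqxx.
have Fb : carrier F (x b) by apply: tF; apply: vertex_hull; rewrite tE !inE eqxx orbT.
have n0 : crossp (x b - x a) (x c - x a) != 0.
  apply: affine_indep_cross => //; apply: complex_indep => //; exact: (tri_of_tet cS sS).
split.
  apply: lt_le_trans (diam_ge bF Fb Fa); apply: enorm_gt0; apply: contraNneq n0 => ->.
  by apply/eqP/rowP; apply: forall3; rewrite !mxE /= ?mxE; ring.
have FleT : diam (carrier F) <= diam (carrier T).
  by apply: (diam_le bT); [exists (x a)|exact: face_subset].
have [h1 /(_ T T3 sT) h2] := hR sS s4.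
have h3 := inradius_le_height x pt ab ac bc.
rewrite vol_side normrN; apply: le_trans h3; rewrite mulrA; apply: ler_wpM2r; first exact: enorm_ge0.
rewrite expr2 -mulrA; apply: le_trans h1; rewrite ler_pM2l //.
by apply: le_trans h2; rewrite ler_pM2l.
Qed.

Section Potential.
Variables (phi : P -> R) (G : P -> P).
Hypothesis hphi : C1 phi G.
Hypothesis phi0 : forall z, ~ Omega z -> phi z = 0.

Lemma cont_phi : continuous phi. Proof. by case: hphi. Qed.

Lemma cont_grad2 : continuous (fun y => dotp (G y) (G y)).
Proof. by case: hphi => _ cG _; apply: cont_sum => i; apply: contM; exact: cG. Qed.

Definition trace_term s : R := vint (ohull x s) (fun y => 4 * phi y ^+ 2 + 4 * D2 * dotp (G y) (G y)).

Lemma trace_term_ge0 s : 0 <= trace_term s.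
Proof.
apply: Rintegral_ge0 => y _; rewrite addr_ge0 // mulr_ge0 ?sqr_ge0 ?dotp_sqr_ge0 //.
by rewrite mulr_ge0.
Qed.

(** With h = diam F and j the jump, Young's inequality reads 2 |phi j| <= lam h^-1 j^2 + lam^-1 h
    phi^2. The first term is the weighted jump of the seminorm. In the second, [face_size] bounds J
    h by rho^-2 |vol|, which is what the trace inequality controls. *)
Lemma face_bound F T t p (lam : R) : 0 < lam -> cdim T = 3 -> face_of F T -> valid t p ->
  hull (p |: t)%SET `<=` carrier T -> hull t `<=` carrier F ->
  2 * `|flux t (x p) (fun y => phi y *: (cell_field v T y - peval (hface v F) y *: Defs.normal F))| <=
    lam * ((diam (carrier F))^-1 * jump_int F t T) + lam^-1 * (rho ^- 2 * trace_term (p |: t)%SET).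
Proof.
move=> lam0 T3 FT vp sT tF; have [tS t3] := valid_face cS vp; have /andP[pt stet] := vp.
have F2 := face_dim FT.
have [a [b [c [J [[ab ac bc tE] J0 Jw JE [mt Jg]]]]]] := face_chart F2 tS t3 tF.
have pt' : p \notin tri a b c by rewrite -tE.
have stet' : (p |: tri a b c)%SET \in tets S by rewrite -tE.
have sT' : hull (p |: tri a b c)%SET `<=` carrier T by rewrite -tE.
have [h0 hJ] := face_size T3 FT ab ac bc pt' stet' sT' tE tF.
set h := diam (carrier F) in h0 hJ *.
have cw : contv (fun y => phi y *: (cell_field v T y - peval (hface v F) y *: Defs.normal F)).
  move=> i; under eq_fun do rewrite !mxE; apply: contM; first exact: cont_phi.
  apply: contB; first exact: cont_peval.
  by apply: contM; [exact: cont_peval|exact: cont_cst].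
rewrite tE fluxE //.
have cj := @cont_jump F T.
have cj2 : continuous (fun y => jump F T y ^+ 2) by exact: contX.
have cp2 : continuous (fun y => phi y ^+ 2) by exact/contX/cont_phi.
have le1 : 2 * `|outflux (x p) (x a) (x b) (x c) (fun y => phi y *: (cell_field v T y - peval (hface v F) y *: Defs.normal F))|
    <= tri_int (x a) (x b) (x c) (fun y => (J * lam * h^-1) * jump F T y ^+ 2 + (J * lam^-1 * h) * phi y ^+ 2).
  apply: le_trans (ler_wpM2l _ (norm_outflux _ _ _ _ cw)) _; first by [].
  rewrite -tri_intZ; last by apply: cont_norm; exact: cont_dotp.
  apply: le_tri_int.
  - by apply: contM; [exact: cont_cst|apply: cont_norm; exact: cont_dotp].
  - by apply: contD; apply: contM => //; exact: cont_cst.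
  move=> u _; move: (tri_pt _ _ _ u) => y.
  rewrite dotpZl normrM Jw.
  have -> : dotp (cell_field v T y - peval (hface v F) y *: Defs.normal F) (Defs.normal F) = jump F T y.
    have nn : dotp (Defs.normal F) (Defs.normal F) = 1 by rewrite (orthogonal_dotp _ _ (face_frame F2)) eqxx.
    rewrite /jump; have -> : cell_field v T y - peval (hface v F) y *: Defs.normal F =
       cell_field v T y + (- peval (hface v F) y) *: Defs.normal F by rewrite scaleNr.
    by rewrite dotpDl dotpZl nn mulr1.
  have N (r : R) : r ^+ 2 = `|r| ^+ 2 by rewrite real_normK ?num_real.
  rewrite (N (jump F T y)) (N (phi y)).
  move: `|jump F T y| `|phi y| => j f.
  have -> : J * lam / h * j ^+ 2 + J / lam * h * f ^+ 2 = (J / (lam * h)) * ((lam * j) ^+ 2 + (h * f) ^+ 2).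
    by field; rewrite !gt_eqF.
  have -> : 2 * (f * (J * j)) = (J / (lam * h)) * (2 * (lam * j) * (h * f)).
    by field; rewrite !gt_eqF.
  apply: ler_wpM2l; first by rewrite divr_ge0 ?mulr_ge0 // ltW.
  by have := sqr_ge0 (lam * j - h * f); lra.
apply: le_trans le1 _.
have c1 : continuous (fun y => J * lam / h * jump F T y ^+ 2) by apply: contM => //; exact: cont_cst.
have c2 : continuous (fun y => J / lam * h * phi y ^+ 2) by apply: contM => //; exact: cont_cst.
rewrite (tri_intD _ _ _ c1 c2) !tri_intZ //.
apply: lerD.
  rewrite -tE; have -> : jump_int F t T = J * tri_int (x a) (x b) (x c) (fun y => jump F T y ^+ 2).
    by rewrite /jump_int /Rintegral (Jg _ cj2).
  by rewrite le_eqVlt; apply/orP; left; apply/eqP; ring.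
have -> : J / lam * h * tri_int (x a) (x b) (x c) (fun y => phi y ^+ 2) =
  lam^-1 * (J * h * tri_int (x a) (x b) (x c) (fun y => phi y ^+ 2)) by ring.
apply: ler_wpM2l; first by rewrite invr_ge0 ltW.
have [oE V0] := tet_ohull cS stet' pt' ab ac bc.
have le2 := @trace_inequality R (x p) (x a) (x b) (x c) phi G (4 * D2) hphi V0.
have {}le2 := le2 _; rewrite /trace_term oE.
have stS : (p |: tri a b c)%SET \in simplices S by have /tetsP[] := stet'.
have le3 := le2 (fun y yo => dist_closure
   (hull_closure stS (ohull_hull (eq_ind_r (fun X : set P => X y) yo oE)))
   (hull_closure stS (vertex_hull (setU11 _ _)))).
rewrite -ler_pdivrMl ?invr_gt0 ?exprn_gt0 // invrK; apply: le_trans le3.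
rewrite mulrA; apply: ler_wpM2r; first by apply: tri_int_ge0 => y; exact: sqr_ge0.
by rewrite (mulrC J) JE.
Qed.

Lemma chart_measurable (Q : 'M[R]_3) (o : P) (A : set P) :
  measurable (@vec3 R @^-1` A) -> measurable (chart Q o @^-1` A).
Proof.
move=> mA.
have m i : measurable_fun setT (fun s : R * R => chart Q o s 0 i).
  by under eq_fun do rewrite chart_tri_pt; apply: (measurable_tri _ _ _ (@cont_coord R i)).
have mc : measurable_fun setT (fun s : R * R => unvec3 (chart Q o s)).
  by apply: measurable_fun_pair; [apply: measurable_fun_pair|]; exact: m.
have -> : chart Q o @^-1` A = setT `&` (fun s : R * R => unvec3 (chart Q o s)) @^-1` (@vec3 R @^-1` A).
  by rewrite setTI; apply/seteqP; split => s /=; rewrite unvec3K.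
exact: mc.
Qed.

Lemma chart_integrable (F : cell M) (g : P -> R) : cdim F = 2 -> continuous g ->
  (@leb2 R).-integrable (chart (fframe F) (forigin F) @^-1` carrier F)
    (EFin \o (fun s : R * R => g (chart (fframe F) (forigin F) s))).
Proof.
move=> F2 cg; set Q := fframe F; set o := forigin F.
have oQ := face_frame F2.
have mA : measurable (chart Q o @^-1` carrier F).
  by apply: chart_measurable; apply: closed_measurable_vec3; exact: (closed_cell hM).
have [K bK] := bounded_cell hS F.
have cd i : continuous (fun y : P => dotp (y - o) (row i Q)).
  by apply: cont_dotp => j; under eq_fun do rewrite !mxE; apply: contB; [exact: cont_coord|exact: cont_cst].
have [M0 H0] := continuous_bounded3 K (cd 0).
have [M1 H1] := continuous_bounded3 K (cd 1).
have D z := chart_coord o z oQ.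
have fin1 (k : R) : (@lebesgue_measure R `[(- k)%R, k]%classic) \is a fin_num.
  by rewrite ge0_fin_numE // lebesgue_measure_itv /=; case: ifP => _; rewrite -?EFinB ltry.
have fin : (@leb2 R (chart Q o @^-1` carrier F) < +oo)%E.
  apply: (@le_lt_trans _ _ (@leb2 R (`[(- M0)%R, M0]%classic `*` `[(- M1)%R, M1]%classic))%R).
    apply: le_measure; rewrite ?inE; [exact: mA|exact: measurableX|].
    move=> s /= /bK hs; have [<- <-] := D s.
    by split; rewrite /= in_itv /= -ler_norml; [exact: H0|exact: H1].
  rewrite /leb2 product_measure1E // -ge0_fin_numE ?mule_ge0 //; apply: fin_numM; exact: fin1.
apply: (@measurable_bounded_integrable _ _ _ (@leb2 R) _ _ mA fin).
  apply: measurable_funTS; under eq_fun do rewrite chart_tri_pt; exact: measurable_tri.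
have [N HN] := continuous_bounded3 K cg.
exists N; split; first exact: num_real.
by move=> N' NN' s /= /bK hs; apply: le_trans (ltW NN'); exact: HN.
Qed.

Definition face_part F t : bool :=
  [&& t \in simplices S, #|t| == 3 & `[< hull t `<=` carrier F >]].

Lemma fint_jump F T : cdim F = 2 ->
  \sum_(t | face_part F t) jump_int F t T <= fint F (fun y => jump F T y ^+ 2).
Proof.
move=> F2; rewrite /fint -/(@leb2 R).
have mA : measurable (chart (fframe F) (forigin F) @^-1` carrier F).
  by apply: chart_measurable; apply: closed_measurable_vec3; exact: (closed_cell hM).
have cj : continuous (fun y => jump F T y ^+ 2) by apply: contX; exact: cont_jump.
apply: (@sum_Rintegral_le _ _ _ (@leb2 R) _ (face_part F)
  (fun t => chart (fframe F) (forigin F) @^-1` ohull x t) _ _ mA _ _ _ (chart_integrable F2 cj)).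
- move=> t /and3P[tS /eqP t3 /asboolP tF].
  by have [a [b [c [J [_ _ _ _ []]]]]] := face_chart F2 tS t3 tF.
- move=> t t' s /and3P[tS _ _] /and3P[tS' _ _]; exact: (ohull_disjoint cS).
- move=> t /and3P[tS _ /asboolP tF] s /= st; apply: tF; exact: ohull_hull.
- by move=> s; exact: sqr_ge0.
Qed.

Lemma jump_int_ge0 F t T : 0 <= jump_int F t T.
Proof. by apply: Rintegral_ge0 => s _; exact: sqr_ge0. Qed.

Lemma diam_ge0 (A : set P) : 0 <= diam A.
Proof.
rewrite /diam; have [[r0 [y [z [Ay Az rE]]]]|n] := pselect ([set r | exists y z, [/\ A y, A z & r = enorm (y - z)]] !=set0).
  have [ub|nub] := pselect (has_ubound [set r | exists y z, [/\ A y, A z & r = enorm (y - z)]]).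
    by apply: le_trans (ub_le_sup ub _); [exact: (enorm_ge0 (y - z))|exists y, z].
  (* A set with no supremum has [sup] equal to 0. *)
  by rewrite sup_out // => -[].
by rewrite sup_out // => -[].
Qed.

Variable Tof : {set vertex S} -> cell M.
Hypothesis hTof : forall s, s \in tets S -> cdim (Tof s) = 3 /\ hull s `<=` carrier (Tof s).

(* Only these triangles contribute jumps: the fluxes through the others cancel. *)
Definition separating t p : bool :=
  valid t p && [forall q, valid t q ==> (q != p) ==> (Tof (q |: t)%SET != Tof (p |: t)%SET)].

(** The mesh face containing the triangle is not chosen: all candidates are summed, and by
    nonnegativity any one term can be extracted. *)
Definition face_jumps t p : R :=
  \sum_(F | face_of F (Tof (p |: t)%SET) && face_part F t)
     (diam (carrier F))^-1 * jump_int F t (Tof (p |: t)%SET).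

Lemma face_jumps_ge0 t p : 0 <= face_jumps t p.
Proof. by apply: sumr_ge0 => F _; rewrite mulr_ge0 ?invr_ge0 ?diam_ge0 ?jump_int_ge0. Qed.

Lemma sum_at_most_one (I : finType) (Q : pred I) (c : R) : 0 <= c ->
  (forall i j, Q i -> Q j -> i = j) -> \sum_(i | Q i) c <= c.
Proof.
move=> c0 u; have [i Qi|nQ] := pickP Q; last by rewrite big_pred0.
rewrite (bigD1 i) //= big1 ?addr0 // => j /andP[Qj /eqP ne].
by case: ne; exact: u.
Qed.

(** After exchanging sums, a fixed cell T and triangle t admit at most one separating apex p with
    tetrahedron assigned to T, so no piece of a face is counted twice from the same cell. *)
Lemma total_jump : \sum_t \sum_(p | separating t p) face_jumps t p <=
  \sum_(T : cell M | cdim T == 3) \sum_(F : cell M | face_of F T)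
    (diam (carrier F))^-1 * fint F (fun y => jump F T y ^+ 2).
Proof.
(* All conditions are moved into the summand, so that the four sums range over full types and
   commute. *)
pose f t p T F : R := if [&& separating t p, cdim T == 3, T == Tof (p |: t)%SET, face_of F T & face_part F t]
  then (diam (carrier F))^-1 * jump_int F t T else 0.
have -> : \sum_t \sum_(p | separating t p) face_jumps t p = \sum_t \sum_p \sum_T \sum_F f t p T F.
  apply: eq_bigr => t _; rewrite big_mkcond; apply: eq_bigr => p _; rewrite /f.
  case: ifPn => [sp|_]; last by rewrite big1 // => T _; rewrite big1.
  have /andP[/andP[pt /hTof[T3 _]] _] := sp.
  rewrite (bigD1 (Tof (p |: t)%SET)) //= [X in _ + X]big1 ?addr0; last first.
    by move=> T /negbTE ->; rewrite big1 // => F _; rewrite andbF.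
  by rewrite eqxx T3 eqxx /= /face_jumps big_mkcond.
have -> : \sum_t \sum_p \sum_T \sum_F f t p T F = \sum_T \sum_F \sum_t \sum_p f t p T F.
  under eq_bigr => t _ do rewrite exchange_big.
  rewrite exchange_big /=; apply: eq_bigr => T _.
  under eq_bigr => t _ do rewrite exchange_big.
  by rewrite exchange_big.
rewrite [leRHS]big_mkcond; apply: ler_sum => T _; case: ifPn => [/eqP T3|T3]; last first.
  rewrite big1 // => F _; rewrite big1 // => t _; rewrite big1 // => p _.
  by rewrite /f (negbTE T3) andbF.
rewrite [leRHS]big_mkcond; apply: ler_sum => F _; case: ifPn => [FT|FT]; last first.
  by rewrite big1 // => t _; rewrite big1 // => p _; rewrite /f (negbTE FT) !andbF.
have F2 := face_dim FT.
apply: le_trans (ler_wpM2l _ (fint_jump T F2)); last by rewrite invr_ge0 diam_ge0.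
rewrite mulr_sumr [leRHS]big_mkcond; apply: ler_sum => t _.
case: ifPn => [tF|tF]; last by rewrite big1 // => p _; rewrite /f (negbTE tF) !andbF.
have -> : \sum_p f t p T F = \sum_(p | separating t p && (T == Tof (p |: t)%SET)) (diam (carrier F))^-1 * jump_int F t T.
  by rewrite [RHS]big_mkcond; apply: eq_bigr => p _; rewrite /f T3 eqxx FT tF /= !andbT.
apply: sum_at_most_one; first by rewrite mulr_ge0 ?invr_ge0 ?diam_ge0 ?jump_int_ge0.
move=> p q /andP[sp /eqP Tp] /andP[/andP[vq _] /eqP Tq].
have /andP[_ /forallP /(_ q)] := sp; rewrite vq /= -Tp -Tq eqxx implybF negbK => /eqP.
by move=> ->.
Qed.

Lemma fluxB t (p : P) (w w' : P -> P) : contv w -> contv w' ->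
  flux t p (fun y => phi y *: (w y - w' y)) =
    flux t p (fun y => phi y *: w y) - flux t p (fun y => phi y *: w' y).
Proof.
move=> cw cw'; have cp := cont_phi.
have -> : (fun y => phi y *: (w y - w' y)) = (fun y => phi y *: w y - phi y *: w' y).
  by apply/funext => y; rewrite scalerBr.
by apply: outfluxB => i; under eq_fun do rewrite mxE; exact: contM.
Qed.

Lemma face_sum_bound t (lam : R) : 0 < lam ->
  2 * `|\sum_(p | valid t p) flux t (x p) (fun y => phi y *: cell_field v (Tof (p |: t)%SET) y)| <=
    lam * \sum_(p | separating t p) face_jumps t p +
    lam^-1 * (rho ^- 2 * \sum_(p | valid t p) trace_term (p |: t)%SET).
Proof.
move=> lam0; have cp := cont_phi.
(* Settles the cases with zero flux sum: no tetrahedron over [t], phi zero on [t], or both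
   tetrahedra in one mesh cell. *)
have rhs0 : 0 <= lam * \sum_(p | separating t p) face_jumps t p +
    lam^-1 * (rho ^- 2 * \sum_(p | valid t p) trace_term (p |: t)%SET).
  rewrite addr_ge0 ?mulr_ge0 ?invr_ge0 ?exprn_ge0 ?(ltW lam0) ?(ltW rho0) //.
    by apply: sumr_ge0 => p _; exact: face_jumps_ge0.
  by apply: sumr_ge0 => p _; exact: trace_term_ge0.
have [p0 vp0|nv] := pickP (valid t); last first.
  by rewrite [X in `|X|]big_pred0 // normr0 mulr0.
have [tS t3] := valid_face cS vp0.
have [z0|] := pselect (forall z, hull t z -> phi z = 0).
  rewrite [X in `|X|]big1 ?normr0 ?mulr0 // => p _; apply: flux_vanish => //.
  exact: contv_cell_field.
move=> /existsNP[z /not_implyP[tz nz]].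
have Oz : Omega z by apply: contrapT => /phi0.
have [p [q [pq vp vq E _]]] := valid_pair cS oO covS tS t3 tz Oz.
have qp : q != p by rewrite eq_sym.
have two (V : nmodType) (H : vertex S -> V) : \sum_(r | valid t r) H r = H p + H q.
  rewrite (bigD1 p) //= (bigD1 q) /=; last by rewrite vq.
  rewrite big1 ?addr0 // => r /andP[/andP[vr rp] rq].
  by move: vr; rewrite E (negbTE rp) (negbTE rq).
have [Tp3 sTp] := hTof (proj2 (andP vp)); have [Tq3 sTq] := hTof (proj2 (andP vq)).
have cv T : contv (cell_field v T) by exact: contv_cell_field.
have [TT|TT] := eqVneq (Tof (p |: t)%SET) (Tof (q |: t)%SET).
  have c0 := flux_cancel cS oO covS cp phi0 t (cv (Tof (p |: t)%SET)); rewrite two in c0.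
  by rewrite [X in `|X|]two -TT c0 normr0 mulr0.
have [F [F2 FTp FTq tF]] := interface_face hM hS tS t3 (finset.subsetUr [set p]%SET t) (finset.subsetUr [set q]%SET t)
  Tp3 Tq3 sTp sTq (elimN eqP TT).
have fp : face_part F t by rewrite /face_part tS t3 eqxx; apply/asboolP.
pose w y := peval (hface v F) y *: Defs.normal F.
have cw : contv w.
  by move=> i; under eq_fun do rewrite mxE; apply: contM; [exact: cont_peval|exact: cont_cst].
have sp : separating t p.
  rewrite /separating vp; apply/forallP => r; apply/implyP; rewrite E => /orP[]/eqP ->; first by rewrite eqxx.
  by rewrite qp eq_sym TT.
have sq : separating t q.
  rewrite /separating vq; apply/forallP => r; apply/implyP; rewrite E => /orP[]/eqP ->; last by rewrite eqxx.
  by rewrite pq TT.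
have two' (H : vertex S -> R) : \sum_(r | separating t r) H r = H p + H q.
  rewrite (bigD1 p) //= (bigD1 q) /=; last by rewrite sq.
  rewrite big1 ?addr0 // => r /andP[/andP[/andP[vr _] rp] rq].
  by move: vr; rewrite E (negbTE rp) (negbTE rq).
have bound r : valid t r -> face_of F (Tof (r |: t)%SET) ->
   2 * `|flux t (x r) (fun y => phi y *: (cell_field v (Tof (r |: t)%SET) y - w y))| <=
     lam * face_jumps t r + lam^-1 * (rho ^- 2 * trace_term (r |: t)%SET).
  move=> vr Fr; have [Tr3 sTr] := hTof (proj2 (andP vr)).
  apply: le_trans (face_bound lam0 Tr3 Fr vr sTr tF) _.
  rewrite lerD2r ler_pM2l // /face_jumps (bigD1 F) ?Fr //= lerDl.
  by apply: sumr_ge0 => F' _; rewrite mulr_ge0 ?invr_ge0 ?diam_ge0 ?jump_int_ge0.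
have b1 := bound p vp FTp; have b2 := bound q vq FTq.
have c0 := flux_cancel cS oO covS cp phi0 t cw; rewrite two in c0.
rewrite !fluxB // in b1 b2; rewrite !two two'.
move: b1 b2 c0; set f1 := flux t _ _; set g1 := flux t _ _; set f2 := flux t _ _; set g2 := flux t _ _.
clearbody f1 g1 f2 g2.
move=> b1 b2 c0; have -> : f1 + f2 = (f1 - g1) + (f2 - g2) by rewrite -[LHS]subr0 -c0; ring.
have := ler_normD (f1 - g1) (f2 - g2).
move: b1 b2; rewrite !mulrDr; lra.
Qed.

Let cphi : continuous phi := cont_phi.
Let cphi2 : continuous (fun y => phi y ^+ 2). Proof. exact: contX. Qed.
Let cG i : continuous (fun y => G y 0 i). Proof. by case: hphi. Qed.
Let cG2 : continuous (fun y => dotp (G y) (G y)) := cont_grad2.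

Definition tet_sum (f : P -> R) : R := \sum_(s in tets S) vint (ohull x s) f.

(** The divergence 3 phi^2 + 2 phi G.y has zero total integral, and it is at least 2 phi^2 - D2
    |G|^2 because (phi + G.y)^2 >= 0 and |y|^2 <= D2. *)
Lemma friedrichs : 2 * tet_sum (fun y => phi y ^+ 2) <= D2 * tet_sum (fun y => dotp (G y) (G y)).
Proof.
(* Divergence theorem for phi ^ 2 y. *)
pose w y : P := phi y *: (phi y *: y).
pose Gw i y : P := phi y *: (phi y *: delta_mx 0 i + y 0 i *: G y) + (phi y * y 0 i) *: G y.
have hw i : C1 (fun y => w y 0 i) (Gw i).
  have -> : (fun y => w y 0 i) = (fun y => phi y * (phi y * y 0 i)).
    by apply/funext => y; rewrite !mxE.
  exact: (C1M hphi (C1M hphi (C1_coord R i))).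
have cid : contv (fun y => phi y *: y).
  by move=> i; under eq_fun do rewrite mxE; apply: contM => //; exact: cont_coord.
have E : tet_sum (fun y => \sum_i Gw i y 0 i) = 0.
  rewrite -[RHS](flux_sum0 cS oO covS cphi phi0 cid); apply: eq_bigr => s st.
  exact: (tet_divergence cS st hw).
rewrite -[leLHS]subr0 -E /tet_sum !mulr_sumr -sumrB /=; apply: ler_sum => s st.
have ns := nice_tet cS st.
have cdiv : continuous (fun y => \sum_i Gw i y 0 i) by apply: cont_sum => i; have [_] := hw i.
have c2 : continuous (fun y => 2 * phi y ^+ 2) by apply: contM => //; exact: cont_cst.
have cD : continuous (fun y => D2 * dotp (G y) (G y)) by apply: contM => //; exact: cont_cst.
rewrite -!vintZ // lerBlDr -vintD //; apply: le_vint => //; first exact: contD.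
move=> y ys; have /tetsP[sS _] := st.
have hy := hD2 (hull_closure sS (ohull_hull ys)).
have -> : \sum_i Gw i y 0 i = 3 * phi y ^+ 2 + 2 * (phi y * dotp (G y) y).
  by rewrite sum3 dotpE /Gw !mxE /=; ring.
have := dotp_CS (G y) y; have := sqr_ge0 (phi y + dotp (G y) y).
have := ler_wpM2l (dotp_sqr_ge0 (G y)) hy.
by rewrite sqrrD (mulrC D2); lra.
Qed.

Definition div_part : R :=
  \sum_(T : cell M | cdim T == 3) vint (carrier T) (fun y => cell_div v T y ^+ 2).

Lemma cont_cell_div T : continuous (cell_div v T).
Proof. exact: cont_peval. Qed.

Lemma cell_div_sum : \sum_(s in tets S) vint (ohull x s) (fun y => cell_div v (Tof s) y ^+ 2) <= div_part.
Proof.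
rewrite (partition_big Tof (fun T => cdim T == 3)) /=; last by move=> s /hTof[-> _].
apply: ler_sum => T T3; rewrite /vint -/(@leb3 R).
have mT := closed_measurable_vec3 (closed_cell hM (c := T)).
have [K bK] := bounded_cell hS T.
have cd : continuous (fun y => cell_div v T y ^+ 2) by apply: contX; exact: cont_cell_div.
under eq_bigr => s /andP[_ /eqP ->] do over.
apply: (@sum_Rintegral_le _ _ _ (@leb3 R) _ (fun s => (s \in tets S) && (Tof s == T))
  (fun s => @vec3 R @^-1` ohull x s) _ (fun p => cell_div v T (vec3 p) ^+ 2) mT).
- by move=> s /andP[/(nice_tet cS)[]].
- move=> s t p /andP[/tetsP[sS _] _] /andP[/tetsP[tS _] _]; exact: (ohull_disjoint cS).
- move=> s /andP[st /eqP <-] p /= ps; have [_ sub] := hTof st; apply: sub; exact: ohull_hull.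
- exact: (continuous_integrable3 mT bK cd).
- by move=> p; exact: sqr_ge0.
Qed.

Let cf s := cell_field v (Tof s).

Lemma cont_cf s : continuous (fun y => dotp (cf s y) (G y)).
Proof. by apply: cont_sum => i; apply: contM; [exact: contv_cell_field|]. Qed.

Lemma tet_parts s : s \in tets S ->
  vint (ohull x s) (fun y => dotp (cf s y) (G y)) + vint (ohull x s) (fun y => phi y * cell_div v (Tof s) y) =
  \sum_(p in s) flux (s :\ p)%SET (x p) (fun y => phi y *: cf s y).
Proof.
move=> st; pose Gw i y : P := phi y *: pgrad (hcell v (Tof s) i) y + peval (hcell v (Tof s) i) y *: G y.
have hw i : C1 (fun y => (phi y *: cf s y) 0 i) (Gw i).
  have -> : (fun y => (phi y *: cf s y) 0 i) = (fun y => phi y * peval (hcell v (Tof s) i) y).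
    by apply/funext => y; rewrite !mxE.
  exact: (C1M hphi (peval_C1 _)).
rewrite -(tet_divergence cS st hw) -vintD; [|exact: nice_tet|exact: cont_cf|by apply: contM => //; exact: cont_cell_div].
congr vint; apply/funext => y; rewrite /cell_div /Gw dotpE !sum3 !mxE /peval !mevalD.
by rewrite -!/(peval _ _); ring.
Qed.

Lemma flux_sum_bound (lam : R) : 0 < lam ->
  2 * `|\sum_(s in tets S) \sum_(p in s) flux (s :\ p)%SET (x p) (fun y => phi y *: cf s y)| <=
    lam * (\sum_(T : cell M | cdim T == 3) \sum_(F : cell M | face_of F T)
      (diam (carrier F))^-1 * fint F (fun y => jump F T y ^+ 2)) +
    lam^-1 * (rho ^- 2 * (4 * \sum_(s in tets S) trace_term s)).
Proof.
move=> lam0; rewrite (sum_pairs _ (fun s p => flux (s :\ p)%SET (x p) (fun y => phi y *: cf s y))).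
rewrite (eq_bigr (fun t => \sum_(p | valid t p) flux t (x p) (fun y => phi y *: cf (p |: t)%SET y))); last first.
  by move=> t _; apply: eq_bigr => p /andP[pt _]; rewrite setU1K.
(* Each tetrahedron is met once from each of its four faces. *)
have -> : 4 * \sum_(s in tets S) trace_term s =
    \sum_(t : {set vertex S}) \sum_(p | valid t p) trace_term (p |: t)%SET.
  rewrite -(sum_pairs (tets S) (fun s _ => trace_term s)) mulr_sumr.
  apply: eq_bigr => s /tetsP[_ s4].
  by rewrite sumr_const s4 -[RHS]mulr_natl.
have tj := ler_wpM2l (ltW lam0) total_jump.
apply: le_trans (lerD tj (lexx _)).
apply: (@le_trans _ _ (\sum_(t : {set vertex S}) 2 * `|\sum_(p | valid t p) flux t (x p) (fun y => phi y *: cf (p |: t)%SET y)|)).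
  by rewrite -mulr_sumr ler_pM2l //; exact: ler_norm_sum.
rewrite !mulr_sumr -big_split /=; apply: ler_sum => t _.
by have := face_sum_bound t lam0.
Qed.

Lemma div_sum_bound (lam : R) : 0 < lam ->
  2 * `|\sum_(s in tets S) vint (ohull x s) (fun y => phi y * cell_div v (Tof s) y)| <=
    lam * div_part + lam^-1 * tet_sum (fun y => phi y ^+ 2).
Proof.
move=> lam0; apply: le_trans (lerD (ler_wpM2l (ltW lam0) cell_div_sum) (lexx _)).
apply: (@le_trans _ _ (2 * \sum_(s in tets S) `|vint (ohull x s) (fun y => phi y * cell_div v (Tof s) y)|)).
  by rewrite ler_pM2l //; exact: ler_norm_sum.
rewrite /tet_sum !mulr_sumr -big_split /=; apply: ler_sum => s st.
have ns := nice_tet cS st; set d := cell_div v (Tof s).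
have cd : continuous d by exact: cont_cell_div.
have cd2 : continuous (fun y => d y ^+ 2) by exact: contX.
have ck (k : R) : continuous (fun _ : P => k) by exact: cont_cst.
have c1 : continuous (fun y => lam * d y ^+ 2) by exact: contM.
have c2 : continuous (fun y => lam^-1 * phi y ^+ 2) by exact: contM.
have cpd : continuous (fun y => phi y * d y) by exact: contM.
have Y y : 2 * `|phi y * d y| <= lam * d y ^+ 2 + lam^-1 * phi y ^+ 2.
  rewrite normrM -(real_normK (num_real (d y))) -(real_normK (num_real (phi y))).
  move: `|d y| `|phi y| => j f.
  have -> : lam * j ^+ 2 + lam^-1 * f ^+ 2 = lam^-1 * ((lam * j) ^+ 2 + f ^+ 2) by field; rewrite gt_eqF.
  have -> : 2 * (f * j) = lam^-1 * (2 * (lam * j) * f) by field; rewrite gt_eqF.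
  by rewrite ler_pM2l ?invr_gt0 //; have := sqr_ge0 (lam * j - f); lra.
rewrite -(vintZ _ ns cd2) -(vintZ _ ns cphi2) -vintD //.
rewrite -[2]ger0_norm // -normrM -vintZ // ler_norml lerNl -mulN1r -vintZ //; last exact: contM.
apply/andP; split; apply: le_vint => //.
- by apply: contM => //; exact: contM.
- exact: contD.
- move=> y _; apply: le_trans (Y y); rewrite mulN1r -mulrN ler_pM2l // -normrN; exact: ler_norm.
- exact: contM.
- exact: contD.
- by move=> y _; apply: le_trans (Y y); rewrite ler_pM2l //; exact: ler_norm.
Qed.

Lemma div_seminorm_sqr : div_seminorm v ^+ 2 = div_part +
  \sum_(T : cell M | cdim T == 3) \sum_(F : cell M | face_of F T)
      (diam (carrier F))^-1 * fint F (fun y => jump F T y ^+ 2).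
Proof.
rewrite /div_seminorm sqr_sqrtr ?big_split //=; apply: addr_ge0; apply: sumr_ge0 => T _.
  by apply: Rintegral_ge0 => y _; exact: sqr_ge0.
apply: sumr_ge0 => F _; rewrite mulr_ge0 ?invr_ge0 ?diam_ge0 //.
by apply: Rintegral_ge0 => y _; exact: sqr_ge0.
Qed.

Lemma tet_sum_ge0 f : (forall y, 0 <= f y) -> 0 <= tet_sum f.
Proof. by move=> f0; apply: sumr_ge0 => s _; apply: Rintegral_ge0. Qed.

(** Let N and Q be the integrals of phi^2 and |G|^2. The traces contribute rho^-2 4 (4 N + 4 D2 Q),
    at most 24 rho^-2 D2 Q since 2 N <= D2 Q; the divergence term contributes N, bounded by D2 Q. *)
Lemma mesh_estimate : (\sum_(s in tets S) vint (ohull x s) (fun y => dotp (cf s y) (G y))) ^+ 2 <=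
  div_seminorm v ^+ 2 * ((24 * rho ^- 2 * D2 + D2) * tet_sum (fun y => dotp (G y) (G y))).
Proof.
set A := \sum_(s in _) _; set Q := tet_sum _.
have Q0 : 0 <= Q by apply: tet_sum_ge0 => y; exact: dotp_sqr_ge0.
have r0 : 0 <= rho ^- 2 by rewrite invr_ge0 exprn_ge0 // ltW.
apply: young_optimal; first exact: sqr_ge0.
  by rewrite mulr_ge0 // addr_ge0 // mulr_ge0 // mulr_ge0.
move=> lam lam0; rewrite div_seminorm_sqr.
have l0 : 0 <= lam^-1 by rewrite invr_ge0 ltW.
have b1 := flux_sum_bound lam0; have b2 := div_sum_bound lam0.
have E : A + \sum_(s in tets S) vint (ohull x s) (fun y => phi y * cell_div v (Tof s) y) =
    \sum_(s in tets S) \sum_(p in s) flux (s :\ p)%SET (x p) (fun y => phi y *: cf s y).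
  by rewrite -big_split; apply: eq_bigr => s st; exact: tet_parts.
rewrite -E in b1.
move: b1 b2; set B := \sum_(s in _) vint _ (fun y => phi y * _); set J := \sum_(T | _) \sum_(F | _) _.
set N := tet_sum _; set U := \sum_(s in _) trace_term _ => b1 b2.
have UE : U = 4 * N + 4 * D2 * Q.
  rewrite /N /Q /tet_sum !mulr_sumr -big_split /=; apply: eq_bigr => s st.
  have ns := nice_tet cS st.
  have ck (k : R) : continuous (fun _ : P => k) by exact: cont_cst.
  rewrite -(vintZ _ ns cphi2) -(vintZ _ ns cG2) -vintD //; exact: contM.
have fr : 2 * N <= D2 * Q by exact: friedrichs.
have n1 : `|A| <= `|A + B| + `|B|.
  by rewrite -[X in `|X| <= _](addrK B); exact: ler_normB.
have h1 : rho ^- 2 * (4 * U) <= 24 * rho ^- 2 * D2 * Q.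
  have -> : 24 * rho ^- 2 * D2 * Q = rho ^- 2 * (24 * (D2 * Q)) by ring.
  by apply: ler_wpM2l => //; rewrite UE; lra.
have h2 : N <= D2 * Q by have := mulr_ge0 D20 Q0; lra.
have h3 := ler_wpM2l l0 (lerD h1 h2).
have -> : (24 * rho ^- 2 * D2 + D2) * Q = 24 * rho ^- 2 * D2 * Q + D2 * Q by rewrite mulrDl.
rewrite mulrDr; move: h3 b1 b2 n1; rewrite [lam^-1 * (rho ^- 2 * _ + _)]mulrDr; lra.
Qed.

End Potential.

Hypothesis neO : Omega !=set0.

Lemma tet_cell_choice : exists Tof : {set vertex S} -> cell M,
  forall s, s \in tets S -> cdim (Tof s) = 3 /\ hull s `<=` carrier (Tof s).
Proof.
(* A default cell for the vertex sets that are not tetrahedra. *)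
have [T0 _] : exists T0 : cell M, True.
  have [y Oy] := neO; case: hM => _ _ [E _ _ _] _ _.
  have : closure Omega y by exact: subset_closure.
  by rewrite -E => -[T _ _]; exists T.
suff H (s : {set vertex S}) : exists T : cell M, s \in tets S -> cdim T = 3 /\ hull s `<=` carrier T.
  by have [Tof hTof] := choice H; exists Tof.
have [st|nt] := boolP (s \in tets S); last by exists T0.
by have /tetsP[sS s4] := st; have [T T3 sT] := tet_cell hM hS sS s4; exists T.
Qed.

Lemma duality_estimate phi : test_function Omega phi ->
  L2inner Omega (broken v) (grad phi) ^+ 2 <=
  div_seminorm v ^+ 2 * ((24 * rho ^- 2 * D2 + D2) * L2inner Omega (grad phi) (grad phi)).
Proof.
move=> tphi; have hphi := smooth_C1 (proj1 tphi).
have phi0 z (nz : ~ Omega z) := test_vanish tphi nz.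
have cG i : continuous (fun y => grad phi y 0 i) by have [] := hphi.
have [Tof hTof] := tet_cell_choice.
have mG i : measurable_fun setT ((fun y => grad phi y 0 i) \o @vec3 R).
  exact: continuous_measurable_vec3.
have dot0 (w : P) : dotp w 0 = 0 by rewrite dotpE !mxE !mulr0 !addr0.
have m3 (u w : P -> P) : (forall i, measurable_fun setT ((fun y => u y 0 i) \o @vec3 R)) ->
    (forall i, measurable_fun setT ((fun y => w y 0 i) \o @vec3 R)) ->
    measurable_fun setT ((fun y => dotp (u y) (w y)) \o @vec3 R).
  by move=> mu' mw; apply: measurable_sum => i; apply: measurable_funM; [exact: mu'|exact: mw].
rewrite /L2inner (tet_decomposition hS (h := fun s y => dotp (cell_field v (Tof s) y) (grad phi y))); last 4 first.
- by apply: m3 => // i; exact: measurable_broken.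
- by move=> z /phi0[_ ->].
- by move=> s _; apply: cont_sum => i; apply: contM => //; exact: contv_cell_field.
- move=> s y st ys; have /tetsP[sS s4] := st; have [T3 sT] := hTof s st.
  by rewrite (broken_tet hM hS v sS s4 T3 sT ys).
rewrite (tet_decomposition hS (h := fun _ y => dotp (grad phi y) (grad phi y))) //; last 3 first.
- exact: m3.
- by move=> z /phi0[_ ->].
- by move=> s _; exact: (cont_grad2 hphi).
apply: (mesh_estimate hphi _ hTof).
by move=> z /phi0[].
Qed.

End MeshEstimate.

(** * Projection on the closure of the gradients *)

Section Projection.
Variables (R : realType) (H : lmodType R) (ip : H -> H -> R) (L V : H -> Prop).
Hypothesis LD : forall u w k, L u -> L w -> L (u + k *: w).
Hypothesis VD : forall u w k, V u -> V w -> V (u + k *: w).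
Hypothesis VL : forall u, V u -> L u.
Hypothesis V0 : V 0.
Hypothesis ipC : forall u w, ip u w = ip w u.
Hypothesis ipD : forall u w z k, L u -> L w -> L z -> ip (u + k *: w) z = ip u z + k * ip w z.
Hypothesis ip_ge0 : forall u, 0 <= ip u u.
Hypothesis complete : forall u : nat -> H, (forall n, L (u n)) ->
  (forall n m, (n <= m)%N -> ip (u m + -1 *: u n) (u m + -1 *: u n) <= 8^-1 ^+ n) ->
  exists2 w, L w & forall n, ip (w + -1 *: u n) (w + -1 *: u n) <= 3 * 8^-1 ^+ n.

Lemma ip_sqr u w k : L u -> L w ->
  ip (u + k *: w) (u + k *: w) = ip u u + 2 * k * ip u w + k ^+ 2 * ip w w.
Proof.
move=> hu hw; have hs := LD k hu hw; rewrite ipD // !(ipC _ (u + _)) !ipD // (ipC w u).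
by ring.
Qed.

(** The squares of u + w / lam and u - w / lam are nonnegative, which is the hypothesis of
    [young_optimal]. *)
Lemma ip_CS u w : L u -> L w -> ip u w ^+ 2 <= ip u u * ip w w.
Proof.
move=> hu hw; apply: young_optimal; [exact: ip_ge0|exact: ip_ge0|] => lam l0.
have h k : 0 <= lam^-1 * (ip u u * lam ^+ 2 + 2 * (k * lam) * ip u w + k ^+ 2 * ip w w).
  rewrite mulr_ge0 ?invr_ge0 ?(ltW l0) //.
  have := ip_ge0 (u + (k / lam) *: w); rewrite ip_sqr // => /(mulr_ge0 (exprn_ge0 2 (ltW l0))).
  by congr (_ <= _); field; rewrite gt_eqF.
have := h 1; have := h (-1).
have E k : lam^-1 * (ip u u * lam ^+ 2 + 2 * (k * lam) * ip u w + k ^+ 2 * ip w w) =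
   lam * ip u u + 2 * k * ip u w + k ^+ 2 * (lam^-1 * ip w w) by field; rewrite gt_eqF.
by rewrite !E; case: (ler0P (ip u w)) => _; lra.
Qed.

Lemma le_geometric (X c : R) : (forall n, X <= c * 8^-1 ^+ n) -> X <= 0.
Proof.
move=> h; rewrite leNgt; apply/negP => X0.
have h0 := h 0; rewrite expr0 mulr1 in h0.
have c0 : 0 < c by lra.
have cX : 0 <= c / X by rewrite divr_ge0 // ltW.
have := archi_boundP cX; set n := Num.bound _ => hn.
have n8 : n%:R <= 8 ^+ n :> R by rewrite -natrX ler_nat ltnW // ltn_expl.
have := h n; rewrite exprVn ler_pdivlMr ?exprn_gt0 // => hX.
have : c / X * X < 8 ^+ n * X by rewrite ltr_pM2r //; exact: lt_le_trans n8.
by rewrite divfK ?gt_eqF // mulrC ltNge hX.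
Qed.

(** The setting is that of functions rather than classes: [ip] is bilinear only on [L] and may
    vanish at a nonzero vector, so limits are expressed by explicit rates. The vector w is the limit
    of a minimising sequence in [V] for the distance to b. *)
Theorem projection b : L b -> exists w, [/\ L w, forall u, V u -> ip (b + -1 *: w) u = 0 &
  forall kappa, 0 <= kappa -> (forall u, V u -> ip b u ^+ 2 <= kappa * ip u u) -> ip w w <= kappa].
Proof.
move=> Lb; pose J u := ip (b + -1 *: u) (b + -1 *: u).
pose D := inf [set J u | u in V].
have hlb : has_lbound [set J u | u in V] by exists 0 => _ [u _ <-]; exact: ip_ge0.
have hi : has_inf [set J u | u in V] by split => //; exists (J 0), 0.
have DJ u : V u -> D <= J u by move=> Vu; apply: ge_inf => //; exists u.
(* By the parallelogram law the squared distance of u m and u n is at most 2 e m + 2 e n, hence at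
   most 4 e n = 8^-n, the rate that [complete] expects. *)
pose e n : R := 8^-1 ^+ n / 4.
have e0 n : 0 < e n by rewrite divr_gt0 // exprn_gt0 // invr_gt0.
have [u hu] : exists u : nat -> H, forall n, V (u n) /\ J (u n) <= D + e n.
  suff ex n : exists w, V w /\ J w <= D + e n by have [u hu] := choice ex; exists u.
  by have [_ [w Vw <-] lt] := inf_adherent (e0 n) hi; exists w; split => //; exact: ltW.
have Vu n : V (u n) by have [] := hu n.
have Lu n : L (u n) by apply: VL.
have Ju n : J (u n) <= D + e n by have [] := hu n.
have JE w : L w -> J w = ip b b - 2 * ip b w + ip w w.
  by move=> Lw; rewrite /J ip_sqr //; ring.
have cau n m : (n <= m)%N -> ip (u m + -1 *: u n) (u m + -1 *: u n) <= 8^-1 ^+ n.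
  (* The midpoint, written so that [VD] applies. *)
  move=> nm; pose h := 0 + 2^-1 *: u n + 2^-1 *: u m.
  have Vh : V h by apply: VD => //; apply: VD.
  have Ve : e m <= e n.
    rewrite /e ler_pM2r ?invr_gt0 // ler_wiXn2l //; lra.
  have L0 := VL V0.
  have z0 w : L w -> ip 0 w = 0.
    by move=> Lw; have := ipD (-1) Lw Lw Lw; rewrite scaleN1r subrr => ->; ring.
  have hE w : L w -> ip h w = 2^-1 * ip (u n) w + 2^-1 * ip (u m) w.
    by move=> Lw; rewrite /h (ipD _ (LD _ L0 (Lu n)) (Lu m) Lw) (ipD _ L0 (Lu n) Lw) z0 // add0r.
  have Lh := VL Vh; clearbody h.
  have := DJ _ Vh; have := Ju n; have := Ju m.
  rewrite !JE //.
  rewrite ip_sqr // (ipC b h) !hE //.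
  rewrite !(ipC _ h) !hE // (ipC (u n) b) (ipC (u m) b) (ipC (u m) (u n)).
  have -> : 8^-1 ^+ n = 4 * e n by rewrite /e; field.
  by lra.
have [w Lw wu] := complete Lu cau.
(* A near-minimiser is nearly orthogonal to [V]: J (u n) exceeds the value of J at u n + (k / lam)
   psi by at most e n, for k = 1 and k = -1. *)
have qa n psi : V psi -> ip (b + -1 *: u n) psi ^+ 2 <= e n * ip psi psi.
  move=> Vp; have Lp := VL Vp; have Lbu := LD (-1) Lb (Lu n).
  apply: young_optimal; [exact: ltW|exact: ip_ge0|] => lam l0.
  have h k : 2 * k * ip (b + -1 *: u n) psi <= lam * e n + k ^+ 2 * (lam^-1 * ip psi psi).
    have Vk : V (u n + (k / lam) *: psi) by exact: VD.
    have := DJ _ Vk; have := Ju n; rewrite !JE //; last exact: VL.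
    rewrite ip_sqr // (ipC b (_ + _)) !ipD // (ipC psi b) (ipC (u n) b) => h1 h2.
    have : 0 <= e n - 2 * (k / lam) * (ip b psi - ip (u n) psi) + (k / lam) ^+ 2 * ip psi psi by lra.
    move=> /(mulr_ge0 (ltW l0)).
    have -> : lam * (e n - 2 * (k / lam) * (ip b psi - ip (u n) psi) + (k / lam) ^+ 2 * ip psi psi) =
      lam * e n - 2 * k * (ip b psi - ip (u n) psi) + k ^+ 2 * (lam^-1 * ip psi psi) by field; rewrite gt_eqF.
    by lra.
  by have := h 1; have := h (-1); case: (ler0P (ip (b + -1 *: u n) psi)) => _; lra.
have orth psi : V psi -> ip (b + -1 *: w) psi = 0.
  move=> Vp; have Lp := VL Vp; apply/eqP; rewrite -sqrf_eq0 eq_le sqr_ge0 andbT.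
  (* The squared product is at most 2 (e n + 3 8^-n) |psi|^2, and 2 (1/4 + 3) <= 8. *)
  apply: (@le_geometric _ (8 * ip psi psi)) => n.
  have h1 := qa n psi Vp; have h2 := ip_CS (LD (-1) Lw (Lu n)) Lp.
  have h3 := ler_wpM2r (ip_ge0 psi) (wu n).
  have h4 := mulr_ge0 (ltW (e0 n)) (ip_ge0 psi); rewrite /e in h1 h4.
  have E : ip (b + -1 *: w) psi = ip (b + -1 *: u n) psi - ip (w + -1 *: u n) psi by rewrite !ipD //; ring.
  rewrite E; move: h1 h2 h3 h4; move: (ip (b + _) psi) (ip (w + _) psi) (ip (w + _) (w + _)) => A B N h1 h2 h3 h4.
  by have := sqr_ge0 (A + B); rewrite sqrrB sqrrD; lra.
exists w; split => // kappa k0 hk.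
rewrite -subr_le0; apply: (@le_geometric _ 3) => n.
(* As (w, u n) = (b, u n), the squared distance of w and u n is |w|^2 - 2 (b, u n) + |u n|^2, at
   least |w|^2 - kappa; and it is at most 3 8^-n. *)
have Ln := Lu n; have ob := orth _ (Vu n); rewrite ipD // in ob.
have := wu n; rewrite ip_sqr //.
have : 2 * ip b (u n) <= kappa + ip (u n) (u n).
  have := hk _ (Vu n); have := ip_ge0 (u n); move: (ip b (u n)) (ip (u n) (u n)) => X q q0 hX.
  apply: le_trans (ler_norm _) _; rewrite -ler_sqr ?nnegrE ?addr_ge0 // real_normK ?num_real //.
  by have := sqr_ge0 (kappa - q); nra.
by lra.
Qed.

End Projection.

(** * Completeness of L2 for geometric Cauchy sequences *)

Section RieszFischer.
Context d (T : measurableType d) (R : realType).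
Variables (mu : {measure set T -> \bar R}) (D : set T) (f : nat -> T -> R).
Hypotheses (mD : measurable D) (fD : (mu D < +oo)%E).
Hypothesis mf : forall n, measurable_fun D (f n).
Hypothesis cauchy : forall n m, (n <= m)%N ->
  (\int[mu]_(x in D) ((f m x - f n x) ^+ 2)%:E <= (8^-1 ^+ n)%:E)%E.

Let a n x := (`|f n.+1 x - f n x|)%:E.

Let ma n : measurable_fun D (a n).
Proof. by apply/measurable_EFinP; apply: measurableT_comp => //; exact: measurable_funB. Qed.

Let msqr n m : measurable_fun D (fun x => ((f m x - f n x) ^+ 2)%:E).
Proof. by apply/measurable_EFinP; apply: measurable_funX; exact: measurable_funB. Qed.

Let c := fine (mu D) + 1.

(* From |t| <= 2 ^ -(n + 1) + 2 ^ (n - 1) t ^ 2, using that D has finite measure. *)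
Let int_a n : (\int[mu]_(x in D) a n x <= (c / (2 ^ (n + 1))%:R)%:E)%E.
Proof.
have fin : mu D \is a fin_num by rewrite ge0_fin_numE.
pose k : R := 2^-1 ^+ n.+1; pose K : R := 2 ^+ n / 2.
have k0 : 0 <= k by rewrite exprn_ge0.
have K0 : 0 <= K by rewrite divr_ge0 // exprn_ge0.
have m2 : measurable_fun D (fun x => (K * (f n.+1 x - f n x) ^+ 2)%:E).
  apply/measurable_EFinP; apply: measurable_funM => //; apply: measurable_funX; exact: measurable_funB.
apply: (@le_trans _ _ (\int[mu]_(x in D) (k%:E + (K * (f n.+1 x - f n x) ^+ 2)%:E)))%E.
  apply: ge0_le_integral => //.
  - by move=> x _; rewrite lee_fin.
  - exact: emeasurable_funD.
  - move=> x _; rewrite /a -EFinD lee_fin -(real_normK (num_real (_ - _))).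
    move: (`|_|) => r; have -> : k + K * r ^+ 2 = K * ((2^-1 ^+ n) ^+ 2 + r ^+ 2).
      by rewrite /k /K mulrDr exprS exprVn; field; rewrite expf_neq0.
    rewrite [leLHS](_ : _ = K * (2 * (2^-1 ^+ n) * r)); last by rewrite /K exprVn; field; rewrite expf_neq0.
    by apply: ler_wpM2l => //; have := sqr_ge0 (2^-1 ^+ n - r); rewrite sqrrB; lra.
rewrite ge0_integralD //; last by move=> x _; rewrite lee_fin mulr_ge0 ?sqr_ge0.
rewrite integral_cst //.
under [X in (_ + X)%E]eq_integral do rewrite EFinM.
rewrite ge0_integralZl_EFin //; last by move=> x _; rewrite lee_fin sqr_ge0.
apply: (@le_trans _ _ (k%:E * mu D + K%:E * (8^-1 ^+ n)%:E)%E).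
  by apply: leeD => //; apply: lee_wpmul2l; [rewrite lee_fin|exact: cauchy].
rewrite -(fineK fin) -!EFinM -EFinD lee_fin /c.
have -> : (fine (mu D) + 1) / (2 ^ (n + 1))%:R = k * fine (mu D) + k.
  by rewrite natrX addn1 /k exprVn; ring.
rewrite lerD2l /K /k exprS -mulrAC mulrC ler_pM2l ?invr_gt0 //.
rewrite -exprMn; apply: lerXn2r; rewrite ?nnegrE; lra.
Qed.

(** By [int_a] the increments have summable L1 norms, so their sum is finite almost everywhere and
    the sequence converges there. Fatou's lemma carries the L2 rate to the limit. *)
Lemma riesz_fischer : exists2 g : T -> R, measurable_fun D g &
  forall n, (\int[mu]_(x in D) ((g x - f n x) ^+ 2)%:E <= (8^-1 ^+ n)%:E)%E.
Proof.
pose h x := (\sum_(0 <= n <oo) a n x)%E.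
have a0 n x : (0 <= a n x)%E by rewrite lee_fin.
have mh : measurable_fun D h by apply: ge0_emeasurable_sum.
have h0 x : (0 <= h x)%E by apply: nneseries_ge0.
have ih : mu.-integrable D h.
  apply/integrableP; split => //; under eq_integral do rewrite gee0_abs //.
  rewrite /h integral_nneseries //.
  apply: (@le_lt_trans _ _ (\sum_(0 <= n <oo) (c / (2 ^ (n + 1))%:R)%:E)%E).
    by apply: lee_nneseries => [n _ _|n _]; [apply: integral_ge0|exact: int_a].
  by rewrite (cvg_lim _ (@cvg_geometric_eseries_half _ c 0)) // ltry.
have [N [mN N0 sub]] := integrable_ae mD ih.
(* Set to 0 on the null set, so that the limit exists at every point of D. *)
pose g_ n x := if x \in N then 0 else f n x.
have g_cvg x : D x -> cvgn (g_ ^~ x).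
  move=> Dx; rewrite /g_; case: (boolP (x \in N)) => [_|/negP nN]; first exact: is_cvg_cst.
  have hx : h x \is a fin_num by apply: contrapT => hx; apply: nN; rewrite inE; apply: sub => /(_ Dx).
  have : cvgn (series (telescope (f ^~ x))).
    apply: normed_cvg; apply: nondecreasing_is_cvgn.
      by apply/nondecreasing_seqP => n; rewrite -subr_ge0 seriesSB /=; apply: normr_ge0.
    exists (fine (h x)) => _ [n _ <-]; rewrite -lee_fin fineK // /series /= -sumEFin.
    exact: (nneseries_lim_ge n (fun k _ _ => a0 k x)).
  move=> /cvg_ex[l Cl]; apply/cvg_ex; exists (f 0 x + l).
  have E : f ^~ x = (fun n => f 0 x + series (telescope (f ^~ x)) n).
    by apply/funext => n; exact: (eq_sum_telescope (f ^~ x)).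
  by rewrite E; apply: cvgD; [exact: cvg_cst|exact: Cl].
pose g x := limn (g_ ^~ x).
have mg_ n : measurable_fun D (g_ n).
  have -> : g_ n = (fun x => \1_(~` N) x * f n x).
    apply/funext => x; rewrite /g_ indicE in_setC; case: (x \in N); first by rewrite mul0r.
    by rewrite mul1r.
  apply: measurable_funM => //; apply: measurable_funTS; apply: measurable_indic; exact: measurableC.
have mg : measurable_fun D g by apply: (measurable_fun_cvg mg_) => x Dx; exact: g_cvg.
exists g => // n.
(* The shift by n makes the Cauchy estimate available for every m. *)
pose F m x := ((g_ (m + n)%N x - f n x) ^+ 2)%:E.
have mF m : measurable_fun D (F m).
  by apply/measurable_EFinP; apply: measurable_funX; exact: measurable_funB.
have F0 m x : D x -> (0 <= F m x)%E by move=> _; rewrite lee_fin sqr_ge0.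
have intF m : (\int[mu]_(x in D) F m x <= (8^-1 ^+ n)%:E)%E.
  apply: le_trans (cauchy (leq_addl m n)).
  rewrite le_eqVlt; apply/orP; left; apply/eqP; apply: ae_eq_integral => //.
  exists N; split => // x /= nE; apply: contrapT => nN; apply: nE => _.
  by rewrite /F /g_ memNset.
have limF x : D x -> limn_einf (F ^~ x) = ((g x - f n x) ^+ 2)%:E.
  move=> Dx; apply: (cvg_limn_einf_sup _).1.
  have H : (fun m => g_ (m + n)%N x - f n x) @ \oo --> g x - f n x.
    apply: cvgB; last exact: cvg_cst.
    by move: (g_cvg x Dx) => C; rewrite (cvg_shiftn n (g_ ^~ x)).
  apply: cvg_EFin; first by near=> m.
  exact: (cvgM H H).
have -> : (\int[mu]_(x in D) ((g x - f n x) ^+ 2)%:E = \int[mu]_(x in D) limn_einf (F ^~ x))%E.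
  by apply: eq_integral => x; rewrite inE => /limF.
apply: le_trans (fatou mu mD mF F0) _; rewrite limn_einf_lim.
apply: lime_le; first exact: is_cvg_einfs.
near=> m; apply: le_trans (intF m); apply: ereal_inf_lbound.
by exists m => //=.
Unshelve. all: by end_near.
Qed.

End RieszFischer.

Section L2Fields.
Variable R : realType.
Local Notation P := 'rV[R]_3.
Variables (D : set P) (K : R).
Hypotheses (mD : measurable (@vec3 R @^-1` D)) (bD : bounded3 K D).
Implicit Types (f g h : P -> R) (u w z : P -> P).
Local Notation pre := (@vec3 R @^-1` D).

Lemma L2fun_sqrP f : measurable_fun pre (f \o @vec3 R) ->
  (@leb3 R).-integrable pre (EFin \o ((fun y => f y ^+ 2) \o @vec3 R)) -> L2fun D f.
Proof.
move=> mf /integrableP[_ h]; split => //; move: h; congr (_ < _)%E; apply: eq_integral => p _.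
by rewrite /= ger0_norm // sqr_ge0.
Qed.

Lemma bounded_L2fun f : measurable_fun setT (f \o @vec3 R) ->
  (exists M, forall y, D y -> `|f y| <= M) -> L2fun D f.
Proof.
move=> mf [M HM]; apply: L2fun_sqrP; first exact: measurable_funTS.
apply: (bounded_integrable3 mD bD).
  by apply: measurable_funTS; apply: measurable_funX.
exists (M ^+ 2) => y /HM hy; rewrite normrX ler_sqr ?nnegrE //.
exact: le_trans hy.
Qed.

Lemma continuous_L2fun f : continuous f -> L2fun D f.
Proof.
move=> cf; apply: bounded_L2fun; first exact: continuous_measurable_vec3.
by have [M HM] := continuous_bounded3 K cf; exists M => y /bD; exact: HM.
Qed.

Lemma L2fun_integrableM f g : L2fun D f -> L2fun D g ->
  (@leb3 R).-integrable pre (EFin \o ((fun y => f y * g y) \o @vec3 R)).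
Proof.
move=> [mf f2] [mg g2].
have sq h : measurable_fun pre (fun p => h (vec3 p)) ->
    (\int[@leb3 R]_(p in pre) (h (vec3 p) ^+ 2)%:E < +oo)%E ->
    (@leb3 R).-integrable pre (EFin \o ((fun y => h y ^+ 2) \o @vec3 R)).
  move=> mh h2; apply/integrableP; split.
    by apply/measurable_EFinP; exact: measurable_funX.
  move: h2; congr (_ < _)%E; apply: eq_integral => p _.
  by rewrite /= ger0_norm // sqr_ge0.
have i1 := sq f mf f2; have i2 := sq g mg g2.
have := @integrableD _ _ _ (@leb3 R) _ mD _ _ i1 i2.
apply: le_integrable => //; first by apply/measurable_EFinP; exact: measurable_funM.
move=> p _; rewrite /= lee_fin [leRHS]ger0_norm ?addr_ge0 ?sqr_ge0 // normrM.
rewrite -(real_normK (num_real (f (vec3 p)))) -(real_normK (num_real (g (vec3 p)))).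
have := sqr_ge0 (`|f (vec3 p)| - `|g (vec3 p)|); have := sqr_ge0 (`|f (vec3 p)|).
have := sqr_ge0 (`|g (vec3 p)|); rewrite sqrrB; lra.
Qed.

Lemma L2fun_integrable_sqr f : L2fun D f ->
  (@leb3 R).-integrable pre (EFin \o ((fun y => f y ^+ 2) \o @vec3 R)).
Proof. by move=> hf; exact: (L2fun_integrableM hf hf). Qed.

Lemma L2funD f g k : L2fun D f -> L2fun D g -> L2fun D (fun y => f y + k * g y).
Proof.
move=> hf hg; have [mf _] := hf; have [mg _] := hg.
apply: L2fun_sqrP; first by apply: measurable_funD => //; exact: measurable_funM.
have i1 := L2fun_integrable_sqr hf; have i2 := L2fun_integrable_sqr hg.
have i3 := @integrableZl _ _ _ (@leb3 R) _ mD (2 * k ^+ 2) _ i2.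
have i4 := @integrableZl _ _ _ (@leb3 R) _ mD 2 _ i1.
have := @integrableD _ _ _ (@leb3 R) _ mD _ _ i4 i3.
apply: le_integrable => //.
  apply/measurable_EFinP; apply: measurable_funX; apply: measurable_funD => //; exact: measurable_funM.
move=> p _; rewrite /= lee_fin ger0_norm ?sqr_ge0 // [leRHS]ger0_norm; last first.
  by rewrite -mulrA -mulrDr mulr_ge0 // addr_ge0 ?sqr_ge0 // -exprMn sqr_ge0.
by have := sqr_ge0 (f (vec3 p) - k * g (vec3 p)); rewrite sqrrB sqrrD exprMn; lra.
Qed.

Lemma L2fieldD u w k : L2field D u -> L2field D w -> L2field D (u + k *: w).
Proof.
move=> hu hw i; have := L2funD k (hu i) (hw i); congr L2fun.
by apply/funext => y; rewrite !mxE.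
Qed.

Lemma L2field_integrable u w : L2field D u -> L2field D w ->
  (@leb3 R).-integrable pre (EFin \o ((fun y => dotp (u y) (w y)) \o @vec3 R)).
Proof.
move=> hu hw.
have -> : EFin \o ((fun y => dotp (u y) (w y)) \o @vec3 R) =
  (fun p => \sum_i (EFin \o ((fun y => u y 0 i * w y 0 i)%R \o @vec3 R)) p)%E.
  by apply/funext => p /=; rewrite sumEFin.
by apply: (@integrable_sum _ _ _ (@leb3 R) _ mD) => i _; exact: L2fun_integrableM.
Qed.

Lemma L2innerC u w : L2inner D u w = L2inner D w u.
Proof. by rewrite /L2inner; congr vint; apply/funext => y; rewrite !dotpE; ring. Qed.

Lemma L2inner_ge0 u : 0 <= L2inner D u u.
Proof. by apply: Rintegral_ge0 => y _; exact: dotp_sqr_ge0. Qed.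

Lemma L2innerD u w z k : L2field D u -> L2field D w -> L2field D z ->
  L2inner D (u + k *: w) z = L2inner D u z + k * L2inner D w z.
Proof.
move=> hu hw hz; have i1 := L2field_integrable hu hz; have i2 := L2field_integrable hw hz.
have i3 := @integrableZl _ _ _ (@leb3 R) _ mD k _ i2.
rewrite /L2inner /vint -/(@leb3 R).
rewrite -(@RintegralZl _ _ _ (@leb3 R) _ _ _ mD i2) -(@RintegralD _ _ _ (@leb3 R) _ _ _ mD i1 i3).
by apply: eq_Rintegral => p _; rewrite /= -[(u + k *: w) _]/(u _ + k *: w _) !dotpE !mxE; ring.
Qed.

Lemma vint_sqrE f : L2fun D f ->
  (\int[@leb3 R]_(p in pre) (f (vec3 p) ^+ 2)%:E)%E = (vint D (fun y => f y ^+ 2))%:E.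
Proof.
move=> hf; rewrite /vint -/(@leb3 R) /Rintegral fineK //.
exact: (@integrable_fin_num _ _ _ (@leb3 R) _ mD _ (L2fun_integrable_sqr hf)).
Qed.

Lemma L2inner_sqrE u : L2field D u -> L2inner D u u = \sum_i vint D (fun y => u y 0 i ^+ 2).
Proof.
move=> hu; have i0 := L2fun_integrable_sqr (hu 0); have i1 := L2fun_integrable_sqr (hu 1).
have i2 := L2fun_integrable_sqr (hu ord_max).
rewrite /L2inner sum3 /vint -/(@leb3 R).
rewrite -(@RintegralD _ _ _ (@leb3 R) _ _ _ mD i0 i1).
rewrite -(@RintegralD _ _ _ (@leb3 R) _ _ _ mD (@integrableD _ _ _ (@leb3 R) _ mD _ _ i0 i1) i2).
by apply: eq_Rintegral => p _; rewrite /= dotpE.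
Qed.

(** Riesz-Fischer is applied to each component, and the three rates add up to the factor 3. *)
Lemma L2field_complete (u : nat -> P -> P) : (forall n, L2field D (u n)) ->
  (forall n m, (n <= m)%N -> L2inner D (u m + -1 *: u n) (u m + -1 *: u n) <= 8^-1 ^+ n) ->
  exists2 w, L2field D w & forall n, L2inner D (w + -1 *: u n) (w + -1 *: u n) <= 3 * 8^-1 ^+ n.
Proof.
move=> hu cau.
have fD := measure_bounded3_lty mD bD.
have ex i : exists g : R * R * R -> R, measurable_fun pre g /\
    forall n, (\int[@leb3 R]_(p in pre) ((g p - u n (vec3 p) 0 i) ^+ 2)%:E <= (8^-1 ^+ n)%:E)%E.
  have [] := @riesz_fischer _ _ _ (@leb3 R) pre (fun n p => u n (vec3 p) 0 i) mD fD.
  - by move=> n; have [] := hu n i.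
  - move=> n m nm; have hd := L2fieldD (-1) (hu m) (hu n).
    have -> : (\int[@leb3 R]_(p in pre) ((u m (vec3 p) 0 i - u n (vec3 p) 0 i) ^+ 2)%:E)%E =
        (vint D (fun y => (u m + -1 *: u n) y 0 i ^+ 2))%:E.
      rewrite -(vint_sqrE (hd i)); apply: eq_integral => p _; congr (_ ^+ 2)%:E.
      by rewrite !mxE mulN1r.
    rewrite lee_fin; apply: le_trans (cau n m nm); rewrite (L2inner_sqrE hd) (bigD1 i) //= lerDl.
    by apply: sumr_ge0 => j _; apply: Rintegral_ge0 => p _; exact: sqr_ge0.
  - by move=> g mg hg; exists g.
have [g hg] := choice ex; pose w y : P := \row_i g i (unvec3 y).
have wE p i : w (vec3 p) 0 i = g i p by rewrite /w mxE vec3K.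
have dE n i p : (w + -1 *: u n) (vec3 p) 0 i = g i p - u n (vec3 p) 0 i.
  by rewrite -wE !mxE mulN1r.
have hdn n : L2field D (w + -1 *: u n).
  move=> i; have [mg ig] := hg i; split.
    under eq_fun do rewrite dE; apply: measurable_funB => //; by have [] := hu n i.
  under eq_integral do rewrite dE.
  by apply: le_lt_trans (ig n) _; exact: ltry.
have hw : L2field D w.
  have := L2fieldD 1 (hdn 0) (hu 0); congr L2field.
  by apply/funext => y; rewrite scaleN1r scale1r subrK.
exists w => // n; rewrite (L2inner_sqrE (hdn n)).
have le1 i : vint D (fun y => (w + -1 *: u n) y 0 i ^+ 2) <= 8^-1 ^+ n.
  rewrite -lee_fin -(vint_sqrE (hdn n i)).
  have [_ /(_ n)] := hg i; apply: le_trans; rewrite le_eqVlt; apply/orP; left; apply/eqP.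
  by apply: eq_integral => p _; rewrite dE.
by rewrite sum3; have := le1 0; have := le1 1; have := le1 ord_max; lra.
Qed.

End L2Fields.

(** * Approximation by divergence-free fields *)

Section Conformity.
Variable R : realType.
Local Notation P := 'rV[R]_3.

Lemma bounded_set3 (Omega : set P) : bounded_set Omega -> exists K, bounded3 K Omega.
Proof.
move=> [M [_ HM]]; exists (M + 1) => y Oy i; apply: le_trans (HM (M + 1) _ y Oy); last by rewrite ltrDl.
rewrite -[`|y|]/(mx_norm y) mx_normrE; exact: (le_bigmax _ (fun ij : 'I_1 * 'I_3 => `|y ij.1 ij.2|) (0, i)).
Qed.

Lemma bounded_closure (Omega : set P) K : bounded3 K Omega ->
  forall y, closure Omega y -> dotp y y <= 3 * K ^+ 2.
Proof.
move=> bO; have cd : continuous (fun y : P => dotp y y).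
  by apply: cont_sum => i; apply: contM; exact: cont_coord.
pose A := (fun y : P => dotp y y) @^-1` [set r | r <= 3 * K ^+ 2].
have cl : closed A by apply: (@closed_comp _ _ (fun y : P => dotp y y)) => [y _|]; [exact: cd|exact: closed_le].
suff sub : closure Omega `<=` A by move=> y /sub.
rewrite [A in _ `<=` A](closure_id A).1 //; apply: closure_subset => y /bO hy; rewrite /A /=.
have H i : y 0 i ^+ 2 <= K ^+ 2.
  rewrite -(real_normK (num_real (y 0 i))) ler_sqr ?nnegrE //; exact: le_trans (hy i).
by rewrite dotpE -!expr2; have := H 0; have := H 1; have := H ord_max; lra.
Qed.

Lemma broken_L2field Omega K (M : mesh R) (v : hybrid M) : measurable (@vec3 R @^-1` Omega) ->
  bounded3 K Omega -> L2field Omega (broken v).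
Proof.
move=> mO bO i; apply: (bounded_L2fun mO bO); first exact: measurable_broken.
have ex T := continuous_bounded3 K (@cont_peval R (hcell v T i)).
have [N HN] := choice ex.
exists (\sum_(T : cell M | cdim T == 3) N T) => y /bO yK; rewrite /broken summxE.
apply: le_trans (ler_norm_sum _ _ _) _; apply: ler_sum => T _.
rewrite !mxE normrM; apply: le_trans (HN T y yK); rewrite ler_piMl // indicE.
by case: (_ \in _); rewrite ?normr1 ?normr0.
Qed.

(** With z = b - w, orthogonality to the gradients is the vanishing of the weak divergence of z, and
    the last clause of [projection] bounds the distance because b - z = w. *)
Lemma solenoidal_approximation (Omega : set P) (kappa : R) (b : P -> P) :
  open Omega -> bounded_set Omega -> L2field Omega b -> 0 <= kappa ->
  (forall phi, test_function Omega phi ->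
     L2inner Omega b (grad phi) ^+ 2 <= kappa * L2inner Omega (grad phi) (grad phi)) ->
  exists2 z, Zdiv Omega z & L2field Omega z /\ L2inner Omega (b + -1 *: z) (b + -1 *: z) <= kappa.
Proof.
move=> oO bO Lb k0 hb; have [K bK] := bounded_set3 bO.
have mO := open_measurable_vec3 oO.
pose V u := exists2 phi, test_function Omega phi & u = grad phi.
have VD u w k : V u -> V w -> V (u + k *: w).
  move=> [f tf ->] [g tg ->]; exists (fun y => f y + k * g y); first exact: test_functionD.
  by apply/funext => y; rewrite gradD //; [case: tf|case: tg].
have VL u : V u -> L2field Omega u.
  move=> [f [sf _] ->] i; apply: (continuous_L2fun mO bK).
  by have [_ + _] := smooth_C1 sf; exact.
have V0 : V 0.
  exists (fun=> 0); first exact: test_function0.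
  apply/funext => y; apply/rowP => i; rewrite !mxE /partial.
  by rewrite -[fun=> 0]/(cst (0 : R)) derive_cst.
have [w [Lw orth le]] := projection (L2fieldD mO) VD VL V0 (L2innerC Omega) (L2innerD mO)
  (L2inner_ge0 Omega) (L2field_complete mO bK) Lb.
have Lz : L2field Omega (b + -1 *: w) by exact: L2fieldD.
exists (b + -1 *: w); last split => //.
  have c0 : L2fun Omega (fun=> 0 : R) by apply: (continuous_L2fun mO bK); exact: cont_cst.
  have wd : weak_div Omega (b + -1 *: w) (fun=> 0).
    move=> phi tphi; rewrite -[LHS]/(L2inner Omega (b + -1 *: w) (grad phi)) orth; last by exists phi.
    under [X in vint Omega X]eq_fun do rewrite mul0r.
    by rewrite /vint /Rintegral integral0 oppr0.
  by split => //; split => //; exists (fun=> 0).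
have -> : b + -1 *: (b + -1 *: w) = w by apply/funext => y; vec_ring.
by apply: le => // u [phi tphi ->]; exact: hb.
Qed.

End Conformity.

Theorem corollary45 (R : realType) (Omega : set 'rV[R]_3) (l : nat) (rho : R) :
  lipschitz_polyhedral_domain Omega -> 0 < rho < 1 ->
  exists C : R,
    forall (M : mesh R) (S : complex R),
      is_mesh Omega M -> simplicial_submesh Omega M S -> regular_mesh rho M S ->
      (forall v : hybrid M, hybrid_deg l v ->
         inf [set L2norm Omega (fun x => broken v x - z x) | z in Zdiv Omega]
           <= C * div_seminorm v) /\
      (forall v : hybrid M, hybrid_deg l v ->
         (forall z, Zdiv Omega z -> L2inner Omega (broken v) z = 0) ->
         L2norm Omega (broken v) <= C * div_seminorm v).
Proof.
move=> [[oO _] neO bO _ _] /andP[rho0 _].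
have [K bK] := bounded_set3 bO; have hD2 := bounded_closure bK.
have mO := open_measurable_vec3 oO.
have D20 : 0 <= 3 * K ^+ 2 by rewrite mulr_ge0 // sqr_ge0.
(* The constant of [duality_estimate] with D2 = 3 K^2, fixed before the mesh is introduced; K bounds
   the coordinates on Omega. *)
pose kappa := 24 * rho ^- 2 * (3 * K ^+ 2) + 3 * K ^+ 2.
have k0 : 0 <= kappa by rewrite addr_ge0 // mulr_ge0 // mulr_ge0 // invr_ge0 exprn_ge0 // ltW.
exists (Num.sqrt kappa) => M S hM hS hR.
have main (v : hybrid M) : exists2 z, Zdiv Omega z & L2field Omega z /\
    L2norm Omega (broken v + -1 *: z) <= Num.sqrt kappa * div_seminorm v.
  have Lv := broken_L2field v mO bK.
  have [|phi tphi|z Zz [Lz hz]] := solenoidal_approximation oO bO Lv (kappa := div_seminorm v ^+ 2 * kappa).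
  - by rewrite mulr_ge0 // sqr_ge0.
  - by rewrite -mulrA; exact: (duality_estimate hM hS hR rho0 D20 hD2 oO v neO tphi).
  exists z => //; split => //; have s0 : 0 <= div_seminorm v by exact: sqrtr_ge0.
  have -> : Num.sqrt kappa * div_seminorm v = Num.sqrt (div_seminorm v ^+ 2 * kappa).
    by rewrite sqrtrM ?sqr_ge0 // sqrtr_sqr ger0_norm // mulrC.
  by rewrite ler_wsqrtr.
have E (v : hybrid M) z : broken v + -1 *: z = (fun x => broken v x - z x).
  by apply/funext => y; rewrite scaleN1r.
split=> v _; have [z Zz [Lz hz]] := main v.
  apply: le_trans hz; rewrite E; apply: ge_inf; last by exists z.
  by exists 0 => _ [u _ <-]; exact: sqrtr_ge0.
(* Pythagoras: v_h is orthogonal to z, so the squared norm of v_h - z is the sum of those of v_h and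
   z. *)
move=> ob; apply: le_trans hz; rewrite ler_wsqrtr //.
have Lv := broken_L2field v mO bK; have zz := L2inner_ge0 Omega z.
have Lw := L2fieldD mO (-1) Lv Lz.
rewrite (ip_sqr (L2fieldD mO) (L2innerC Omega) (L2innerD mO)) // (ob z) //.
by rewrite mulr0 addr0 sqrrN expr1n mul1r lerDl.
Qed.
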